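(* Let $\mathscr{C}$ be a spacelike cone contained in $(\mathscr{S}_a+x)'$ for some $x\in\mathbb{M}^3$. Every BF representation $\eta$ of $\mathfrak{A}$ localised in $\mathscr{C}$ can be extended to a BF representation $\widehat\eta$ of $\mathfrak{F}$ localised in $\mathscr{C}$ (i.e. $\widehat\eta(\pi(A))=\pi^{\mathscr{S}_a}(\eta(A))$ for all $A\in\mathfrak{A}$) that commutes with the $G$-action, i.e. $\alpha_g\circ\widehat\eta=\widehat\eta\circ\alpha_g$ for all $g\in G$. This extension is unique.
   Context: $\mathbb{M}^3$ is 3-dimensional Minkowski space. For a region $\mathscr{S}$, $\mathscr{S}'$ is its causal (spacelike) complement; for a set of operators, a prime denotes the commutant. A spacelike cone is a set $\mathscr{C}=x+\bigcup_{\lambda>0}\lambda\cdot\mathcal{O}$ with $\mathcal{O}$ a double cone not containing the origin, $x\in\mathbb{M}^3$, and $\mathscr{C}=\mathscr{C}''$. All representations and endomorphisms are unital and $*$-preserving. Observable net: $\mathcal{O}\mapsto\mathfrak{A}(\mathcal{O})$ assigns to each double cone a von Neumann algebra on a Hilbert space $\mathcal{H}_0$ (we work in the vacuum representation $\pi_0$, which is faithful and identified with the identity), different from $\mathbb{C}I$, such that: isotony holds; algebras of spacelike separated double cones commute; there is a strongly continuous unitary representation $\mathcal{U}_0$ of the translation group with $\mathcal{U}_0(x)\mathfrak{A}(\mathcal{O})\mathcal{U}_0(x)^*=\mathfrak{A}(\mathcal{O}+x)$, joint spectrum of the generators in the closed forward light cone, and an up to phase unique invariant unit vector $\Omega$.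 $\mathfrak{A}$ is the norm closure of $\bigcup_{\mathcal{O}}\mathfrak{A}(\mathcal{O})$ and acts irreducibly. For an unbounded region $\mathscr{S}$, $\mathfrak{A}(\mathscr{S})$ is the norm closure of $\bigcup_{\mathcal{O}\subset\mathscr{S}}\mathfrak{A}(\mathcal{O})$. Haag duality: $\mathfrak{A}(\mathscr{S}')'=\mathfrak{A}(\mathscr{S})''$ for $\mathscr{S}$ a double cone or a spacelike cone. A DHR representation is a representation $\pi'$ of $\mathfrak{A}$ with $\pi'\upharpoonright\mathfrak{A}(\mathcal{O}')\cong\pi_0\upharpoonright\mathfrak{A}(\mathcal{O}')$ for every double cone $\mathcal{O}$. Standing assumptions: $\mathfrak{A}$ has at most countably many DHR sectors, none of them fermionic, and every DHR sector with finite statistics is translation covariant with the spectrum condition. BF representations: a BF representation is a representation $\eta$ of $\mathfrak{A}$ such that for every spacelike cone $\widehat{\mathscr{C}}$ the restrictions $\eta\upharpoonright\mathfrak{A}(\widehat{\mathscr{C}}')$ and $\pi_0\upharpoonright\mathfrak{A}(\widehat{\mathscr{C}}')$ are unitarily equivalent. It is localised in $\mathscr{C}$ if it acts on $\mathcal{H}_0$ and $\eta(A)=A$ for $A\in\mathfrak{A}(\mathscr{C}')$. Fix an auxiliary spacelike cone $\mathscr{S}_a$ and let $\mathfrak{A}^{\mathscr{S}_a}$ be the norm closure of $\bigcup_{x\in\mathbb{M}^3}\mathfrak{A}((\mathscr{S}_a+x)')''$. If $\eta$ is localised in a cone $\mathscr{C}\subset(\mathscr{S}_a+x)'$ then $\eta(\mathfrak{A})\subset\mathfrak{A}^{\mathscr{S}_a}$.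 Only BF representations with finite statistical dimension (equivalently, possessing a conjugate) are considered. Field net: $(\pi,G,\mathfrak{F})$ is the complete normal field net of $\mathfrak{A}$ with respect to the DHR sectors: a representation $(\pi,\mathcal{H})$ of $\mathfrak{A}$ and a net $\mathcal{O}\mapsto\mathfrak{F}(\mathcal{O})$ of von Neumann algebras on $\mathcal{H}$ such that: $\mathcal{H}_0\subset\mathcal{H}$; $\pi_0$ is a subrepresentation of $\pi$; $G$ is a compact group of unitaries on $\mathcal{H}$ leaving $\mathcal{H}_0$ pointwise fixed, with action $\alpha_g=\operatorname{Ad}g$; each $\alpha_g$ is an automorphism of $\mathfrak{F}(\mathcal{O})$, with fixed-point algebra $\pi(\mathfrak{A}(\mathcal{O}))$; $\mathfrak{F}$, the norm closure of $\bigcup_{\mathcal{O}}\mathfrak{F}(\mathcal{O})$, is irreducible; $\mathcal{H}_0$ is cyclic for each $\mathfrak{F}(\mathcal{O})$; $\mathfrak{F}(\mathcal{O}_1)$ and $\mathfrak{F}(\mathcal{O}_2)$ commute for spacelike separated $\mathcal{O}_1,\mathcal{O}_2$; every irreducible DHR representation with finite statistics is a subrepresentation of $\pi$. It exists and is unique up to equivalence. $\pi^{\mathscr{S}_a}:\mathfrak{A}^{\mathscr{S}_a}\to\mathcal{B}(\mathcal{H})$ is the unique (faithful) extension of $\pi$ that is weakly continuous on each $\mathfrak{A}((\mathscr{S}_a+x)')''$. Under the standing assumptions $\mathfrak{F}$ is itself a net satisfying the assumptions made on $\mathfrak{A}$ (locality, covariance, spectrum condition, Haag duality); BF representations of $\mathfrak{F}$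 and their localisation are defined exactly as for $\mathfrak{A}$, with $(\mathfrak{F},\mathcal{H})$ in place of $(\mathfrak{A},\mathcal{H}_0)$ and vacuum representation the identity. *)

(* Defs.v *)
From HB Require Import structures.
From mathcomp Require Import all_boot all_order all_algebra.
From mathcomp Require Import sesquilinear.
From mathcomp Require Import all_classical all_reals all_analysis.
From mathcomp Require Import complex.

Set Implicit Arguments.
Unset Strict Implicit.
Unset Printing Implicit Defensive.

Import Order.TTheory GRing.Theory Num.Theory numFieldNormedType.Exports.

Local Open Scope classical_set_scope.
Local Open Scope ring_scope.
Local Open Scope complex_scope.

(* A complex Hilbert space; the inner product is linear in its first argument
   and conjugate-linear in the second one. *)
Record hilbertSpace (R : realType) := HilbertSpace {
  hilbert_sort :> completeNormedModType R[i] ;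
  inner : {dot hilbert_sort for Num.conj} ;
  inner_normE : forall x, `|x| ^+ 2 = inner x x }.

Section Operators.
Variable R : realType.
Implicit Types H K L : hilbertSpace R.

Definition bounded_op H K (A : H -> K) : Prop :=
  linear A /\ exists M : R[i], forall x, `|A x| <= M * `|x|.

Definition is_adjoint H K (A : H -> K) (B : K -> H) : Prop :=
  forall x y, inner K (A x) y = inner H x (B y).

(* Every bounded operator has exactly one adjoint (Riesz), which is the value
   selected here; on other functions the value is irrelevant. *)
Definition adj H K (A : H -> K) : K -> H := get [set B | is_adjoint A B].

Definition isometric_op H K (V : H -> K) : Prop :=
  linear V /\ forall x y, inner K (V x) (V y) = inner H x y.

Definition unitary_op H K (U : H -> K) : Prop :=
  isometric_op U /\ range U = setT.

Definition Ad H (U A : H -> H) : H -> H := U \o A \o adj U.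

Definition scalar_ops H : set (H -> H) := [set A | exists c : R[i], A = c *: idfun].

Definition commutant H (S : set (H -> H)) : set (H -> H) :=
  [set B | bounded_op B /\ forall A, S A -> A \o B = B \o A].

Definition bicommutant H (S : set (H -> H)) := commutant (commutant S).

Definition von_neumann_algebra H (M : set (H -> H)) : Prop :=
  (forall A, M A -> M (adj A)) /\ bicommutant M = M.

Definition norm_closure H (S : set (H -> H)) : set (H -> H) :=
  [set A | bounded_op A /\ forall e : R[i], 0 < e ->
    exists2 B, S B & forall x, `|A x - B x| <= e * `|x|].

(* [rho] is a unital *-representation on [K] of the *-algebra [M]; its values
   outside [M] are irrelevant. *)
Record representation H (M : set (H -> H)) K (rho : (H -> H) -> (K -> K))
    : Prop := Representation {
  rep_bounded : forall A, M A -> bounded_op (rho A) ;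
  rep_unital : rho idfun = idfun ;
  rep_add : forall A B, M A -> M B -> rho (A + B) = rho A + rho B ;
  rep_scale : forall (c : R[i]) A, M A -> rho (c *: A) = c *: rho A ;
  rep_mul : forall A B, M A -> M B -> rho (A \o B) = rho A \o rho B ;
  rep_adj : forall A, M A -> rho (adj A) = adj (rho A) }.

Definition endomorphism H (M : set (H -> H)) (rho : (H -> H) -> (H -> H)) :=
  representation M rho /\ forall A, M A -> M (rho A).

Definition equivalent_on H (M : set (H -> H)) K L
    (rho : (H -> H) -> (K -> K)) (sigma : (H -> H) -> (L -> L)) : Prop :=
  exists2 U : K -> L, unitary_op U & forall A, M A -> U \o rho A = sigma A \o U.

Definition subrepresentation H (M : set (H -> H)) K L
    (rho : (H -> H) -> (K -> K)) (sigma : (H -> H) -> (L -> L)) : Prop :=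
  exists2 V : K -> L, isometric_op V & forall A, M A -> V \o rho A = sigma A \o V.

Definition irreducible H (S : set (H -> H)) : Prop := commutant S = @scalar_ops H.

(* Continuity on [M] for the weak operator topologies. *)
Definition weakly_continuous_on H (M : set (H -> H)) K
    (rho : (H -> H) -> (K -> K)) : Prop :=
  forall (F : set_system (H -> H)) (A : H -> H), ProperFilter F -> F M -> M A ->
    (forall x y, (fun B : H -> H => inner H (B x) y) @ F --> inner H (A x) y) ->
    forall x y, (fun B : H -> H => inner K (rho B x) y) @ F --> inner K (rho A x) y.

(* [(Rr, Rb)] solves the conjugate equations for the endomorphisms [rho] and
   [rhobar] of [M]: [Rr] intertwines [id] and [rhobar \o rho], and [Rb]
   intertwines [id] and [rho \o rhobar]. *)
Record conjugate_solution H (M : set (H -> H)) (rho rhobar : (H -> H) -> (H -> H))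
    (Rr Rb : H -> H) : Prop := ConjugateSolution {
  conj_mem : M Rr /\ M Rb ;
  conj_r : forall A, M A -> Rr \o A = rhobar (rho A) \o Rr ;
  conj_b : forall A, M A -> Rb \o A = rho (rhobar A) \o Rb ;
  conj_eq1 : adj Rb \o rho Rr = idfun ;
  conj_eq2 : adj Rr \o rhobar Rb = idfun }.

End Operators.

Section Spacetime.
Variable R : realType.

(* Minkowski space; coordinate 0 is time. *)
Definition spacetime := 'rV[R]_3.
Definition time (v : spacetime) : R := v 0 (inord 0).
Definition space_sq (v : spacetime) : R := v 0 (inord 1) ^+ 2 + v 0 (inord 2) ^+ 2.

Definition future (v : spacetime) : Prop :=
  0 < time v /\ space_sq v < time v ^+ 2.
Definition spacelike (v : spacetime) : Prop := time v ^+ 2 < space_sq v.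
Definition closed_forward_cone : set spacetime :=
  [set v : spacetime | 0 <= time v /\ space_sq v <= time v ^+ 2].

Definition causal_complement (S : set spacetime) : set spacetime :=
  [set y | forall x, S x -> spacelike (y - x)].

Definition translate (S : set spacetime) (x : spacetime) : set spacetime :=
  [set y + x | y in S].

Definition double_cone (O : set spacetime) : Prop :=
  exists a b : spacetime, future (b - a) /\
    O = [set x | future (x - a) /\ future (b - x)].

Definition spacelike_cone (C : set spacetime) : Prop :=
  exists (x : spacetime) (O : set spacetime),
    [/\ double_cone O, ~ O 0,
        C = [set z | exists l : R, exists2 y, O y & 0 < l /\ z = x + l *: y]
      & C = causal_complement (causal_complement C)].

End Spacetime.

Section Translations.
Variable R : realType.
Implicit Types H : hilbertSpace R.
Local Notation M3 := (spacetime R).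

(* [x] is in the domain of the self-adjoint generator [P_mu] of
   [t |-> U (t e_mu) = exp (i t P_mu)], and [P_mu x = z]. *)
Definition generator H (U : M3 -> H -> H) (mu : 'I_3) (x z : H) : Prop :=
  (fun t : R => (t^-1)%:C *: (U (t *: delta_mx 0 mu) x - x)) @ (0 : R)^'
    --> 'i *: z.

(* Joint spectrum of the (strongly commuting) generators: the points [p] that
   are approximate joint eigenvalues. *)
Definition joint_spectrum H (U : M3 -> H -> H) : set M3 :=
  [set p : M3 | forall e : R, 0 < e -> exists (x : H) (z : 'I_3 -> H),
    `|x| = 1 /\ forall mu, generator U mu x (z mu) /\
                           `|z mu - (p 0 mu)%:C *: x| < e%:C].

Record positive_energy_rep H (U : M3 -> H -> H) : Prop := PositiveEnergyRep {
  per_unitary : forall x, unitary_op (U x) ;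
  per_add : forall x y, U (x + y) = U x \o U y ;
  per_continuous : forall xi, continuous (fun x => U x xi) ;
  per_spectrum : joint_spectrum U `<=` @closed_forward_cone R }.

End Translations.

Section Nets.
Variable R : realType.
Implicit Types H K L : hilbertSpace R.
Local Notation M3 := (spacetime R).

(* Only the values on double cones matter. *)
Definition local_net H := set M3 -> set (H -> H).

Definition region_algebra H (N : local_net H) (S : set M3) : set (H -> H) :=
  norm_closure [set A | exists2 O, double_cone O /\ O `<=` S & N O A].

Definition quasilocal H (N : local_net H) : set (H -> H) := region_algebra N setT.

Definition isotonous H (N : local_net H) : Prop :=
  forall O1 O2, double_cone O1 -> double_cone O2 -> O1 `<=` O2 -> N O1 `<=` N O2.

Definition local H (N : local_net H) : Prop :=
  forall O1 O2, double_cone O1 -> double_cone O2 -> O1 `<=` causal_complement O2 ->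
    forall A B, N O1 A -> N O2 B -> A \o B = B \o A.

Definition haag_duality H (N : local_net H) : Prop :=
  forall S, double_cone S \/ spacelike_cone S ->
    commutant (region_algebra N (causal_complement S)) =
    bicommutant (region_algebra N S).

Record observable_net H (N : local_net H) (U0 : M3 -> H -> H) (Omega : H)
    : Prop := ObservableNet {
  obs_vn : forall O, double_cone O -> von_neumann_algebra (N O) ;
  obs_nontrivial : forall O, double_cone O -> N O <> @scalar_ops R H ;
  obs_isotony : isotonous N ;
  obs_locality : local N ;
  obs_translations : positive_energy_rep U0 ;
  obs_covariance : forall O x, double_cone O ->
    [set Ad (U0 x) A | A in N O] = N (translate O x) ;
  obs_vacuum : `|Omega| = 1 /\ forall x, U0 x Omega = Omega ;
  obs_vacuum_unique : forall xi, `|xi| = 1 -> (forall x, U0 x xi = xi) ->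
    exists c : R[i], `|c| = 1 /\ xi = c *: Omega ;
  obs_irreducible : irreducible (quasilocal N) ;
  obs_duality : haag_duality N }.

Definition localised H (N : local_net H) (S : set M3)
    (eta : (H -> H) -> (H -> H)) : Prop :=
  forall A, region_algebra N (causal_complement S) A -> eta A = A.

Definition DHR H (N : local_net H) K (rho : (H -> H) -> (K -> K)) : Prop :=
  representation (quasilocal N) rho /\
  forall O, double_cone O ->
    equivalent_on (region_algebra N (causal_complement O)) rho idfun.

Definition irreducible_DHR H (N : local_net H) K (rho : (H -> H) -> (K -> K)) :=
  DHR N rho /\ irreducible (rho @` quasilocal N).

Definition DHR_endomorphism H (N : local_net H) (O : set M3)
    (rho : (H -> H) -> (H -> H)) : Prop :=
  [/\ double_cone O, DHR N rho, localised N O rho & endomorphism (quasilocal N) rho].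

(* [rho] is a localised endomorphism in the class of [sigma], and [(Rr, Rb)]
   exhibits the localised endomorphism [rhobar] as a conjugate of it. *)
Definition DHR_conjugate H (N : local_net H) K (sigma : (H -> H) -> (K -> K))
    (O Obar : set M3) (rho rhobar : (H -> H) -> (H -> H)) (Rr Rb : H -> H) : Prop :=
  [/\ DHR_endomorphism N O rho, DHR_endomorphism N Obar rhobar,
      equivalent_on (quasilocal N) rho sigma
    & conjugate_solution (quasilocal N) rho rhobar Rr Rb].

Definition DHR_finite_statistics H (N : local_net H) K
    (sigma : (H -> H) -> (K -> K)) : Prop :=
  exists O Obar rho rhobar Rr Rb, DHR_conjugate N sigma O Obar rho rhobar Rr Rb.

(* For [U] transporting [rho] to the causal complement of its localisation
   region, [eps = U^* rho(U)] is the statistics operator; [A |-> Rr^* rhobar(A) Rr]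
   is a positive multiple of the left inverse of an irreducible [rho], and its
   value at [eps] a positive multiple of the statistics phase. *)
Definition fermionic H (N : local_net H) K (sigma : (H -> H) -> (K -> K)) : Prop :=
  exists O Obar rho rhobar Rr Rb,
    DHR_conjugate N sigma O Obar rho rhobar Rr Rb /\
    exists (O1 : set M3) (U : H -> H) (lambda : R[i]),
      [/\ double_cone O1, O1 `<=` causal_complement O, unitary_op U,
          localised N O1 (fun A => Ad U (rho A))
        & lambda < 0 /\
          adj Rr \o rhobar (adj U \o rho U) \o Rr = lambda *: idfun].

Definition translation_covariant H (N : local_net H) (U0 : M3 -> H -> H) K
    (rho : (H -> H) -> (K -> K)) : Prop :=
  exists2 U : M3 -> K -> K, positive_energy_rep U &
    forall x A, quasilocal N A -> Ad (U x) (rho A) = rho (Ad (U0 x) A).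

Definition countably_many_sectors H (N : local_net H) : Prop :=
  exists (K : nat -> hilbertSpace R) (rho : forall n, (H -> H) -> (K n -> K n)),
    forall L (sigma : (H -> H) -> (L -> L)), irreducible_DHR N sigma ->
      exists n, equivalent_on (quasilocal N) (rho n) sigma.

Record standing_assumptions H (N : local_net H) (U0 : M3 -> H -> H) : Prop :=
  StandingAssumptions {
  std_countable : countably_many_sectors N ;
  std_no_fermions : forall K (sigma : (H -> H) -> (K -> K)),
    irreducible_DHR N sigma -> DHR_finite_statistics N sigma -> ~ fermionic N sigma ;
  std_covariant : forall K (sigma : (H -> H) -> (K -> K)),
    irreducible_DHR N sigma -> DHR_finite_statistics N sigma ->
    translation_covariant N U0 sigma }.

Definition cone_complement_vn H (N : local_net H) (Sa : set M3) (x : M3) :=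
  bicommutant (region_algebra N (causal_complement (translate Sa x))).

(* The auxiliary algebra of the net with forbidden direction [Sa]. *)
Definition aux_algebra H (N : local_net H) (Sa : set M3) : set (H -> H) :=
  norm_closure [set A | exists x, cone_complement_vn N Sa x A].

Record aux_extension H (N : local_net H) (Sa : set M3) K
    (rho rho' : (H -> H) -> (K -> K)) : Prop := AuxExtension {
  aux_rep : representation (aux_algebra N Sa) rho' ;
  aux_extends : forall A, quasilocal N A -> rho' A = rho A ;
  aux_weak : forall x, weakly_continuous_on (cone_complement_vn N Sa x) rho' }.

Definition BF_criterion H (N : local_net H) K (eta : (H -> H) -> (K -> K)) : Prop :=
  representation (quasilocal N) eta /\
  forall C, spacelike_cone C ->
    equivalent_on (region_algebra N (causal_complement C)) eta idfun.

(* Finite statistical dimension of a localised BF representation, as existence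
   of a conjugate; products are formed by means of the extensions to
   [aux_algebra N Sa]. *)
Definition BF_has_conjugate H (N : local_net H) (Sa : set M3)
    (eta : (H -> H) -> (H -> H)) : Prop :=
  exists (Cbar : set M3) (y : M3) (etabar eta' etabar' : (H -> H) -> (H -> H)),
    [/\ spacelike_cone Cbar, Cbar `<=` causal_complement (translate Sa y),
        BF_criterion N etabar & localised N Cbar etabar] /\
    [/\ aux_extension N Sa eta eta', aux_extension N Sa etabar etabar',
        endomorphism (aux_algebra N Sa) eta', endomorphism (aux_algebra N Sa) etabar'
      & exists Rr Rb, conjugate_solution (aux_algebra N Sa) eta' etabar' Rr Rb].

(* BF representation localised in the spacelike cone [C]; finite statistical
   dimension is part of the notion. *)
Record localised_BF H (N : local_net H) (Sa C : set M3)
    (eta : (H -> H) -> (H -> H)) : Prop := LocalisedBF {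
  bf_criterion : BF_criterion N eta ;
  bf_localised : localised N C eta ;
  bf_conjugate : BF_has_conjugate N Sa eta }.

(* [J] is the inclusion of the vacuum Hilbert space [H0] in [H]. *)
Record complete_normal_field_net H0 H (N : local_net H0) (J : H0 -> H)
    (pi : (H0 -> H0) -> (H -> H)) (G : set (H -> H)) (F : local_net H)
    : Prop := CompleteNormalFieldNet {
  fld_rep : representation (quasilocal N) pi ;
  fld_vn : forall O, double_cone O -> von_neumann_algebra (F O) ;
  fld_isotony : isotonous F ;
  fld_incl : isometric_op J ;
  fld_vacuum : forall A, quasilocal N A -> pi A \o J = J \o A ;
  fld_unitary : forall g, G g -> unitary_op g ;
  fld_group : [/\ G idfun, forall g h, G g -> G h -> G (g \o h)
                & forall g, G g -> G (adj g)] ;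
  (* compactness in the strong operator topology, i.e. pointwise convergence *)
  fld_compact : compact (G : set {ptws H -> H}) ;
  fld_fixes : forall g, G g -> g \o J = J ;
  fld_action : forall g O, G g -> double_cone O -> [set Ad g T | T in F O] = F O ;
  fld_fixed_points : forall O, double_cone O ->
    [set T | F O T /\ forall g, G g -> Ad g T = T] = pi @` N O ;
  fld_irreducible : irreducible (quasilocal F) ;
  fld_cyclic : forall O, double_cone O ->
    closure [set xi : H | exists (n : nat) (T : 'I_n -> H -> H) (v : 'I_n -> H0),
      (forall k, F O (T k)) /\ xi = \sum_(k < n) T k (J (v k))] = setT ;
  fld_locality : local F ;
  fld_complete : forall K (sigma : (H0 -> H0) -> (K -> K)),
    irreducible_DHR N sigma -> DHR_finite_statistics N sigma ->
    subrepresentation (quasilocal N) sigma pi }.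

Record equivariant_BF_extension H0 H (N : local_net H0) (F : local_net H)
    (pi piSa : (H0 -> H0) -> (H -> H)) (G : set (H -> H)) (Sa C : set M3)
    (eta : (H0 -> H0) -> (H0 -> H0)) (etahat : (H -> H) -> (H -> H))
    : Prop := EquivariantBFExtension {
  ext_BF : localised_BF F Sa C etahat ;
  ext_extends : forall A, quasilocal N A -> etahat (pi A) = piSa (eta A) ;
  ext_equivariant : forall g T, G g -> quasilocal F T ->
    Ad g (etahat T) = etahat (Ad g T) }.

End Nets.

(* Main.v *)
(* A field T localised in a double cone O is mapped by the extension to V^* T V, where V is a
   unitary intertwiner moving the charge of eta from C into a translate of C, far along C
   itself, that is spacelike to O. By Haag duality V lies in A(C)'', hence in the domain of
   pi^Sa, and two choices of V differ by an element of the weak closure of the observables of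
   a cone spacelike to O, which commutes with F(O).
   Everything else rests on one principle: as F(O) H_0 is dense for every double cone O, an
   operator relation valid on F(O) propagates to F(Q), O in Q, as soon as it holds for the
   compressions of F(Q) to H_0, and these compressions are the observables A(Q). Chains of
   nested double cones then give the BF criterion for arbitrary cones, lift the solutions of
   the conjugate equations from the observables to the fields, and give uniqueness. For the
   last point equivariance under G identifies the compression of the image of T with the
   image of the mean of T over G; the mean is built from vectors of minimal norm in convex
   hulls of orbits, so no Haar measure is needed. *)

Require Import Defs.
From mathcomp Require Import all_boot all_order all_algebra.
From mathcomp Require Import all_classical all_reals all_analysis.
From mathcomp Require Import complex ring lra.

Set Implicit Arguments.
Unset Strict Implicit.
Unset Printing Implicit Defensive.

Import Order.TTheory GRing.Theory Num.Theory numFieldNormedType.Exports.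

Local Open Scope classical_set_scope.
Local Open Scope ring_scope.
Local Open Scope complex_scope.

Local Notation Re := complex.Re.
Local Notation Im := complex.Im.

(** * Inner product spaces, Riesz representation and adjoints *)

(** The formula V^* T V reaches bounded regions only: the complements (Sa + z)' that matter contain
    C itself. Weak continuity and finite statistics, however, are statements about
    [aux_algebra F Sa], which is built from the weak closures over these complements. So for every
    spacelike cone D one unitary is constructed that implements the local formula on all of F(D'),
    by comparing Gram matrices. For D = Sa + n s, conjugation by these unitaries defines the
    extension on an increasing sequence of von Neumann algebras, where weak continuity is immediate.
    Identities between weakly continuous maps are then checked on words in local operators and
    carried over by the density theorem. A representation is only required to have bounded values,
    so its contractivity has to be proved before an identity can pass to norm closures. A competing
    extension comes without weak continuity. The BF criterion for a far translate of C makes it a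
    conjugation on a large double cone, and this is what allows it to be applied to a mean over G.
    The conjugate of the extension is the extension of a conjugate. *)

Section PreHilbert.
Variables (R : realType) (V : lmodType R[i]) (q : V -> V -> R[i]).
Hypothesis qDl : forall x y z, q (x + y) z = q x z + q y z.
Hypothesis qZl : forall c x y, q (c *: x) y = c * q x y.
Hypothesis qC : forall x y, q x y = (q y x)^*.
Hypothesis q_ge0 : forall x, 0 <= Re (q x x).

Local Notation N x := (Re (q x x)).

Lemma preDr x y z : q x (y + z) = q x y + q x z.
Proof. by rewrite qC qDl rmorphD /= -!qC. Qed.
Lemma preZr c x y : q x (c *: y) = c^* * q x y.
Proof. by rewrite qC qZl rmorphM /= -qC. Qed.
Lemma pre0l y : q 0 y = 0.
Proof. by rewrite -(scale0r 0) qZl mul0r. Qed.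

Lemma sq_preDZ (c : R[i]) x y :
  N (x + c *: y) = N x + 2 * Re (c^* * q x y) + (Re c ^+ 2 + Im c ^+ 2) * N y.
Proof.
have Eyy : Im (q y y) = 0 by have := qC y y; case: (q y y) => a b [] /= ; lra.
rewrite qDl !preDr !qZl !preZr (qC y x) !raddfD /=.
move: Eyy; case: c => a b; case: (q x y) => u v; case: (q y y) => s t /= ->.
by move: (N x) => n; ring.
Qed.

Lemma sq_preZ (c : R[i]) x : N (c *: x) = (Re c ^+ 2 + Im c ^+ 2) * N x.
Proof. by rewrite -[c *: x]add0r sq_preDZ !pre0l mulr0 /= mulr0 !add0r. Qed.

Lemma sq_preD x y : N (x + y) = N x + 2 * Re (q x y) + N y.
Proof.
have := sq_preDZ 1 x y.
rewrite scale1r => ->; case: (q x y) => u v /=.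
by move: (N x) (N y) => a b; ring.
Qed.

Lemma sq_preB x y : N (x - y) = N x - 2 * Re (q x y) + N y.
Proof.
have := sq_preDZ (-1) x y.
rewrite scaleN1r => ->; case: (q x y) => u v /=.
by move: (N x) (N y) => a b; ring.
Qed.

Lemma sq_preN x : N (- x) = N x.
Proof. by rewrite -sub0r sq_preB !pre0l mulr0 subr0 add0r. Qed.

Lemma parallelogram x y : N (x - y) = 2 * N x + 2 * N y - N (x + y).
Proof.
rewrite sq_preB sq_preD; move: (N x) (N y) (Re _) => a b c; ring.
Qed.

(** Expanding [0 <= N (x - t^-1 *: y)] and multiplying by [t] gives it. This is a triangle
    inequality for squared norms: [t = 1] costs a factor 2, a small [t] keeps the constant in front
    of [N x] near 1. *)
Lemma sq_preD_le t x y : 0 < t -> N (x + y) <= (1 + t) * N x + (1 + t^-1) * N y.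
Proof.
move=> t0; have := q_ge0 (x + (- t^-1)%:C *: y).
rewrite sq_preDZ sq_preD.
case: (q x y) => u v /=.
have tt : t * t^-1 = 1 by rewrite divff // gt_eqF.
move: (N x) (N y) => a b H.
have := mulr_ge0 (ltW t0) H.
have -> : t * (a + 2 * (- t^-1 * u - - 0 * v) + ((- t^-1) ^+ 2 + 0 ^+ 2) * b) =
   t * a - 2 * (t * t^-1) * u + (t * t^-1) * t^-1 * b by ring.
by rewrite tt; lra.
Qed.

(** The test vectors are [x - t q(x, y) y] with real [t]. The form may be degenerate, hence the
    separate case [N y = 0]. *)
Lemma pre_cauchy_schwarz x y : Re (q x y) ^+ 2 + Im (q x y) ^+ 2 <= N x * N y.
Proof.
set k2 := (X in X <= _).
have H t : 0 <= N x - 2 * t * k2 + t ^+ 2 * k2 * N y.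
  have := q_ge0 (x + (- t%:C * q x y) *: y).
  rewrite sq_preDZ /k2; case: (q x y) => u v /=.
  by move=> /le_trans; apply; rewrite le_eqVlt; apply/orP; left; apply/eqP; ring.
have [Ny|Ny] := eqVneq (N y) 0.
  (* The value [t = (N x + 1) / k2] turns [H] into [0 <= - N x - 2], which is absurd, unless
     [k2 <= 0]. *)
  rewrite Ny mulr0; have := H (N x + 1); have := H ((N x + 1) / k2).
  rewrite Ny !mulr0 !addr0 => h1 h2.
  have [//|k2p] := leP k2 0.
  have : 2 * ((N x + 1) / k2) * k2 = 2 * (N x + 1) by field; rewrite gt_eqF.
  by have := q_ge0 x; lra.
have Nyp : 0 < N y by rewrite lt_neqAle eq_sym Ny q_ge0.
have := H (N y)^-1.
have -> : N x - 2 * (N y)^-1 * k2 + (N y)^-1 ^+ 2 * k2 * N y = N x - k2 / N y.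
  by field.
by rewrite subr_ge0 ler_pdivrMr.
Qed.

(** Only the square [Re (q x x)] occurs because [q] is a bare form on a module: it is specialised
    both to the inner product of a Hilbert space and to the sum form on tuples ['I_n -> H]. *)
Definition pre_complete := forall u : nat -> V,
  (forall e : R, 0 < e -> exists n0, forall m n, (n0 <= m)%N -> (n0 <= n)%N -> N (u m - u n) < e) ->
  exists l, forall e : R, 0 < e -> exists n0, forall n, (n0 <= n)%N -> N (u n - l) < e.

Definition pre_closed (S : set V) :=
  forall l, (forall e : R, 0 < e -> exists2 s, S s & N (s - l) < e) -> S l.

Hypothesis complete : pre_complete.

Lemma invS_lt (e : R) : 0 < e -> exists n0 : nat, forall n, (n0 <= n)%N -> (n.+1%:R : R)^-1 < e.
Proof.
move=> e0; exists (Num.truncn e^-1) => n hnorm.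
rewrite invf_plt ?posrE ?ltr0n //.
have /andP[_ h] := truncn_itv (ltW (e0 : 0 < e) : 0 <= e).
have : 0 <= e^-1 by rewrite invr_ge0 ltW.
move/truncn_itv => /andP[_ /lt_le_trans]; apply.
by rewrite ler_nat ltnS.
Qed.

(** By the parallelogram law a minimising sequence is Cauchy. Stability under midpoints stands in
    for convexity, which suits the orbit averages formed later. *)
Lemma min_sq_norm (S : set V) : S !=set0 ->
  (forall x y, S x -> S y -> S ((2^-1)%:C *: (x + y))) -> pre_closed S ->
  exists2 p, S p & forall s, S s -> N p <= N s.
Proof.
move=> S0 Smid Scl.
set E := [set N s | s in S].
have Elb : has_lbound E by exists 0 => _ [s _ <-].
have E0 : E !=set0 by case: S0 => s Ss; exists (N s); exists s.
have dle s : S s -> inf E <= N s by move=> Ss; apply: ge_inf => //; exists s.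
have ex (n : nat) : exists s, S s /\ N s < inf E + (n.+1%:R : R)^-1.
  have [|_ [s Ss <-] h] := @inf_adherent R E (n.+1%:R : R)^-1 _ (conj E0 Elb).
    by rewrite invr_gt0 ltr0n.
  by exists s.
have [u hu] := boolp.choice ex.
have bound x y : S x -> S y -> N (x - y) <= 2 * N x + 2 * N y - 4 * inf E.
  move=> Sx Sy; rewrite parallelogram; have := dle _ (Smid _ _ Sx Sy).
  by rewrite sq_preZ /= expr0n addr0 => h; lra.
have [l hl] : exists l, forall e : R, 0 < e ->
    exists n0, forall n, (n0 <= n)%N -> N (u n - l) < e.
  apply: complete => e e0.
  have [n0 h0] := invS_lt (divr_gt0 e0 (ltr0n R 4) : 0 < e / 4%:R).
  exists n0 => m n /h0 hm /h0 hnorm.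
  have [Sm um] := hu m; have [Sn un] := hu n.
  have := bound _ _ Sm Sn.
  have -> : e = 4 * (e / 4%:R) by field.
  move: hm hnorm um un; move: ((m.+1%:R : R)^-1) ((n.+1%:R : R)^-1) => a b.
  move: (N (u m)) (N (u n)) (N (u m - u n)) (inf E) => x y z d; lra.
have Sl : S l.
  apply: Scl => e /hl [n0 /(_ n0 (leqnn _)) h]; exists (u n0) => //.
  by case: (hu n0).
exists l => // s Ss; apply: le_trans (dle _ Ss).
suff H (e : R) : 0 < e -> N l <= inf E + e by apply/ler_addgt0Pr => e; exact: H.
move=> e0.
have N0 : 0 <= inf E by apply: lb_le_inf => // _ [y _ <-].
(* [N l] is at most [(1 + t1) N (u n) + (1 + t1^-1) N (u n - l)]. The budget is [e / 8] for the
   distance of [N (u n)] from the infimum, [e / 4] for [t1 * inf E], [e / 8] for [t1 * (e / 8)] and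
   [e / 2] for the last term. The [+ 1] covers [inf E = 0]. *)
pose t : R := e / 4 / (inf E + 1).
have t0 : 0 < t by rewrite divr_gt0 ?divr_gt0 //; lra.
pose t1 : R := Num.min t 1.
have t10 : 0 < t1 by rewrite lt_min t0 ltr01.
have [n1 h1] := invS_lt (divr_gt0 e0 (ltr0n R 8) : 0 < e / 8%:R).
have [|n2 h2] := hl (e / 2 / (1 + t1^-1)).
  by rewrite !divr_gt0 // addr_gt0 // invr_gt0.
pose n := maxn n1 n2.
have := sq_preD_le (u n) (l - u n) t10.
have -> : u n + (l - u n) = l by rewrite addrC subrK.
have -> : N (l - u n) = N (u n - l).
  by rewrite -opprB sq_preN.
have {}h1 := h1 n (leq_maxl _ _); have {}h2 := h2 n (leq_maxr _ _).
have hun := (hu n).2.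
have b2 : (1 + t1^-1) * N (u n - l) <= e / 2.
  rewrite -ler_pdivlMl ?addr_gt0 ?invr_gt0 // mulrC; exact: ltW.
have b1 : (1 + t1) * N (u n) <= (1 + t1) * (inf E + e / 8).
  rewrite ler_pM2l ?addr_gt0 //.
  by apply/ltW/(lt_trans hun); rewrite ltrD2l.
have b3 : t1 * inf E <= e / 4.
  have ht : t1 <= t by rewrite ge_min lexx.
  have : t1 * inf E <= t * (inf E + 1).
    by apply: ler_pM => //; [exact: ltW | rewrite lerDl].
  by rewrite /t divfK // gt_eqF // ltr_wpDl.
have b4 : t1 * (e / 8) <= e / 8.
  rewrite -[leRHS]mul1r ler_pM2r; last by rewrite divr_gt0.
  by rewrite ge_min lexx orbT.
move: b1 b2 b3 b4; move: (N l) (inf E) (N (u n)) (N (u n - l)) (t1^-1) => x y z v w.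
lra.
Qed.

Lemma pre_projection (S : set V) : S 0 ->
  (forall c x y, S x -> S y -> S (c *: x + y)) -> pre_closed S ->
  forall x, exists2 p, S p & forall s, S s -> q (x - p) s = 0.
Proof.
move=> S0 SL Scl x.
have SZ c s : S s -> S (c *: s) by move=> Ss; rewrite -[_ *: _]addr0; exact: SL.
have [_ [p Sp <-] hp] : exists2 p, [set x - s | s in S] p &
    forall s, [set x - s | s in S] s -> N p <= N s.
  apply: min_sq_norm.
  - by exists (x - 0); exists 0.
  - move=> _ _ [s Ss <-] [t St <-]; exists ((2^-1)%:C *: (s + t)).
      by apply: SZ; rewrite -[s]scale1r; exact: SL.
    rewrite addrACA -opprD scalerBr; congr (_ - _).
    rewrite scalerDr -scalerDl -rmorphD /=.
    by rewrite (_ : 2^-1 + 2^-1 = 1 :> R) ?scale1r //; field.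
  - move=> l hl; exists (x - l); last by rewrite opprB addrC subrK.
    apply: Scl => e /hl [_ [s Ss <-] h]; exists s => //.
    have -> : s - (x - l) = - (x - s - l) by rewrite [in RHS]addrAC [RHS]opprB.
    by rewrite sq_preN.
exists p => // s Ss; set k := q (x - p) s.
(* This [t] satisfies [t * N s = 1 - t], so the perturbation by [- t k s] changes the squared
   distance by [- t (1 + t) |k|^2]; minimality forces [k = 0]. *)
pose t := (N s + 1)^-1.
have Ns1 : 0 < N s + 1 by have := q_ge0 s; lra.
have := hp (x - p + (- t%:C * k) *: s); rewrite sq_preDZ -/k => H.
have {}H : N (x - p) <= N (x - p) + 2 * Re ((- t%:C * k)^* * k) +
    (Re (- t%:C * k) ^+ 2 + Im (- t%:C * k) ^+ 2) * N s.
  apply: H; exists (p - (- t%:C * k) *: s); last by rewrite opprB addrA addrAC.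
  by rewrite -scaleNr addrC; exact: SL.
move: H.
have t0 : 0 < t by rewrite invr_gt0.
have tN : t * N s = 1 - t.
  by rewrite -[N s](addrK 1) mulrBr mulr1 mulVf ?gt_eqF.
move: tN (q_ge0 s); move: (N s) (N (x - p)) => n m; move: (t) t0 => tt t0.
case: (k) => a b /= tN n0 h.
have {}h : 0 <= - 2 * tt * (a ^+ 2 + b ^+ 2) + tt * (a ^+ 2 + b ^+ 2) * (tt * n).
  by move: h; rewrite -subr_ge0 => /le_trans; apply; rewrite le_eqVlt; apply/orP; left; apply/eqP; ring.
rewrite tN in h.
have t1 : tt * (a ^+ 2 + b ^+ 2) * (1 + tt) <= 0 by lra.
have ab : a ^+ 2 + b ^+ 2 <= 0.
  by move: t1; rewrite -mulrA pmulr_rle0 // pmulr_lle0 //; lra.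
have a0 : a = 0 by apply/eqP; rewrite -sqrf_eq0 eq_le sqr_ge0 andbT; have := sqr_ge0 b; lra.
have b0 : b = 0 by apply/eqP; rewrite -sqrf_eq0 eq_le sqr_ge0 andbT; have := sqr_ge0 a; lra.
by rewrite a0 b0.
Qed.

End PreHilbert.

Section Hilbert.
Variable R : realType.
Implicit Types H K L : hilbertSpace R.

Definition cconj (c : R[i]) : R[i] := conjc c.
Lemma cconjK c : cconj (cconj c) = c.
Proof. by case: c => a b; rewrite /cconj /= opprK. Qed.
Lemma cconj0 : cconj 0 = 0.
Proof. by rewrite /cconj /= oppr0. Qed.

Lemma innerDl H (x y z : H) : inner H (x + y) z = inner H x z + inner H y z.
Proof. exact: linearDl. Qed.
Lemma innerZl H (c : R[i]) (x y : H) : inner H (c *: x) y = c * inner H x y.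
Proof. exact: linearZl_LR. Qed.
Lemma innerC H (x y : H) : inner H x y = cconj (inner H y x).
Proof. by rewrite hermC /= expr0 mul1r. Qed.
Lemma innerDr H (x y z : H) : inner H z (x + y) = inner H z x + inner H z y.
Proof. exact: linearDr. Qed.
Lemma innerZr H (c : R[i]) (x y : H) : inner H x (c *: y) = cconj c * inner H x y.
Proof. exact: linearZr_LR. Qed.
Lemma innerBl H (x y z : H) : inner H (x - y) z = inner H x z - inner H y z.
Proof. exact: linearBl. Qed.
Lemma innerBr H (x y z : H) : inner H z (x - y) = inner H z x - inner H z y.
Proof. exact: linearBr. Qed.
Lemma inner0l H (x : H) : inner H 0 x = 0. Proof. exact: linear0l. Qed.
Lemma inner0r H (x : H) : inner H x 0 = 0. Proof. exact: linear0r. Qed.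
Lemma inner_suml H I (r : seq I) (F : I -> H) (x : H) :
  inner H (\sum_(i <- r) F i) x = \sum_(i <- r) inner H (F i) x.
Proof. exact: linear_sumlz. Qed.

(** The norm of a module over [R[i]] has values in [R[i]]; its real part carries the same
    information and is open to real order arithmetic. *)
Definition hnorm H (x : H) : R := Re `|x|.
Definition cnorm (c : R[i]) : R := Re `|c|.

Lemma normE H (x : H) : `|x| = (hnorm x)%:C.
Proof. by rewrite /hnorm RRe_real // normr_real. Qed.
Lemma cnormE (c : R[i]) : `|c| = (cnorm c)%:C.
Proof. by rewrite /cnorm RRe_real // normr_real. Qed.
Lemma hnorm_ge0 H (x : H) : 0 <= hnorm x.
Proof. by rewrite -ler0c -normE. Qed.
Lemma cnorm_ge0 c : 0 <= cnorm c.
Proof. by rewrite -ler0c -cnormE. Qed.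
Lemma cnorm_sq c : cnorm c ^+ 2 = Re c ^+ 2 + Im c ^+ 2.
Proof. by apply: complexI; rewrite rmorphXn /= -cnormE add_Re2_Im2. Qed.
Lemma hnorm_sq H (x : H) : hnorm x ^+ 2 = Re (inner H x x).
Proof. by rewrite -inner_normE normE -rmorphXn. Qed.
Lemma hnorm0 H : hnorm (0 : H) = 0.
Proof. by rewrite /hnorm normr0. Qed.
Lemma hnorm_eq0 H (x : H) : hnorm x = 0 -> x = 0.
Proof. by move=> h; apply/eqP; rewrite -normr_eq0 normE h. Qed.
Lemma hnormD H (x y : H) : hnorm (x + y) <= hnorm x + hnorm y.
Proof. by rewrite -lecR rmorphD /= -!normE ler_normD. Qed.
Lemma hnormN H (x : H) : hnorm (- x) = hnorm x.
Proof. by rewrite /hnorm normrN. Qed.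
Lemma hnormBC H (x y : H) : hnorm (x - y) = hnorm (y - x).
Proof. by rewrite -hnormN opprB. Qed.
Lemma hnormB_le H (x y : H) : hnorm (x - y) <= hnorm x + hnorm y.
Proof. by rewrite -(hnormN y) hnormD. Qed.
Lemma hnorm_tri H (z x y : H) : hnorm (x - y) <= hnorm (x - z) + hnorm (z - y).
Proof. by have := hnormD (x - z) (z - y); rewrite addrA subrK. Qed.
Lemma cnormM c d : cnorm (c * d) = cnorm c * cnorm d.
Proof. by apply: complexI; rewrite rmorphM /= -!cnormE normrM. Qed.
Lemma hnormZ H c (x : H) : hnorm (c *: x) = cnorm c * hnorm x.
Proof. by apply: complexI; rewrite rmorphM /= -!cnormE -!normE normrZ. Qed.
Lemma cnormR (r : R) : cnorm r%:C = `|r|.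
Proof. by rewrite /cnorm normc_def /= expr0n addr0 sqrtr_sqr. Qed.
Lemma cnorm_eq0 c : cnorm c = 0 -> c = 0.
Proof. by move=> h; apply/eqP; rewrite -normr_eq0 cnormE h. Qed.
Lemma Re_le_cnorm c : Re c <= cnorm c.
Proof. by apply: le_trans (ler_norm _) _; rewrite -lecR -cnormE normc_ge_Re. Qed.

Lemma inner_ge0 H (x : H) : 0 <= Re (inner H x x).
Proof. by rewrite -hnorm_sq sqr_ge0. Qed.

Lemma cauchy_schwarz H (x y : H) : cnorm (inner H x y) <= hnorm x * hnorm y.
Proof.
rewrite -ler_sqr ?nnegrE ?mulr_ge0 ?hnorm_ge0 ?cnorm_ge0 // exprMn !hnorm_sq cnorm_sq.
apply: pre_cauchy_schwarz; [exact: innerDl | exact: innerZl | exact: innerC |].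
exact: inner_ge0.
Qed.

Lemma inner_ext H (x y : H) : (forall z, inner H x z = inner H y z) -> x = y.
Proof.
move=> h; apply/eqP; rewrite -subr_eq0; apply/eqP/hnorm_eq0/eqP.
by rewrite -sqrf_eq0 hnorm_sq innerBl h subrr.
Qed.

Lemma inner_extr H (x y : H) : (forall z, inner H z x = inner H z y) -> x = y.
Proof. by move=> h; apply: inner_ext => z; rewrite innerC h -innerC. Qed.

Lemma complex_gt0P (e : R[i]) : 0 < e -> exists2 r : R, 0 < r & e = r%:C.
Proof.
by case: e => a b; rewrite ltcE /= => /andP[/eqP -> h]; exists a.
Qed.

Definition seq_lim H (u : nat -> H) (l : H) :=
  forall e : R, 0 < e -> exists n0 : nat, forall n, (n0 <= n)%N -> hnorm (u n - l) < e.

Lemma hnorm_complete H (u : nat -> H) :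
  (forall e : R, 0 < e -> exists n0 : nat,
     forall m n, (n0 <= m)%N -> (n0 <= n)%N -> hnorm (u m - u n) < e) ->
  exists l, seq_lim u l.
Proof.
move=> hu; have : cvg (u @ \oo).
  apply/cauchy_cvgP/cauchy_ballP => e /complex_gt0P[r r0 ->].
  have [n0 h0] := hu r r0; near_simpl.
  exists ([set n | n0 <= n]%N, [set n | n0 <= n]%N); first by split; exists n0.
  by move=> [m n] [/= hm hnorm']; rewrite -ball_normE /= normE ltcR; exact: h0.
move=> /cvg_ballP h; exists (lim (u @ \oo)) => e e0.
have [|n0 _ h0] := h e%:C; first by rewrite ltcR.
exists n0 => n /h0 /=; rewrite -ball_normE /= normE ltcR.
by rewrite hnormBC.
Unshelve. all: by end_near. Qed.

Lemma hilbert_pre_complete H : pre_complete (inner H).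
Proof.
move=> u hu; have [|l hl] := @hnorm_complete H u.
  move=> e e0; have [n0 h0] := hu (e ^+ 2) (exprn_gt0 _ e0).
  exists n0 => m n hm hnorm'.
  by rewrite -ltr_sqr ?nnegrE ?hnorm_ge0 ?(ltW e0) // hnorm_sq; exact: h0.
exists l => e e0.
have [|n0 h0] := hl (Num.sqrt e); first by rewrite sqrtr_gt0.
exists n0 => n /h0 h; rewrite -hnorm_sq -[ltRHS]sqr_sqrtr ?(ltW e0) //.
by rewrite ltr_sqr ?nnegrE ?hnorm_ge0 ?sqrtr_ge0.
Qed.

(** If [a > 0], the case [e = 1] shows [C > 0], so the sign of [C] need not be known beforehand.
    Most equalities of vectors below are concluded from a bound of this kind. *)
Lemma le_eps0 (a C : R) : (forall e : R, 0 < e -> a <= C * e) -> a <= 0.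
Proof.
move=> h; have [//|a0] := leP a 0.
have C0 : 0 < C by rewrite -[C]mulr1; exact: lt_le_trans (h _ ltr01).
have := h (a / (2 * C)) (divr_gt0 a0 (mulr_gt0 (ltr0n R 2) C0)).
have -> : C * (a / (2 * C)) = a / 2 by field; rewrite gt_eqF.
by lra.
Qed.

Lemma hnorm_eps0 H (x : H) (C : R) : (forall e : R, 0 < e -> hnorm x <= C * e) -> x = 0.
Proof. by move=> /le_eps0 h; apply/hnorm_eq0/eqP; rewrite eq_le h hnorm_ge0. Qed.

Lemma linD H K (A : H -> K) x y : linear A -> A (x + y) = A x + A y.
Proof. by move=> lA; have := lA 1 x y; rewrite !scale1r. Qed.
Lemma lin0 H K (A : H -> K) : linear A -> A 0 = 0.
Proof. by move=> lA; apply: (addIr (A 0)); rewrite -linD // !add0r. Qed.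
Lemma linZ H K (A : H -> K) c x : linear A -> A (c *: x) = c *: A x.
Proof. by move=> lA; have := lA c x 0; rewrite (lin0 lA) !addr0. Qed.
Lemma linN H K (A : H -> K) x : linear A -> A (- x) = - A x.
Proof. by move=> lA; rewrite -scaleN1r linZ // scaleN1r. Qed.
Lemma linB H K (A : H -> K) x y : linear A -> A (x - y) = A x - A y.
Proof. by move=> lA; rewrite linD // linN. Qed.
Lemma lin_sum H K (A : H -> K) I (r : seq I) (F : I -> H) : linear A ->
  A (\sum_(i <- r) F i) = \sum_(i <- r) A (F i).
Proof.
move=> lA; elim: r => [|i r IH]; first by rewrite !big_nil lin0.
by rewrite !big_cons linD // IH.
Qed.

Lemma bounded_lin H K (A : H -> K) : bounded_op A -> linear A.
Proof. by case. Qed.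

Lemma bounded_hnorm H K (A : H -> K) : bounded_op A ->
  exists2 M : R, 0 < M & forall x, hnorm (A x) <= M * hnorm x.
Proof.
case=> _ [M hM]; exists (cnorm M + 1); first by have := cnorm_ge0 M; lra.
move=> x; have := hM x; rewrite !normE lecE /= => /andP[_ h].
apply: le_trans h _.
apply: (@le_trans _ _ (cnorm (M * (hnorm x)%:C))); first exact: Re_le_cnorm.
by rewrite cnormM cnormR ger0_norm ?hnorm_ge0 // ler_wpM2r ?hnorm_ge0 // lerDl.
Qed.

Lemma hnorm_bounded H K (A : H -> K) (M : R) : linear A ->
  (forall x, hnorm (A x) <= M * hnorm x) -> bounded_op A.
Proof.
by move=> lA h; split=> //; exists M%:C => x; rewrite !normE -rmorphM lecR.
Qed.

Lemma riesz H (f : H -> R[i]) (M : R) : (forall c x y, f (c *: x + y) = c * f x + f y) ->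
  (forall x, cnorm (f x) <= M * hnorm x) -> exists y, forall x, f x = inner H x y.
Proof.
move=> fl fM.
have [f0|/existsNP[x0 fx0]] := pselect (forall x, f x = 0).
  by exists 0 => x; rewrite inner0r.
have f0 : f 0 = 0.
  by have := fl (-1) 0 0; rewrite scaler0 addr0 mulN1r addNr.
have fD x y : f (x + y) = f x + f y by have := fl 1 x y; rewrite scale1r mul1r.
have fZ c x : f (c *: x) = c * f x by have := fl c x 0; rewrite !addr0 f0 addr0.
have fB x y : f (x - y) = f x - f y by rewrite fD -scaleN1r fZ mulN1r.
have [||p fp hp] := @pre_projection R H (inner H) (@innerDl H) (@innerZl H)
  (@innerC H) (@inner_ge0 H) (@hilbert_pre_complete H) [set x | f x = 0] f0 _ _ x0.
- by move=> c x y /= fx fy; rewrite fl fx fy mulr0 addr0.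
- move=> l hl /=; apply/cnorm_eq0/eqP; rewrite eq_le cnorm_ge0 andbT.
  apply: (@le_eps0 _ M) => e e0.
  have [s /= fs] := hl _ (exprn_gt0 2 e0).
  rewrite -hnorm_sq ltr_sqr ?nnegrE ?hnorm_ge0 ?(ltW e0) // => hs.
  (* The sign of [M] is read off at [x0], where [f] does not vanish. *)
  have M0 : 0 <= M.
    have := fM x0; have := cnorm_ge0 (f x0); have := hnorm_ge0 x0.
    rewrite le_eqVlt => /orP[/eqP/esym/hnorm_eq0 x00|x0p _ h].
      by move: fx0; rewrite x00 f0.
    have : 0 <= M * hnorm x0 by apply: le_trans h; exact: cnorm_ge0.
    by rewrite pmulr_lge0.
  have := fM (s - l); rewrite fB fs sub0r => h.
  have -> : cnorm (f l) = cnorm (- f l) by rewrite /cnorm normrN.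
  by apply: le_trans h _; rewrite ler_wpM2l // ltW.
set z := x0 - p in hp; have fz : f z = f x0 by rewrite /z fB fp subr0.
have fz0 : f z != 0 by apply/eqP; rewrite fz.
have zz0 : inner H z z != 0.
  apply/eqP => h; move/eqP: fz0; apply; have -> : z = 0; last exact: f0.
  by apply/hnorm_eq0/eqP; rewrite -sqrf_eq0 hnorm_sq h.
exists (cconj (f z / inner H z z) *: z) => x.
rewrite innerZr cconjK.
have := hp (x - (f x / f z) *: z); rewrite /= fB fZ divfK // subrr => /(_ erefl).
rewrite innerC => /(congr1 cconj); rewrite cconjK cconj0 innerBl innerZl.
by move=> /eqP; rewrite subr_eq0 => /eqP ->; field; rewrite fz0 zz0.
Qed.

Lemma adjoint_exists H K (A : H -> K) : bounded_op A -> exists B, is_adjoint A B.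
Proof.
move=> bA; have [M M0 hM] := bounded_hnorm bA; have lA := bounded_lin bA.
suff /boolp.choice[B hB] : forall y, exists z, forall x, inner K (A x) y = inner H x z.
  by exists B => x y; exact: hB.
move=> y; apply: (@riesz _ _ (M * hnorm y)).
  by move=> c x x'; rewrite lA innerDl innerZl.
move=> x; apply: le_trans (cauchy_schwarz _ _) _.
by rewrite mulrAC ler_wpM2r ?hnorm_ge0.
Qed.

Lemma is_adjoint_unique H K (A : H -> K) B : is_adjoint A B -> adj A = B.
Proof.
move=> hB; have hA : is_adjoint A (adj A).
  by rewrite /adj; case: xgetP => [C _ //|/(_ B)].
by apply/funext => y; apply: inner_extr => x; rewrite -hA hB.
Qed.

Lemma adjP H K (A : H -> K) : bounded_op A -> is_adjoint A (adj A).
Proof. by move=> /adjoint_exists[B hB]; rewrite (is_adjoint_unique hB). Qed.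

Lemma is_adjoint_sym H K (A : H -> K) B : is_adjoint A B -> is_adjoint B A.
Proof. by move=> h x y; rewrite innerC -h -innerC. Qed.

Lemma adj_inner H K (A : H -> K) x y : bounded_op A ->
  inner K (A x) y = inner H x (adj A y).
Proof. by move=> /adjP. Qed.

Lemma adj_innerr H K (A : H -> K) x y : bounded_op A ->
  inner H (adj A x) y = inner K x (A y).
Proof. by move=> /adjP/is_adjoint_sym. Qed.

Lemma is_adjoint_linear H K (A : H -> K) B : is_adjoint A B -> linear B.
Proof.
by move=> h c x y; apply: inner_extr => z; rewrite -h innerDr innerZr !h innerDr innerZr.
Qed.

Lemma adj_bound H K (A : H -> K) (M : R) : bounded_op A -> 0 <= M ->
  (forall x, hnorm (A x) <= M * hnorm x) -> forall y, hnorm (adj A y) <= M * hnorm y.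
Proof.
move=> bA M0 hM y; have [->|n0] := eqVneq (hnorm (adj A y)) 0.
  by rewrite mulr_ge0 ?hnorm_ge0.
have n1 : 0 < hnorm (adj A y) by rewrite lt_neqAle eq_sym n0 hnorm_ge0.
rewrite -(ler_pM2r n1) -expr2 hnorm_sq adj_innerr //.
apply: le_trans (Re_le_cnorm _) _; apply: le_trans (cauchy_schwarz _ _) _.
by rewrite mulrAC mulrC ler_wpM2r ?hnorm_ge0.
Qed.

End Hilbert.

(** * Bounded operators *)

Section BoundedOperators.
Variable R : realType.
Implicit Types H K L : hilbertSpace R.

Lemma bounded_comp H K L (A : K -> L) (B : H -> K) :
  bounded_op A -> bounded_op B -> bounded_op (A \o B).
Proof.
move=> bA bB; have [M M0 hM] := bounded_hnorm bA; have [N N0 hN] := bounded_hnorm bB.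
apply: (@hnorm_bounded _ _ _ _ (M * N)).
  by move=> c x y /=; rewrite (bounded_lin bB) (bounded_lin bA).
by move=> x /=; apply: le_trans (hM _) _; rewrite -mulrA ler_wpM2l // ltW.
Qed.

Lemma bounded_id H : bounded_op (idfun : H -> H).
Proof. by apply: (@hnorm_bounded _ _ _ _ 1) => // x; rewrite mul1r. Qed.

Lemma bounded_add H K (A B : H -> K) : bounded_op A -> bounded_op B -> bounded_op (A + B).
Proof.
move=> bA bB; have [M M0 hM] := bounded_hnorm bA; have [N N0 hN] := bounded_hnorm bB.
apply: (@hnorm_bounded _ _ _ _ (M + N)).
  move=> c x y; rewrite !fctE (bounded_lin bB) (bounded_lin bA) scalerDr.
  by rewrite addrACA.
move=> x; rewrite fctE mulrDl; apply: le_trans (hnormD _ _) _; exact: lerD.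
Qed.

Lemma bounded_scale H K c (A : H -> K) : bounded_op A -> bounded_op (c *: A).
Proof.
move=> bA; have [M M0 hM] := bounded_hnorm bA.
apply: (@hnorm_bounded _ _ _ _ (cnorm c * M)).
  by move=> d x y; rewrite !fctE (bounded_lin bA) scalerDr !scalerA mulrC.
by move=> x; rewrite fctE hnormZ -mulrA ler_wpM2l // cnorm_ge0.
Qed.

Lemma bounded_sub H K (A B : H -> K) : bounded_op A -> bounded_op B -> bounded_op (A - B).
Proof.
move=> bA bB; rewrite (_ : A - B = A + (-1) *: B); last by rewrite scaleN1r.
exact/bounded_add/bounded_scale.
Qed.

Lemma bounded_adj H K (A : H -> K) : bounded_op A -> bounded_op (adj A).
Proof.
move=> bA; have [M M0 hM] := bounded_hnorm bA; apply: (@hnorm_bounded _ _ _ _ M).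
  exact: is_adjoint_linear (adjP bA).
exact: adj_bound bA (ltW M0) hM.
Qed.

Lemma adjK H K (A : H -> K) : bounded_op A -> adj (adj A) = A.
Proof. by move=> bA; apply: is_adjoint_unique; apply/is_adjoint_sym/adjP. Qed.

Lemma adj_comp H K L (A : K -> L) (B : H -> K) :
  bounded_op A -> bounded_op B -> adj (A \o B) = adj B \o adj A.
Proof.
by move=> bA bB; apply: is_adjoint_unique => x y /=; rewrite !adj_inner.
Qed.

Lemma adj_add H K (A B : H -> K) :
  bounded_op A -> bounded_op B -> adj (A + B) = adj A + adj B.
Proof.
move=> bA bB; apply: is_adjoint_unique => x y; rewrite !fctE.
by rewrite innerDl innerDr !adj_inner.
Qed.

Lemma adj_scale H K c (A : H -> K) : bounded_op A -> adj (c *: A) = cconj c *: adj A.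
Proof.
move=> bA; apply: is_adjoint_unique => x y; rewrite !fctE.
by rewrite innerZl innerZr cconjK adj_inner.
Qed.

Lemma adj_id H : adj (idfun : H -> H) = idfun.
Proof. exact: is_adjoint_unique. Qed.

Lemma isometric_bounded H K (V : H -> K) : isometric_op V -> bounded_op V.
Proof.
case=> lV iV; apply: (@hnorm_bounded _ _ _ _ 1) => // x.
by rewrite mul1r -ler_sqr ?nnegrE ?hnorm_ge0 // !hnorm_sq iV.
Qed.

Lemma isometric_hnorm H K (V : H -> K) x : isometric_op V -> hnorm (V x) = hnorm x.
Proof.
case=> lV iV; apply/eqP; rewrite -(@eqrXn2 _ 2) ?hnorm_ge0 //.
by rewrite !hnorm_sq iV.
Qed.

Lemma adj_isometric H K (V : H -> K) : isometric_op V -> adj V \o V = idfun.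
Proof.
move=> iV; have bV := isometric_bounded iV; apply/funext => x /=.
by apply: inner_ext => z; rewrite adj_innerr //; case: iV.
Qed.

Lemma unitary_bounded H K (U : H -> K) : unitary_op U -> bounded_op U.
Proof. by case=> /isometric_bounded. Qed.

Lemma unitary_adjl H K (U : H -> K) : unitary_op U -> adj U \o U = idfun.
Proof. by case=> /adj_isometric. Qed.

Lemma unitary_adjr H K (U : H -> K) : unitary_op U -> U \o adj U = idfun.
Proof.
move=> uU; have /= e := unitary_adjl uU; case: uU => _ rU.
apply/funext => y /=; have : range U y by rewrite rU.
by case=> x _ <-; rewrite -[RHS]/(U (idfun x)) -e.
Qed.

Lemma unitary_intro H K (U : H -> K) : bounded_op U ->
  adj U \o U = idfun -> U \o adj U = idfun -> unitary_op U.
Proof.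
move=> bU h1 h2; split; last first.
  rewrite -subTset => y _; exists (adj U y) => //.
  by rewrite -[LHS]/((U \o adj U) y) h2.
split; first exact: bounded_lin.
by move=> x y; rewrite adj_inner // -[adj U _]/((adj U \o U) y) h1.
Qed.

Lemma unitary_adj H K (U : H -> K) : unitary_op U -> unitary_op (adj U).
Proof.
move=> uU; have bU := unitary_bounded uU; apply: unitary_intro.
- exact: bounded_adj.
- by rewrite adjK // unitary_adjr.
- by rewrite adjK // unitary_adjl.
Qed.

Lemma unitary_comp H K L (U : K -> L) (V : H -> K) :
  unitary_op U -> unitary_op V -> unitary_op (U \o V).
Proof.
move=> uU uV; have bU := unitary_bounded uU; have bV := unitary_bounded uV.
apply: unitary_intro; first exact: bounded_comp.
- rewrite adj_comp //.
  by rewrite -[LHS]/(adj V \o (adj U \o U) \o V) unitary_adjl //; exact: unitary_adjl.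
- rewrite adj_comp //.
  by rewrite -[LHS]/(U \o (V \o adj V) \o adj U) (unitary_adjr uV); exact: unitary_adjr.
Qed.

Definition dense_in H (D : set H) := forall x (e : R), 0 < e -> exists2 y, D y & hnorm (x - y) < e.

Lemma dense_inP H (D : set H) : closure D = setT <-> dense_in D.
Proof.
split=> [h x e e0|h].
  have : closure D x by rewrite h.
  move=> /(_ (ball x e%:C)) []; first by apply: nbhsx_ballx; rewrite ltcR.
  by move=> y [Dy]; rewrite -ball_normE /= normE ltcR => hy; exists y.
rewrite -subTset => x _ B /nbhs_ballP[e /complex_gt0P[r r0 ->] hB].
have [y Dy hy] := h x r r0; exists y; split=> //; apply: hB.
by rewrite -ball_normE /= normE ltcR.
Qed.

Lemma dense_orthogonal H (D : set H) x : dense_in D ->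
  (forall y, D y -> inner H x y = 0) -> x = 0.
Proof.
move=> dD h; apply/hnorm_eq0/eqP; rewrite eq_le hnorm_ge0 andbT; apply: (@le_eps0 _ _ 1) => e e0.
rewrite mul1r; have [y Dy hy] := dD x e e0.
have [->|xn0] := eqVneq (hnorm x) 0; first exact: ltW.
have xp : 0 < hnorm x by rewrite lt_neqAle eq_sym xn0 hnorm_ge0.
rewrite -(ler_pM2r xp) -expr2 hnorm_sq -[x in inner H _ x](subrK y) innerDr (h y) // addr0.
apply: le_trans (Re_le_cnorm _) _; apply: le_trans (cauchy_schwarz _ _) _.
by rewrite mulrC ler_wpM2r ?hnorm_ge0 // ltW.
Qed.

Lemma dense_eq H (D : set H) x y : dense_in D ->
  (forall z, D z -> inner H x z = inner H y z) -> x = y.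
Proof.
move=> dD h; apply/eqP; rewrite -subr_eq0; apply/eqP/(dense_orthogonal dD) => z Dz.
by rewrite innerBl h // subrr.
Qed.

Lemma dense_bounded_eq H K (A B : H -> K) (D : set H) : bounded_op A -> bounded_op B ->
  dense_in D -> (forall x, D x -> A x = B x) -> A = B.
Proof.
move=> bA bB dD h; apply/funext => x; apply/eqP; rewrite -subr_eq0; apply/eqP.
have bC := bounded_sub bA bB; have [M M0 hM] := bounded_hnorm bC.
apply: (@hnorm_eps0 _ _ _ M) => e e0; have [y Dy hy] := dD x e e0.
have -> : A x - B x = (A - B) (x - y).
  rewrite -[RHS]/(A (x - y) - B (x - y)) (linB _ _ (bounded_lin bA)).
  by rewrite (linB _ _ (bounded_lin bB)) (h y Dy) opprB addrA subrK.
by apply: le_trans (hM _) _; rewrite ler_wpM2l // ltW.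
Qed.

(** The operator is given by its graph, since on vectors such as [\sum_k T k (J (v k))] the intended
    value depends a priori on the way the vector is written. The bound, applied to differences,
    makes the graph single-valued. *)
Lemma dense_extension H K (G : H -> K -> Prop) (M : R) : 0 <= M ->
  (forall c x y x' y', G x y -> G x' y' -> G (c *: x + x') (c *: y + y')) ->
  (forall x y, G x y -> hnorm y <= M * hnorm x) ->
  dense_in [set x | exists y, G x y] ->
  exists2 A : H -> K, bounded_op A & forall x y, G x y -> A x = y.
Proof.
move=> M0 GL GM GD.
(* [P] is the closure of the graph [G]. *)
pose P x l := forall e : R, 0 < e -> exists x' y', [/\ G x' y', hnorm (x - x') < e & hnorm (l - y') < e].
have GB x y x' y' : G x y -> G x' y' -> G (x - x') (y - y').
  move=> h h'; have := GL (-1) _ _ _ _ h' h.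
  by rewrite !scaleN1r addrC [- y' + _]addrC.
have Pbound x l : P x l -> hnorm l <= M * hnorm x.
  move=> h; rewrite -subr_le0; apply: (@le_eps0 _ _ (M + 1)) => e e0.
  have [x' [y' [g hx hy]]] := h e e0.
  have := hnormD (l - y') y'; rewrite subrK => h1.
  have h2 := GM _ _ g.
  have h3 : hnorm x' <= hnorm x + e.
    have := hnormD (x' - x) x; rewrite subrK hnormBC => h3.
    by apply: le_trans h3 _; rewrite addrC lerD2l ltW.
  have h4 : M * hnorm x' <= M * (hnorm x + e) by rewrite ler_wpM2l.
  move: hx hy h1 h2 h3 h4; move: (hnorm l) (hnorm (l - y')) (hnorm y') (M * hnorm x') (hnorm x) => a b c d f.
  by nra.
have PL c x l x' l' : P x l -> P x' l' -> P (c *: x + x') (c *: l + l').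
  move=> h h' e e0.
  have c1 : 0 < cnorm c + 1 by have := cnorm_ge0 c; lra.
  have [|z [w [g hz hw]]] := h (e / (2 * (cnorm c + 1))).
    by rewrite divr_gt0 // mulr_gt0.
  have [|z' [w' [g' hz' hw']]] := h' (e / 2); first by rewrite divr_gt0.
  have key (L' : hilbertSpace R) (u v u' v' : L') : hnorm (u - v) < e / (2 * (cnorm c + 1)) ->
      hnorm (u' - v') < e / 2 -> hnorm (c *: u + u' - (c *: v + v')) < e.
    move=> hu hu'; rewrite opprD addrACA -scalerBr.
    apply: le_lt_trans (hnormD _ _) _; rewrite hnormZ.
    have : cnorm c * hnorm (u - v) <= e / 2.
      apply: (@le_trans _ _ ((cnorm c + 1) * (e / (2 * (cnorm c + 1))))).
        by apply: ler_pM; rewrite ?cnorm_ge0 ?hnorm_ge0 ?(ltW hu) // lerDl.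
      by rewrite le_eqVlt; apply/orP; left; apply/eqP; field; rewrite gt_eqF.
    by move=> h1; rewrite [e]splitr; exact: ler_ltD.
  by exists (c *: z + z'), (c *: w + w'); split; [exact: GL | exact: key | exact: key].
have Puniq x l l' : P x l -> P x l' -> l = l'.
  move=> h h'; have := Pbound _ _ (PL (-1) _ _ _ _ h h').
  rewrite !scaleN1r addNr hnorm0 mulr0 => h1; apply/esym/eqP; rewrite -subr_eq0 addrC.
  by apply/eqP/hnorm_eq0/eqP; rewrite eq_le h1 hnorm_ge0.
have GP x y : G x y -> P x y.
  by move=> g e e0; exists x, y; rewrite !subrr !hnorm0.
have Pex x : exists l, P x l.
  have /boolp.choice[u hu] : forall n : nat, exists p : H * K, G p.1 p.2 /\ hnorm (x - p.1) < (n.+1%:R : R)^-1.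
    move=> n; have [|x' [y' g] h] := GD x (n.+1%:R : R)^-1.
      by rewrite invr_gt0 ltr0n.
    by exists (x', y').
  have [|l hl] := @hnorm_complete _ K (fun n => (u n).2).
    (* The factor 2 pays for the two approximations of [x], and [M + 1] covers [M = 0]. *)
    move=> e e0; have [|n0 h0] := @invS_lt R (e / (2 * (M + 1))).
      by rewrite divr_gt0 // mulr_gt0 // ltr_wpDl.
    exists n0 => m n /h0 hm /h0 hnorm'; have [gm um] := hu m; have [gn un] := hu n.
    apply: le_lt_trans (GM _ _ (GB _ _ _ _ gm gn)) _.
    have h1 := hnorm_tri x (u m).1 (u n).1.
    have h2 : hnorm ((u m).1 - (u n).1) <= 2 * (e / (2 * (M + 1))).
      rewrite mulr_natl mulr2n; apply: le_trans h1 _; rewrite hnormBC.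
      by apply: lerD; apply/ltW; [exact: lt_trans um hm | exact: lt_trans un hnorm'].
    apply: le_lt_trans (ler_wpM2l M0 h2) _.
    have -> : M * (2 * (e / (2 * (M + 1)))) = e * (M / (M + 1)).
      by field; rewrite gt_eqF // ltr_wpDl.
    rewrite -[ltRHS]mulr1 ltr_pM2l // ltr_pdivrMr ?mul1r; last by rewrite ltr_wpDl.
    by rewrite ltrDl.
  exists l => e e0; have [n1 h1] := hl e e0; have [n2 h2] := invS_lt e0.
  pose n := maxn n1 n2; exists (u n).1, (u n).2; have [g h] := hu n; split=> //.
    by apply: lt_trans h (h2 _ (leq_maxr _ _)).
  by rewrite hnormBC; apply: h1; exact: leq_maxl.
have [A hA] := boolp.choice Pex; exists A.
  apply: (@hnorm_bounded _ _ _ _ M); last by move=> x; exact: Pbound.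
  by move=> c x y; apply: Puniq (hA _) _; exact: PL.
by move=> x y g; apply: Puniq (hA x) (GP _ _ g).
Qed.

End BoundedOperators.

(** * Commutants and the double commutant theorem *)

Section Commutants.
Variable R : realType.
Implicit Types H K L : hilbertSpace R.

Lemma comp_lin_add H K L (A : K -> L) (B C : H -> K) : linear A ->
  A \o (B + C) = (A \o B) + (A \o C).
Proof. by move=> lA; apply/funext => x; exact: (linD (B x) (C x) lA). Qed.

Lemma comp_lin_scale H K L c (A : K -> L) (B : H -> K) : linear A ->
  A \o (c *: B) = c *: (A \o B).
Proof. by move=> lA; apply/funext => x; exact: (linZ c (B x) lA). Qed.

Lemma commutant_bounded H (S : set (H -> H)) A : commutant S A -> bounded_op A.
Proof. by case. Qed.

Lemma commutant_anti H (S T : set (H -> H)) : S `<=` T -> commutant T `<=` commutant S.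
Proof. by move=> ST A [bA h]; split=> // B /ST; exact: h. Qed.

Lemma sub_bicommutant H (S : set (H -> H)) : S `<=` @bounded_op R H H -> S `<=` bicommutant S.
Proof. by move=> bS A SA; split=> [|B [_ h]]; [exact: bS | rewrite h]. Qed.

Lemma commutant3 H (S : set (H -> H)) : S `<=` @bounded_op R H H ->
  commutant (bicommutant S) = commutant S.
Proof.
move=> bS; apply/seteqP; split; first exact/commutant_anti/sub_bicommutant.
by apply: sub_bicommutant => A; exact: commutant_bounded.
Qed.

Lemma bicommutant_mono H (S T : set (H -> H)) : S `<=` T -> bicommutant S `<=` bicommutant T.
Proof. by move=> ST; exact/commutant_anti/commutant_anti. Qed.

Lemma commutant_id H (S : set (H -> H)) : commutant S idfun.
Proof. by split; [exact: bounded_id|]. Qed.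

Lemma commutant_comp H (S : set (H -> H)) A B :
  commutant S A -> commutant S B -> commutant S (A \o B).
Proof.
move=> [bA hA] [bB hB]; split=> [|C SC]; first exact: bounded_comp.
by rewrite -[LHS]/((C \o A) \o B) hA // -[LHS]/(A \o (C \o B)) hB.
Qed.

Lemma commutant_add H (S : set (H -> H)) A B : S `<=` @bounded_op R H H ->
  commutant S A -> commutant S B -> commutant S (A + B).
Proof.
move=> bS [bA hA] [bB hB]; split=> [|C SC]; first exact: bounded_add.
by rewrite comp_lin_add ?hA ?hB //; exact/bounded_lin/bS.
Qed.

Lemma commutant_scale H (S : set (H -> H)) c A : S `<=` @bounded_op R H H ->
  commutant S A -> commutant S (c *: A).
Proof.
move=> bS [bA hA]; split=> [|C SC]; first exact: bounded_scale.
by rewrite comp_lin_scale ?hA //; exact/bounded_lin/bS.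
Qed.

Definition star_closed H (S : set (H -> H)) :=
  forall A, S A -> bounded_op A /\ S (adj A).

Lemma star_bounded H (S : set (H -> H)) : star_closed S -> S `<=` @bounded_op R H H.
Proof. by move=> sS A /sS[]. Qed.

Lemma commutant_star H (S : set (H -> H)) : star_closed S -> star_closed (commutant S).
Proof.
move=> sS A [bA hA]; split=> //; split=> [|B SB]; first exact: bounded_adj.
have [bB SB'] := sS _ SB.
rewrite -{1}(adjK bB) -adj_comp //; last exact: bounded_adj.
by rewrite -hA // adj_comp ?adjK //; exact: bounded_adj.
Qed.

Lemma norm_closureP H (S : set (H -> H)) A : norm_closure S A <->
  bounded_op A /\ forall e : R, 0 < e -> exists2 B, S B & forall x, hnorm (A x - B x) <= e * hnorm x.
Proof.
split=> -[bA h]; split=> // e e0.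
  have [|B SB hB] := h e%:C; first by rewrite ltcR.
  by exists B => // x; have := hB x; rewrite !normE -rmorphM lecR.
have [r r0 ->] := complex_gt0P e0; have [B SB hB] := h r r0.
by exists B => // x; rewrite !normE -rmorphM lecR.
Qed.

Lemma norm_closure_bounded H (S : set (H -> H)) : norm_closure S `<=` @bounded_op R H H.
Proof. by move=> A []. Qed.

Lemma sub_norm_closure H (S : set (H -> H)) A : bounded_op A -> S A -> norm_closure S A.
Proof.
move=> bA SA; apply/norm_closureP; split=> // e e0; exists A => // x.
by rewrite subrr hnorm0 mulr_ge0 ?hnorm_ge0 ?ltW.
Qed.

Lemma norm_closure_mono H (S T : set (H -> H)) : S `<=` T -> norm_closure S `<=` norm_closure T.
Proof.
move=> ST A /norm_closureP[bA h]; apply/norm_closureP; split=> // e /h[B /ST TB hB].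
by exists B.
Qed.

Lemma norm_closure_idem H (S : set (H -> H)) : norm_closure (norm_closure S) = norm_closure S.
Proof.
apply/seteqP; split=> A; last by move=> h; apply: sub_norm_closure (h); case: h.
move=> /norm_closureP[bA h]; apply/norm_closureP; split=> // e e0.
have e2 : 0 < e / 2 by rewrite divr_gt0.
have [B /norm_closureP[_ hB] AB] := h _ e2; have [C SC BC] := hB _ e2.
exists C => // x; apply: le_trans (hnorm_tri (B x) _ _) _.
by rewrite [e]splitr mulrDl; apply: lerD.
Qed.

(** [A'] stands for [f A]: it only has to be approximated by [f B] whenever [A] is by [B], which
    holds as soon as [f] is a contractive linear map. *)
Lemma norm_closure_intertwine H K (S : set (H -> H)) A (U : H -> K) (A' : K -> K)
    (f : (H -> H) -> (K -> K)) : bounded_op U -> norm_closure S A ->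
  (forall e : R, 0 < e -> exists2 B, S B &
    (forall x, hnorm (A x - B x) <= e * hnorm x) /\ (forall x, hnorm (A' x - f B x) <= e * hnorm x)) ->
  (forall B, S B -> U \o B = f B \o U) -> U \o A = A' \o U.
Proof.
move=> bU _ h hU; have [M M0 hM] := bounded_hnorm bU.
apply/funext => x /=; apply/eqP; rewrite -subr_eq0; apply/eqP.
apply: (@hnorm_eps0 _ _ _ (2 * M * hnorm x)) => e /h[B SB [hB hB']].
apply: le_trans (hnorm_tri (U (B x)) _ _) _.
have /(congr1 (@^~ x)) /= -> := hU B SB.
rewrite -{1}[f B (U x)]/((f B \o U) x) -hU //= -linB; last exact: bounded_lin.
have h1 := le_trans (hM (A x - B x)) (ler_wpM2l (ltW M0) (hB x)).
have h2 := hB' (U x); rewrite hnormBC in h2.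
have h3 := hM x.
have [hx|hx] := eqVneq (hnorm x) 0.
  move: h1; rewrite hx !mulr0 mul0r => h1; move: h3 h2; rewrite hx mulr0 => h3.
  have -> : hnorm (U x) = 0 by apply/eqP; rewrite eq_le h3 hnorm_ge0.
  by rewrite mulr0 => h2; exact: (le_trans (lerD h1 h2)); rewrite addr0.
have xp : 0 < hnorm x by rewrite lt_neqAle eq_sym hx hnorm_ge0.
have ep : 0 <= e.
  by have := le_trans (hnorm_ge0 _) (hB x); rewrite pmulr_lge0.
have h4 := ler_wpM2l ep h3.
have -> : 2 * M * hnorm x * e = M * (e * hnorm x) + e * (M * hnorm x) by ring.
by apply: lerD => //; exact: le_trans h2 h4.
Qed.

Lemma commute_norm_closure H (S : set (H -> H)) A (U : H -> H) : bounded_op U ->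
  norm_closure S A -> (forall B, S B -> U \o B = B \o U) -> U \o A = A \o U.
Proof.
move=> bU cA hU; apply: (norm_closure_intertwine (f := id) bU cA) => // e e0.
by move/norm_closureP: cA => [_ /(_ e e0) [B SB hB]]; exists B.
Qed.

Lemma commutant_norm_closure H (S : set (H -> H)) : S `<=` @bounded_op R H H ->
  commutant (norm_closure S) = commutant S.
Proof.
move=> bS; apply/seteqP; split.
  by apply: commutant_anti => A SA; apply: sub_norm_closure => //; exact: bS.
move=> A [bA hA]; split=> // B cB; symmetry; apply: (commute_norm_closure bA cB).
by move=> C /hA.
Qed.

Lemma norm_closure_commutant H (S T : set (H -> H)) : T `<=` @bounded_op R H H ->
  S `<=` commutant T -> norm_closure S `<=` commutant T.
Proof.
move=> bT ST A cA; split=> [|B TB]; first by case: cA.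
by apply: (commute_norm_closure (bT _ TB) cA) => C /ST[_ /(_ _ TB)].
Qed.

(** The words in [S] and their combinations. The inductive form allows an identity to be checked on
    local operators and pushed through sums, multiples and products; adjoints come for free when [S]
    is closed under them. *)
Inductive star_algebra H (S : set (H -> H)) : set (H -> H) :=
| gen_in A : S A -> star_algebra S A
| gen_id : star_algebra S idfun
| gen_add A B : star_algebra S A -> star_algebra S B -> star_algebra S (A + B)
| gen_scale c A : star_algebra S A -> star_algebra S (c *: A)
| gen_comp A B : star_algebra S A -> star_algebra S B -> star_algebra S (A \o B).

Lemma star_algebra_star H (S : set (H -> H)) : star_closed S -> star_closed (star_algebra S).
Proof.
move=> sS A; elim=> {A} [A SA||A B _ [bA gA] _ [bB gB]|c A _ [bA gA]|A B _ [bA gA] _ [bB gB]].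
- by have [bA SA'] := sS A SA; split=> //; exact: gen_in.
- by split; [exact: bounded_id | rewrite adj_id; exact: gen_id].
- by split; [exact: bounded_add | rewrite adj_add //; exact: gen_add].
- by split; [exact: bounded_scale | rewrite adj_scale //; exact: gen_scale].
- by split; [exact: bounded_comp | rewrite adj_comp //; exact: gen_comp].
Qed.

Lemma star_algebra_bicommutant H (S : set (H -> H)) : S `<=` @bounded_op R H H ->
  star_algebra S `<=` bicommutant S.
Proof.
move=> bS A.
have bS' : commutant S `<=` @bounded_op R H H by move=> ?; exact: commutant_bounded.
elim=> {A} [A SA||A B _ hA _ hB|c A _ hA|A B _ hA _ hB].
- exact: sub_bicommutant.
- exact: commutant_id.
- exact: commutant_add.
- exact: commutant_scale.
- exact: commutant_comp.
Qed.

End Commutants.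

(** * The density theorem of von Neumann, by amplification to n-tuples *)

Section Density.
Variables (R : realType) (H : hilbertSpace R) (n : nat).
Local Notation V := ('I_n -> H).
Let q (u v : V) : R[i] := \sum_(i < n) inner H (u i) (v i).

Let qDl x y z : q (x + y) z = q x z + q y z.
Proof. by rewrite /q -big_split; apply: eq_bigr => i _; exact: innerDl. Qed.
Let qZl c x y : q (c *: x) y = c * q x y.
Proof. by rewrite /q mulr_sumr; apply: eq_bigr => i _; exact: innerZl. Qed.
Let qC x y : q x y = (q y x)^*.
Proof. by rewrite /q rmorph_sum; apply: eq_bigr => i _; rewrite innerC. Qed.
Let qRe x : Re (q x x) = \sum_(i < n) hnorm (x i) ^+ 2.
Proof. by rewrite /q raddf_sum; apply: eq_bigr => i _; rewrite hnorm_sq. Qed.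
Let q_ge0 x : 0 <= Re (q x x).
Proof. by rewrite qRe sumr_ge0 // => i _; rewrite sqr_ge0. Qed.
Let q_coord x i : hnorm (x i) ^+ 2 <= Re (q x x).
Proof.
by rewrite qRe (bigD1 i) //= lerDl sumr_ge0 // => j _; rewrite sqr_ge0.
Qed.
Let q_eq0 x : Re (q x x) = 0 -> x = 0.
Proof.
move=> h; apply/funext => i; apply/hnorm_eq0/eqP; rewrite -sqrf_eq0 eq_le sqr_ge0 andbT -h.
exact: q_coord.
Qed.

Let q_complete : pre_complete q.
Proof.
move=> u hu.
have /boolp.choice[l hl] : forall i, exists l, seq_lim (fun k => u k i) l.
  move=> i; apply: hnorm_complete => e e0; have [n0 h0] := hu (e ^+ 2) (exprn_gt0 _ e0).
  exists n0 => k m hk hm; rewrite -ltr_sqr ?nnegrE ?hnorm_ge0 ?(ltW e0) //.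
  by apply: le_lt_trans (h0 k m hk hm); exact: (q_coord (u k - u m)).
(* With [n + 1] in the denominator the [n] terms [d ^+ 2] add up to strictly less than [e], also for
   [n = 0]. *)
exists l => e e0; pose d : R := Num.sqrt (e / n.+1%:R).
have d0 : 0 < d by rewrite sqrtr_gt0 divr_gt0 // ltr0n.
have /boolp.choice[N hN] : forall i, exists n0 : nat, forall k, (n0 <= k)%N -> hnorm (u k i - l i) < d.
  by move=> i; exact: hl.
exists (\max_(i < n) N i) => k hk; rewrite qRe.
apply: (@le_lt_trans _ _ (\sum_(i < n) d ^+ 2)).
  apply: ler_sum => i _; rewrite ler_sqr ?nnegrE ?hnorm_ge0 ?(ltW d0) //.
  by apply/ltW/hN/leq_trans/hk/leq_bigmax.
rewrite sumr_const card_ord sqr_sqrtr; last by rewrite divr_ge0 ?ltW.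
by rewrite -[_ *+ n]mulr_natr -mulrA gtr_pMr // mulrC ltr_pdivrMr ?ltr0n // mul1r ltr_nat.
Qed.

(* Project [H^n] onto the closure of [{(A x_i)_i : A in the algebra}]; the matrix
   entries of the projection lie in the commutant, so [X] preserves that closure. *)
Lemma star_algebra_dense (S : set (H -> H)) (X : H -> H) (x : V) (e : R) :
  star_closed S -> bicommutant S X -> 0 < e ->
  exists2 B, star_algebra S B & forall i, hnorm (X (x i) - B (x i)) < e.
Proof.
move=> sS [bX hX] e0.
have sG := star_algebra_star sS.
pose W0 : set V := [set w | exists2 B, star_algebra S B & w = fun i => B (x i)].
pose W : set V := [set w | forall d : R, 0 < d -> exists2 s, W0 s & Re (q (s - w) (s - w)) < d].
have W0W w : W0 w -> W w.
  by move=> hw d d0; exists w => //; rewrite subrr /q big1 // => i _; rewrite inner0l.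
have Wop (A : V -> V) (M : R) : 0 < M -> (forall w v, A (w - v) = A w - A v) ->
    (forall w, Re (q (A w) (A w)) <= M * Re (q w w)) ->
    (forall w, W0 w -> W0 (A w)) -> forall w, W w -> W (A w).
  move=> M0 Al AM AW w hw d d0; have [s Ws hs] := hw (d / M) (divr_gt0 d0 M0).
  exists (A s); first exact: AW.
  by rewrite -Al; apply: le_lt_trans (AM _) _; rewrite mulrC -ltr_pdivlMr.
have tri := @sq_preD_le R V q qDl qZl qC q_ge0.
have WL c w v : W w -> W v -> W (c *: w + v).
  move=> hw hv d d0; pose c2 := Re c ^+ 2 + Im c ^+ 2.
  have c20 : 0 <= c2 by rewrite addr_ge0 // sqr_ge0.
  have [|s [B gB ->] hs] := hw (d / 4 / (c2 + 1)).
    by rewrite !divr_gt0 // ltr_wpDl.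
  have [|t [C gC ->] ht] := hv (d / 4); first by rewrite divr_gt0.
  exists (fun i => (c *: B + C) (x i)).
    by exists (c *: B + C) => //; apply: gen_add => //; exact: gen_scale.
  set s1 := (fun i => B (x i)) in hs; set t1 := (fun i => C (x i)) in ht.
  have -> : (fun i => (c *: B + C) (x i)) - (c *: w + v) = c *: (s1 - w) + (t1 - v).
    rewrite scalerBr addrACA -opprD; congr (_ - _).
  have := tri 1 (c *: (s1 - w)) (t1 - v) ltr01; rewrite invr1 => h.
  apply: le_lt_trans h _; rewrite (sq_preZ qDl qZl qC) -/c2.
  have : c2 * Re (q (s1 - w) (s1 - w)) <= d / 4.
    apply: (@le_trans _ _ ((c2 + 1) * (d / 4 / (c2 + 1)))).
      by apply: ler_pM => //; [rewrite lerDl | exact: ltW].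
    by rewrite mulrC divfK // gt_eqF // ltr_wpDl.
  move: ht; move: (Re _) (Re _) => a b h1 h2; lra.
have W00 : W 0.
  apply: W0W; exists (0 *: idfun); first exact/gen_scale/gen_id.
  by apply/funext => i; exact/esym/(scale0r (x i)).
have Wcl : pre_closed q W.
  move=> l hl d d0; have [s Ws hs] := hl (d / 4) (divr_gt0 d0 (ltr0n _ 4)).
  have [t Wt ht] := Ws (d / 4) (divr_gt0 d0 (ltr0n _ 4)).
  exists t => //; have := tri 1 (t - s) (s - l) ltr01; rewrite addrA subrK invr1 => h.
  apply: le_lt_trans h _; move: hs ht; move: (Re _) (Re _) => a b h1 h2; lra.
have /boolp.choice[P hP] : forall w, exists p, W p /\ forall s, W s -> q (w - p) s = 0.
  move=> w; have [p Wp hp] := pre_projection qDl qZl qC q_ge0 q_complete W00 WL Wcl w.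
  by exists p.
have Puniq w p : W p -> (forall s, W s -> q (w - p) s = 0) -> P w = p.
  move=> Wp hp; apply/eqP; rewrite -subr_eq0; apply/eqP/q_eq0.
  have [WP hP'] := hP w.
  have WD : W (P w - p).
    by have := WL (-1) _ _ Wp WP; rewrite scaleN1r addrC.
  have -> : q (P w - p) (P w - p) = q (w - p) (P w - p) - q (w - P w) (P w - p).
    rewrite -[- q _ _]mulN1r -qZl -qDl scaleN1r opprB.
    by congr q; rewrite [RHS]addrC addrA subrK.
  by rewrite hp // hP' // subrr.
have PL c w v : P (c *: w + v) = c *: P w + P v.
  have [Ww hw] := hP w; have [Wv hv] := hP v.
  apply: Puniq; first exact: WL.
  move=> s Ws; rewrite opprD addrACA -scalerBr qDl qZl hw // hv // mulr0 addr0 //.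
have Pnorm w : Re (q (P w) (P w)) <= Re (q w w).
  have [Ww hw] := hP w.
  have := sq_preD qDl qZl qC (w - P w) (P w).
  by rewrite subrK (hw _ Ww) mulr0 addr0 => ->; rewrite lerDr.
pose inj (j : 'I_n) (h : H) : V := fun i => if i == j then h else 0.
have inj_lin j c h h' : inj j (c *: h + h') = c *: inj j h + inj j h'.
  apply/funext => i; rewrite /inj !fctE; case: eqP => // _.
  by rewrite scaler0 addr0.
have inj_sq j h : Re (q (inj j h) (inj j h)) = hnorm h ^+ 2.
  rewrite qRe (bigD1 j) //= /inj eqxx big1 ?addr0 // => i /negbTE ->.
  by rewrite hnorm0 expr0n.
pose p i j h := P (inj j h) i.
have bp i j : bounded_op (p i j).
  apply: (@hnorm_bounded _ _ _ _ 1).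
    by move=> c h h'; rewrite /p inj_lin PL.
  move=> h; rewrite mul1r -ler_sqr ?nnegrE ?hnorm_ge0 //.
  by apply: le_trans (q_coord _ _) _; apply: le_trans (Pnorm _) _; rewrite inj_sq.
pose act (B : H -> H) : V -> V := fun w i => B (w i).
have Pact B w : star_algebra S B -> P (act B w) = act B (P w).
  move=> gB.
  have actW C : star_algebra S C -> forall w, W w -> W (act C w).
    move=> gC; have bC := (sG _ gC).1; have [M M0 hM] := bounded_hnorm bC.
    apply: (@Wop _ (M ^+ 2)).
    - by rewrite exprn_gt0.
    - by move=> v u; apply/funext => i; exact: (linB _ _ (bounded_lin bC)).
    - move=> v; rewrite !qRe mulr_sumr; apply: ler_sum => i _.
      by rewrite -exprMn ler_sqr ?nnegrE ?mulr_ge0 ?hnorm_ge0 ?(ltW M0) //; exact: hM.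
    - by move=> _ [D gD ->]; exists (C \o D) => //; exact: gen_comp.
  have [Ww hw] := hP w; have [bB gB'] := sG _ gB.
  apply: Puniq; first exact: actW.
  move=> s Ws; rewrite -(hw _ (actW _ gB' _ Ws)) /q; apply: eq_bigr => i _.
  rewrite /act -[RHS]adj_inner //; congr (inner H _ _).
  exact/esym/(linB _ _ (bounded_lin bB)).
have Xp i j : X \o p i j = p i j \o X.
  symmetry; apply: hX; split=> // B SB; apply/funext => h /=.
  have gB : star_algebra S B by exact: gen_in.
  rewrite /p -[LHS]/(act B (P (inj j h)) i) -Pact //; congr (P _ i).
  apply/funext => k; rewrite /act /inj; case: eqP => // _.
  exact/lin0/bounded_lin/(sG _ gB).1.
have Psum w i : P w i = \sum_(j < n) p i j (w j).
  have {1}-> : w = \sum_(j < n) inj j (w j).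
    apply/funext => k; rewrite fct_sumE (bigD1 k) //= /inj eqxx big1 ?addr0 //.
    by move=> j /negbTE; rewrite eq_sym => ->.
  have P0 : P 0 = 0 by apply: Puniq => // s Ws; rewrite subrr /q big1 // => k _; rewrite inner0l.
  have PD u v : P (u + v) = P u + P v by have := PL 1 u v; rewrite !scale1r.
  by rewrite (big_morph P PD P0) fct_sumE.
have Wx : W x by apply: W0W; exists idfun => //; exact: gen_id.
have Px : P x = x by apply: Puniq => // s _; rewrite subrr /q big1 // => k _; rewrite inner0l.
have WX : W (act X x).
  suff <- : P (act X x) = act X x by case: (hP (act X x)).
  apply/funext => i; rewrite Psum /act -[in RHS]Px Psum.
  rewrite lin_sum; last exact: bounded_lin.
  by apply: eq_bigr => j _; rewrite -[LHS]/((p i j \o X) (x j)) -Xp.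
have [_ [B gB ->] hB] := WX (e ^+ 2) (exprn_gt0 _ e0).
exists B => // i; rewrite hnormBC -ltr_sqr ?nnegrE ?hnorm_ge0 ?(ltW e0) //.
by apply: le_lt_trans hB; exact: (q_coord ((fun i => B (x i)) - act X x)).
Qed.

End Density.

(** * Weak continuity and representations *)

Section WeakDensity.
Variable R : realType.
Implicit Types H K L : hilbertSpace R.

(** The density theorem in the form that [weakly_continuous_on] accepts: the filter is generated by
    the traces on the algebra of the strong neighbourhoods of [X], and it is proper by
    [star_algebra_dense] for the vectors of the list. *)
Lemma weak_density H (S : set (H -> H)) (X : H -> H) : star_closed S -> bicommutant S X ->
  exists F : set_system (H -> H), [/\ ProperFilter F, F (star_algebra S) &
    forall x y, (fun B : H -> H => inner H (B x) y) @ F --> inner H (X x) y].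
Proof.
move=> sS cX.
pose F : set_system (H -> H) := [set U | exists (l : seq H) (e : R), 0 < e /\
  forall B, star_algebra S B -> (forall x, x \in l -> hnorm (X x - B x) < e) -> U B].
have PF : ProperFilter F.
  split.
    move=> [l [e [e0 h]]].
    have [B gB hB] := @star_algebra_dense R H (size l) S X (fun i => l`_i) e sS cX e0.
    apply: (h B gB) => x /(nthP 0)[i il <-]; exact: (hB (Ordinal il)).
  split.
  - by exists [::], 1.
  - move=> U V [l [e [e0 h]]] [l' [e' [e'0 h']]].
    exists (l ++ l'), (Num.min e e'); split; first by rewrite lt_min e0.
    move=> B gB hB; split; [apply: h => // x xl | apply: h' => // x xl].
      by have := hB x; rewrite mem_cat xl lt_min => /(_ isT) /andP[].
    by have := hB x; rewrite mem_cat xl orbT lt_min => /(_ isT) /andP[].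
  - by move=> U V UV [l [e [e0 h]]]; exists l, e; split=> // B gB hB; exact/UV/h.
exists F; split=> //; first by exists [::], 1; split.
move=> x y; apply/cvgrPdist_lt => _ /complex_gt0P[r r0 ->].
have y1 : 0 < hnorm y + 1 by rewrite ltr_wpDl ?hnorm_ge0.
exists [:: x], (r / (hnorm y + 1)); split; first by rewrite divr_gt0.
move=> B gB /(_ x (mem_head _ _)) hB; rewrite /= -innerBl cnormE ltcR.
apply: le_lt_trans (cauchy_schwarz _ _) _.
rewrite -(divfK (lt0r_neq0 y1) r).
apply: (@le_lt_trans _ _ (r / (hnorm y + 1) * hnorm y)).
  by rewrite ler_wpM2r ?hnorm_ge0 // ltW.
by rewrite ltr_pM2l ?ltrDl // divr_gt0.
Qed.

Lemma weakly_continuous_id H (M : set (H -> H)) : weakly_continuous_on M (id : (H -> H) -> (H -> H)).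
Proof. by []. Qed.

Lemma weakly_continuous_comp H K L (M : set (H -> H)) (M' : set (K -> K))
    (rho : (H -> H) -> (K -> K)) (sigma : (K -> K) -> (L -> L)) :
  weakly_continuous_on M rho -> weakly_continuous_on M' sigma ->
  (forall A, M A -> M' (rho A)) -> weakly_continuous_on M (sigma \o rho).
Proof.
move=> wr ws h F A PF FM MA FA x y.
apply: (ws (rho @ F) (rho A)).
- by change (F (rho @^-1` M')); apply: filterS FM => B /h.
- exact: h.
- by move=> z w; exact: (wr F A PF FM MA FA z w).
Qed.

(** Both sides are limits along the filter of [weak_density]. The vectors on the two sides are
    independent, so that a fixed operator can first be moved across the inner product by its
    adjoint. *)
Lemma weak_eq H K L (S : set (H -> H)) (rho : (H -> H) -> (K -> K))
    (sigma : (H -> H) -> (L -> L)) x y x' y' : star_closed S ->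
  weakly_continuous_on (bicommutant S) rho -> weakly_continuous_on (bicommutant S) sigma ->
  (forall B, star_algebra S B -> inner K (rho B x) y = inner L (sigma B x') y') ->
  forall X, bicommutant S X -> inner K (rho X x) y = inner L (sigma X x') y'.
Proof.
move=> sS wr ws h X cX; have [F [PF FS FX]] := weak_density sS cX.
have FM : F (bicommutant S).
  by apply: filterS FS; exact/star_algebra_bicommutant/star_bounded.
have h1 := wr F X PF FM cX FX x y.
have h2 := ws F X PF FM cX FX x' y'.
have h3 : (fun B => inner K (rho B x) y) @ F --> inner L (sigma X x') y'.
  apply: cvg_trans h2; apply: near_eq_cvg.
  by apply: filterS FS => B /h ->.
exact: (cvg_unique _ h1 h3).
Qed.

End WeakDensity.

(** * Norm-closed operator algebras and the contractivity of their representations *)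

Section Representations.
Variable R : realType.
Implicit Types H K L : hilbertSpace R.

Record cstar_algebra H (M : set (H -> H)) : Prop := CstarAlgebra {
  cstar_star : star_closed M;
  cstar_id : M idfun;
  cstar_add : forall A B, M A -> M B -> M (A + B);
  cstar_scale : forall c A, M A -> M (c *: A);
  cstar_comp : forall A B, M A -> M B -> M (A \o B);
  cstar_closed : norm_closure M `<=` M }.

Lemma cstar_bounded H (M : set (H -> H)) A : cstar_algebra M -> M A -> bounded_op A.
Proof. by case=> sM _ _ _ _ _ /sM[]. Qed.

Lemma cstar_bicommutant H (S : set (H -> H)) : star_closed S -> cstar_algebra (bicommutant S).
Proof.
move=> sS; have sC := commutant_star sS.
have bC := star_bounded sC; split.
- exact: commutant_star.
- exact: commutant_id.
- by move=> A B; exact: commutant_add.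
- by move=> c A; exact: commutant_scale.
- by move=> A B; exact: commutant_comp.
- exact: norm_closure_commutant.
Qed.

Lemma cstar_norm_closure H (M : set (H -> H)) : star_closed M -> M idfun ->
  (forall A B, M A -> M B -> M (A + B)) -> (forall c A, M A -> M (c *: A)) ->
  (forall A B, M A -> M B -> M (A \o B)) -> cstar_algebra (norm_closure M).
Proof.
move=> sM M1 MD MZ MM.
have adj_close (A B : H -> H) (e : R) : 0 <= e -> bounded_op A -> bounded_op B ->
    (forall x, hnorm (A x - B x) <= e * hnorm x) -> forall x, hnorm (adj A x - adj B x) <= e * hnorm x.
  move=> e0 bA bB h.
  move=> x; have -> : adj A x - adj B x = adj (A - B) x.
    rewrite -[A - B]/(A + - B) -(scaleN1r B) adj_add ?adj_scale //; last exact: bounded_scale.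
    rewrite -[RHS]/(adj A x + cconj (-1) *: adj B x); congr (_ + _).
    by rewrite (_ : cconj (-1) = -1) ?scaleN1r // /cconj /= oppr0.
  by apply: adj_bound => //; exact: bounded_sub.
split.
- move=> A /norm_closureP[bA h]; split=> //; apply/norm_closureP; split.
    exact: bounded_adj.
  move=> e e0; have [B MB hB] := h e e0; have [bB MB'] := sM B MB.
  by exists (adj B) => //; apply: adj_close => //; exact: ltW.
- by apply: sub_norm_closure => //; exact: bounded_id.
- move=> A B /norm_closureP[bA hA] /norm_closureP[bB hB]; apply/norm_closureP.
  split=> [|e e0]; first exact: bounded_add.
  have e2 : 0 < e / 2 by rewrite divr_gt0.
  have [A' MA' hA'] := hA _ e2; have [B' MB' hB'] := hB _ e2.
  exists (A' + B'); first exact: MD.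
  move=> x; rewrite (_ : _ - _ = (A x - A' x) + (B x - B' x)); last first.
    by rewrite addrACA -opprD.
  by rewrite [e]splitr mulrDl; apply: le_trans (hnormD _ _) _; exact: lerD.
- move=> c A /norm_closureP[bA hA]; apply/norm_closureP.
  split=> [|e e0]; first exact: bounded_scale.
  have c1 : 0 < cnorm c + 1 by rewrite ltr_wpDl ?cnorm_ge0.
  have [A' MA' hA'] := hA _ (divr_gt0 e0 c1).
  exists (c *: A'); first exact: MZ.
  move=> x; rewrite (_ : _ - _ = c *: (A x - A' x)); last by rewrite scalerBr.
  rewrite hnormZ; apply: (@le_trans _ _ ((cnorm c + 1) * (e / (cnorm c + 1) * hnorm x))).
    by apply: ler_pM; rewrite ?cnorm_ge0 ?hnorm_ge0 // lerDl.
  by rewrite mulrA [(cnorm c + 1) * _]mulrC divfK // gt_eqF.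
- move=> A B /norm_closureP[bA hA] /norm_closureP[bB hB]; apply/norm_closureP.
  split=> [|e e0]; first exact: bounded_comp.
  have [N N0 hN] := bounded_hnorm bB.
  have [A' MA' hA'] := hA (e / 2 / N) (divr_gt0 (divr_gt0 e0 (ltr0n _ 2)) N0).
  have [bA' _] := sM _ MA'; have [M' M'0 hM'] := bounded_hnorm bA'.
  (* [B'] is chosen after [A'], since the precision depends on the bound of [A']. *)
  have [B' MB' hB'] := hB (e / 2 / M') (divr_gt0 (divr_gt0 e0 (ltr0n _ 2)) M'0).
  exists (A' \o B'); first exact: MM.
  move=> x; apply: le_trans (hnorm_tri (A' (B x)) _ _) _.
  rewrite [e]splitr mulrDl; apply: lerD.
    apply: le_trans (hA' (B x)) _; apply: (@le_trans _ _ (e / 2 / N * (N * hnorm x))).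
      by apply: ler_wpM2l => //; rewrite divr_ge0 ?ltW // divr_gt0.
    by rewrite mulrA divfK // gt_eqF.
  rewrite /= -linB; last exact: bounded_lin.
  apply: le_trans (hM' _) _; apply: le_trans (ler_wpM2l (ltW M'0) (hB' x)) _.
  by rewrite mulrA [M' * _]mulrC divfK // gt_eqF.
- by rewrite norm_closure_idem.
Qed.

Lemma expr_small (q e : R) : 0 <= q < 1 -> 0 < e -> exists n : nat, q ^+ n < e.
Proof.
move=> /andP[q0 q1] e0.
have : (GRing.exp q) @ \oo --> (0 : R) by apply: cvg_expr; rewrite ger0_norm.
move=> /cvgrPdist_lt /(_ e e0) [n _ /(_ n (leqnn n))] /=.
by rewrite sub0r normrN ger0_norm ?exprn_ge0 // => h; exists n.
Qed.

(** The inverse is the geometric series of [B]. Its tails are bounded by [q ^+ n / (1 - q)]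
    uniformly in the vector, so the pointwise limit is a norm limit and stays in [M]. *)
Lemma neumann H (M : set (H -> H)) B (q : R) : cstar_algebra M -> M B -> 0 <= q < 1 ->
  (forall x, hnorm (B x) <= q * hnorm x) -> exists2 Y, M Y & forall x, Y (x - B x) = x.
Proof.
move=> cM MB q01 hB; have /andP[q0 q1] := q01.
have p1 : 0 < 1 - q by rewrite subr_gt0.
pose P n : H -> H := iter n (fun T : H -> H => B \o T) idfun.
have MP n : M (P n) by elim: n => [|n IH]; [exact: cstar_id | exact: cstar_comp].
have hP n x : hnorm (P n x) <= q ^+ n * hnorm x.
  elim: n => [|n IH]; first by rewrite expr0 mul1r.
  apply: le_trans (hB _) _; rewrite exprS -mulrA; exact: ler_wpM2l.
(* The empty sum is written [0 *: idfun] because its membership in [M] is then an instance of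
   closure under multiples. *)
pose Y n : H -> H := iteri n (fun k (T : H -> H) => T + P k) (0 *: idfun).
have MY n : M (Y n).
  by elim: n => [|n IH]; [apply: cstar_scale => //; exact: cstar_id | exact: cstar_add].
have YS n x : Y n.+1 x = Y n x + P n x by [].
have hY x n k : hnorm (Y (n + k)%N x - Y n x) <= (q ^+ n - q ^+ (n + k)) / (1 - q) * hnorm x.
  elim: k => [|k IH]; first by rewrite addn0 !subrr hnorm0 mul0r mul0r.
  rewrite addnS YS addrAC; apply: le_trans (hnormD _ _) _.
  apply: le_trans (lerD IH (hP _ _)) _; rewrite -mulrDl le_eqVlt; apply/orP; left.
  by apply/eqP; rewrite exprS; field; rewrite gt_eqF.
have hY' x m n : (n <= m)%N -> hnorm (Y m x - Y n x) <= q ^+ n / (1 - q) * hnorm x.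
  move=> nm; rewrite -(subnKC nm); apply: le_trans (hY _ _ _) _.
  rewrite ler_wpM2r ?hnorm_ge0 // ler_wpM2r ?invr_ge0 ?(ltW p1) //.
  by rewrite gerBl exprn_ge0.
have small (x : H) (e : R) : 0 < e -> exists n : nat, q ^+ n / (1 - q) * hnorm x < e.
  move=> e0; have x1 : 0 < hnorm x + 1 by rewrite ltr_wpDl ?hnorm_ge0.
  have [|n he'] := @expr_small q (e * (1 - q) / (hnorm x + 1)) q01.
    by rewrite divr_gt0 // mulr_gt0.
  exists n; apply: (@le_lt_trans _ _ (q ^+ n / (1 - q) * (hnorm x + 1))).
    by rewrite ler_wpM2l ?lerDl // divr_ge0 ?exprn_ge0 // ltW.
  by rewrite -ltr_pdivlMr // ltr_pdivrMr // mulrAC.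
have /boolp.choice[Z hZ] : forall x, exists l, seq_lim (fun n => Y n x) l.
  move=> x; apply: hnorm_complete => e e0; have [n he'] := small x (e / 2) (divr_gt0 e0 (ltr0n _ 2)).
  exists n => m k /hY' hm /hY' hk; apply: le_lt_trans (hnorm_tri (Y n x) _ _) _.
  rewrite [e]splitr; apply: ltrD; first exact: le_lt_trans (hm x) _.
  by rewrite hnormBC; exact: le_lt_trans (hk x) _.
have ZY x n : hnorm (Z x - Y n x) <= q ^+ n / (1 - q) * hnorm x.
  rewrite -subr_le0; apply: (@le_eps0 _ _ 1) => e e0.
  have [N hN] := hZ x e e0; pose m := maxn N n.
  have := hN m (leq_maxl _ _); rewrite hnormBC => h1.
  have h2 := hY' x m n (leq_maxr _ _); have := hnorm_tri (Y m x) (Z x) (Y n x).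
  rewrite mul1r lerBlDl => h3; apply: le_trans h3 _; rewrite addrC; apply: lerD => //.
  exact: ltW.
have lZ : linear Z.
  move=> c x y; apply/eqP; rewrite -subr_eq0; apply/eqP.
  pose C := (hnorm (c *: x + y) + cnorm c * hnorm x + hnorm y) / (1 - q).
  have C0 : 0 <= C by rewrite divr_ge0 ?(ltW p1) // !addr_ge0 ?mulr_ge0 ?hnorm_ge0 ?cnorm_ge0.
  apply: (@hnorm_eps0 _ _ _ C) => e e0; have [n he'] := expr_small q01 e0.
  apply: (@le_trans _ _ (C * q ^+ n)); last by rewrite ler_wpM2l // ltW.
  apply: le_trans (hnorm_tri (Y n (c *: x + y)) _ _) _.
  rewrite (bounded_lin (cstar_bounded cM (MY n))).
  have -> : c *: Y n x + Y n y - (c *: Z x + Z y) = - (c *: (Z x - Y n x)) - (Z y - Y n y).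
    by rewrite -opprD scalerBr addrACA -opprD opprB.
  rewrite -(bounded_lin (cstar_bounded cM (MY n))).
  apply: le_trans (lerD (ZY _ n) (hnormB_le _ _)) _.
  rewrite hnormN hnormZ.
  apply: le_trans (lerD (lexx _) (lerD (ler_wpM2l (cnorm_ge0 c) (ZY x n)) (ZY y n))) _.
  by rewrite le_eqVlt; apply/orP; left; apply/eqP; rewrite /C; field; rewrite gt_eqF.
have bZ : bounded_op Z.
  apply: (@hnorm_bounded _ _ _ _ (1 - q)^-1 lZ) => x.
  have := ZY x 0%N; rewrite expr0 mul1r -[Y 0%N x]/(0 *: x) scale0r subr0 //.
exists Z.
  apply: cstar_closed cM _ _; apply/norm_closureP; split=> // e e0.
  have [|n he'] := @expr_small q (e * (1 - q)) q01; first by rewrite mulr_gt0.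
  exists (Y n) => // x; apply: le_trans (ZY x n) _.
  by rewrite ler_wpM2r ?hnorm_ge0 // ler_pdivrMr // ltW.
move=> x; apply/eqP; rewrite -subr_eq0; apply/eqP.
have YB n : Y n (x - B x) = x - P n x.
  elim: n => [|n IH]; first by rewrite -[LHS]/(0 *: (x - B x)) scale0r subrr.
  rewrite YS IH (linB _ _ (bounded_lin (cstar_bounded cM (MP n)))).
  have -> : P n (B x) = P n.+1 x.
    by rewrite /P; elim: n {IH} => //= n ->.
  by rewrite addrA subrK.
pose C := hnorm (x - B x) / (1 - q) + hnorm x.
apply: (@hnorm_eps0 _ _ _ C) => e e0; have [n he'] := expr_small q01 e0.
apply: (@le_trans _ _ (C * q ^+ n)); last first.
  apply: ler_wpM2l; last exact: ltW.
  by rewrite addr_ge0 ?hnorm_ge0 // divr_ge0 ?hnorm_ge0 // ltW.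
apply: le_trans (hnorm_tri (Y n (x - B x)) _ _) _.
rewrite {2}YB addrAC subrr sub0r hnormN.
apply: le_trans (lerD (ZY _ _) (hP _ _)) _.
by rewrite le_eqVlt; apply/orP; left; apply/eqP; rewrite /C; field; rewrite gt_eqF.
Qed.

Lemma cstar_sub H (M : set (H -> H)) A B : cstar_algebra M -> M A -> M B -> M (A - B).
Proof.
move=> cM MA MB; rewrite (_ : A - B = A + (-1) *: B); last by rewrite scaleN1r.
by apply: (cstar_add cM MA); exact: (cstar_scale cM).
Qed.

Lemma rep_sub H K (M : set (H -> H)) (rho : (H -> H) -> (K -> K)) A B :
  cstar_algebra M -> representation M rho -> M A -> M B -> rho (A - B) = rho A - rho B.
Proof.
move=> cM rr MA MB; rewrite (_ : A - B = A + (-1) *: B); last by rewrite scaleN1r.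
have MB' : M ((-1) *: B) by exact: (cstar_scale cM).
by rewrite (rep_add rr MA MB') (rep_scale rr _ MB) scaleN1r.
Qed.

(* If [c] is the best constant with |rho(A) x|^2 <= c |x|^2 and c exceeds m^2, then
   1 - A^* A / c is invertible in [M], which improves the constant. *)
Lemma representation_contractive H K (M : set (H -> H)) (rho : (H -> H) -> (K -> K)) A (m : R) :
  cstar_algebra M -> representation M rho -> M A -> 0 <= m ->
  (forall x, hnorm (A x) <= m * hnorm x) -> forall y, hnorm (rho A y) <= m * hnorm y.
Proof.
move=> cM rrho MA m0 hA.
have [bA MA'] := cstar_star cM MA.
have bS := rep_bounded rrho MA; set S := rho A in bS *.
pose E : set R := [set c | 0 <= c /\ forall x, hnorm (S x) ^+ 2 <= c * hnorm x ^+ 2].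
have E0 : E !=set0.
  have [N N0 hN] := bounded_hnorm bS; exists (N ^+ 2); split; first exact: sqr_ge0.
  by move=> x; rewrite -exprMn ler_sqr ?nnegrE ?mulr_ge0 ?hnorm_ge0 ?(ltW N0).
have lbE : has_lbound E by exists 0 => c [].
set c0 := inf E.
have c00 : 0 <= c0 by apply: lb_le_inf => // c [].
have hc0 x : hnorm (S x) ^+ 2 <= c0 * hnorm x ^+ 2.
  have [x0|x0] := eqVneq (hnorm x) 0.
    by rewrite (hnorm_eq0 x0) (lin0 (bounded_lin bS)) hnorm0 expr0n mulr0.
  have xp : 0 < hnorm x ^+ 2 by rewrite exprn_gt0 // lt_neqAle eq_sym x0 hnorm_ge0.
  rewrite -ler_pdivrMr //; apply: lb_le_inf => // c [_ hc].
  by rewrite ler_pdivrMr.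
suff c0m : c0 <= m ^+ 2.
  move=> y; rewrite -ler_sqr ?nnegrE ?mulr_ge0 ?hnorm_ge0 // exprMn.
  by apply: le_trans (hc0 y) _; rewrite ler_wpM2r // sqr_ge0.
have [//|mc0] := leP c0 (m ^+ 2); exfalso.
have c0p : 0 < c0 by apply: le_lt_trans mc0; exact: sqr_ge0.
pose B : H -> H := (c0^-1)%:C *: (adj A \o A).
have MB : M B by apply: (cstar_scale cM); exact: (cstar_comp cM).
have q01 : 0 <= c0^-1 * m ^+ 2 < 1.
  by rewrite mulr_ge0 ?invr_ge0 ?sqr_ge0 //= mulrC ltr_pdivrMr ?mul1r.
have hB x : hnorm (B x) <= c0^-1 * m ^+ 2 * hnorm x.
  rewrite -[B x]/((c0^-1)%:C *: (adj A (A x))) hnormZ cnormR ger0_norm ?invr_ge0 //.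
  rewrite -mulrA ler_wpM2l ?invr_ge0 //.
  apply: le_trans (adj_bound bA m0 hA _) _.
  by rewrite expr2 -mulrA ler_wpM2l.
have [Y MY hY] := neumann cM MB q01 hB.
have MAA : M (adj A \o A) by exact: cstar_comp.
have rY : rho Y \o (idfun - rho B) = idfun.
  have M1B : M (idfun - B) by apply: (cstar_sub cM) => //; exact: cstar_id.
  transitivity (rho (Y \o (idfun - B))); last first.
    rewrite (_ : Y \o (idfun - B) = idfun) ?(rep_unital rrho) //.
    by apply/funext => x; exact: hY.
  rewrite (rep_mul rrho MY M1B); congr (_ \o _).
  by rewrite (rep_sub cM rrho (cstar_id cM) MB) (rep_unital rrho).
have rB : rho B = (c0^-1)%:C *: (adj S \o S).
  by rewrite (rep_scale rrho) // (rep_mul rrho) // (rep_adj rrho).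
have [K0 K0p hK0] := bounded_hnorm (rep_bounded rrho MY).
(* The summand 1 gives [k >= 1], so the improved constant [c0 * (1 - k^-1)] is nonnegative, as [E]
   demands. *)
pose k := K0 ^+ 2 + 1.
have k1 : 1 <= k by rewrite lerDr sqr_ge0.
have kp : 0 < k by apply: lt_le_trans k1.
have key x : hnorm x ^+ 2 <= k * (hnorm x ^+ 2 - hnorm (S x) ^+ 2 / c0).
  have h1 : hnorm x ^+ 2 <= K0 ^+ 2 * hnorm (x - rho B x) ^+ 2.
    rewrite -exprMn ler_sqr ?nnegrE ?mulr_ge0 ?hnorm_ge0 ?(ltW K0p) //.
    by have := hK0 (x - rho B x); rewrite -[rho Y _]/((rho Y \o (idfun - rho B)) x) rY.
  have h2 : hnorm (x - rho B x) ^+ 2 <= hnorm x ^+ 2 - hnorm (S x) ^+ 2 / c0.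
    rewrite hnorm_sq (sq_preB (@innerDl R K) (@innerZl R K) (@innerC R K)) -!hnorm_sq.
    have -> : rho B x = (c0^-1)%:C *: adj S (S x) by rewrite rB.
    rewrite innerZr -adj_inner // hnormZ cnormR ger0_norm ?invr_ge0 // exprMn.
    have -> : Re (cconj (c0^-1)%:C * inner K (S x) (S x)) = c0^-1 * hnorm (S x) ^+ 2.
      by rewrite hnorm_sq; case: (inner K (S x) (S x)) => a b /=; rewrite oppr0 mul0r subr0.
    have h3 : hnorm (adj S (S x)) ^+ 2 <= c0 * hnorm (S x) ^+ 2.
      rewrite -[c0]sqr_sqrtr // -exprMn ler_sqr ?nnegrE ?mulr_ge0 ?hnorm_ge0 //.
      apply: adj_bound => // y; rewrite -ler_sqr ?nnegrE ?mulr_ge0 ?hnorm_ge0 //.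
      by rewrite exprMn sqr_sqrtr.
    have : c0^-1 ^+ 2 * hnorm (adj S (S x)) ^+ 2 <= c0^-1 * hnorm (S x) ^+ 2.
      rewrite expr2 -mulrA ler_wpM2l ?invr_ge0 // mulrC ler_pdivrMr // mulrC //.
    by move: (hnorm x ^+ 2) (hnorm (S x) ^+ 2) => a b; rewrite [b / c0]mulrC; lra.
  apply: le_trans h1 _; apply: ler_pM; rewrite ?sqr_ge0 //.
  by rewrite lerDl.
have : E (c0 * (1 - k^-1)).
  split; first by rewrite mulr_ge0 // subr_ge0 invf_le1.
  move=> x; have := key x; rewrite -ler_pdivrMl // => h.
  have : hnorm (S x) ^+ 2 / c0 <= (1 - k^-1) * hnorm x ^+ 2.
    by rewrite mulrBl mul1r; lra.
  by rewrite ler_pdivrMr // mulrC mulrA.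
move=> /(ge_inf lbE); rewrite -/c0 mulrBr mulr1.
have : 0 < c0 / k by rewrite divr_gt0.
by move: (c0 / k) => t; lra.
Qed.

Lemma representation_close H K (M : set (H -> H)) (rho : (H -> H) -> (K -> K)) A B (e : R) :
  cstar_algebra M -> representation M rho -> M A -> M B -> 0 <= e ->
  (forall x, hnorm (A x - B x) <= e * hnorm x) -> forall y, hnorm (rho A y - rho B y) <= e * hnorm y.
Proof.
move=> cM rr MA MB e0 h y.
have -> : rho A y - rho B y = rho (A - B) y by rewrite (rep_sub cM rr MA MB).
apply: (representation_contractive cM rr) => //; exact: cstar_sub.
Qed.

End Representations.

(** * Averages over a group of unitaries *)

Section Averages.
Variables (R : realType) (H : hilbertSpace R) (G : set (H -> H)).
Hypothesis G_unitary : forall g, G g -> unitary_op g.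
Hypothesis G_id : G idfun.
Hypothesis G_comp : forall g h, G g -> G h -> G (g \o h).
Hypothesis G_adj : forall g, G g -> G (adj g).

(** The dyadic convex combinations of the orbit of [T]; [min_sq_norm] asks for midpoints only. *)
Inductive averages (T : H -> H) : set (H -> H) :=
| average_in g : G g -> averages T (Ad g T)
| average_mid A B : averages T A -> averages T B -> averages T ((2^-1)%:C *: (A + B)).

Definition fixed_vectors : set H := [set x | forall g, G g -> g x = x].

Lemma Ad_id (T : H -> H) : Ad idfun T = T.
Proof. by rewrite /Ad adj_id. Qed.

Lemma Ad_comp (g h T : H -> H) : bounded_op g -> bounded_op h -> Ad g (Ad h T) = Ad (g \o h) T.
Proof. by move=> bg bh; rewrite /Ad adj_comp. Qed.

Lemma averages_refl T : averages T T.
Proof. by rewrite -{2}(Ad_id T); exact: average_in. Qed.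

Lemma averages_Ad T C g : averages T C -> G g -> averages T (Ad g C).
Proof.
move=> aC Gg; have bg := unitary_bounded (G_unitary Gg).
elim: aC => {C} [h Gh|A B _ IA _ IB].
  rewrite Ad_comp //; last exact/unitary_bounded/G_unitary.
  by apply: average_in; exact: G_comp.
rewrite (_ : Ad g _ = (2^-1)%:C *: (Ad g A + Ad g B)); first exact: average_mid.
apply/funext => x; rewrite /Ad /=.
exact: etrans (linZ _ _ (bounded_lin bg)) (congr1 _ (linD _ _ (bounded_lin bg))).
Qed.

Lemma averages_trans T C D : averages T C -> averages C D -> averages T D.
Proof.
move=> aC; elim=> {D} [g Gg|A B _ IA _ IB]; first exact: averages_Ad.
exact: average_mid.
Qed.

Lemma averages_ind2 T (P : (H -> H) -> Prop) : (forall g, G g -> P (Ad g T)) ->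
  (forall A B, P A -> P B -> P ((2^-1)%:C *: (A + B))) -> forall C, averages T C -> P C.
Proof. by move=> h1 h2 C; elim=> *; [exact: h1 | exact: h2]. Qed.

Lemma half_add (K : hilbertSpace R) (x : K) : (2^-1)%:C *: (x + x) = x.
Proof.
rewrite scalerDr -scalerDl -rmorphD /=.
by rewrite (_ : 2^-1 + 2^-1 = 1 :> R) ?scale1r //; field.
Qed.

Lemma hnorm_half (K : hilbertSpace R) (x y : K) (e : R) : hnorm x < e -> hnorm y < e ->
  hnorm ((2^-1)%:C *: (x + y)) < e.
Proof.
move=> hx hy; rewrite hnormZ cnormR ger0_norm ?invr_ge0 //.
by have := hnormD x y; move: hx hy; move: (hnorm _) (hnorm _) (hnorm _) => a b c; lra.
Qed.

Lemma averages_bounded T C : bounded_op T -> averages T C -> bounded_op C.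
Proof.
move=> bT; move: C; apply: averages_ind2 => [g Gg|A B bA bB].
  have bg := unitary_bounded (G_unitary Gg).
  by apply: bounded_comp; [exact: bounded_comp | exact: bounded_adj].
by apply/bounded_scale/bounded_add.
Qed.

Lemma averages_bound T C (M : R) : bounded_op T -> (forall x, hnorm (T x) <= M * hnorm x) ->
  averages T C -> forall x, hnorm (C x) <= M * hnorm x.
Proof.
move=> bT hT; move: C; apply: averages_ind2 => [g Gg|A B hA hB] x.
  have ug := G_unitary Gg; rewrite /Ad /= (isometric_hnorm _ ug.1).
  apply: le_trans (hT _) _; rewrite (isometric_hnorm _ (unitary_adj ug).1) //.
rewrite -[X in hnorm X]/((2^-1)%:C *: (A x + B x)) hnormZ cnormR ger0_norm ?invr_ge0 //.
have := hnormD (A x) (B x); have := hA x; have := hB x.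
by move: (hnorm _) (hnorm _) (hnorm _) (M * hnorm x) => a b c d; lra.
Qed.

(** Each [g] is isometric and fixes both [x] and [p], so no further averaging can spoil an
    approximation already reached at a fixed vector. *)
Lemma averages_near T C x p (e : R) : fixed_vectors x -> fixed_vectors p ->
  hnorm (T x - p) < e -> averages T C -> hnorm (C x - p) < e.
Proof.
move=> fx fp h; move: C; apply: averages_ind2 => [g Gg|A B hA hB].
  have ug := G_unitary Gg; have lg := bounded_lin (unitary_bounded ug).
  rewrite /Ad /= (fx _ (G_adj Gg)) -(fp g Gg) -(linB _ _ lg).
  by rewrite (isometric_hnorm _ ug.1).
rewrite -[X in hnorm X]/((2^-1)%:C *: (A x + B x) - p) -[p]half_add -scalerBr.
by rewrite opprD addrACA; exact: hnorm_half.
Qed.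

(* The element of minimal norm in the closed convex hull of an orbit is fixed, and it
   is determined by its inner products with the fixed vectors. *)
Lemma fixed_average T x : bounded_op T -> fixed_vectors x ->
  exists2 p, fixed_vectors p & forall T' (e : R), averages T T' -> 0 < e ->
    exists2 C, averages T' C & forall C', averages C C' -> hnorm (C' x - p) < e.
Proof.
move=> bT fx.
have inner_av T' C s : averages T' C -> fixed_vectors s -> inner H (C x) s = inner H (T' x) s.
  move=> aC fs; move: C aC; apply: averages_ind2 => [g Gg|A B hA hB].
    rewrite /Ad /= adj_inner; last exact/unitary_bounded/G_unitary.
    by rewrite (fx _ (G_adj Gg)) (fs _ (G_adj Gg)).
  rewrite -[X in inner H X]/((2^-1)%:C *: (A x + B x)) innerZl innerDl hA hB.
  rewrite mulrDr -mulrDl -rmorphD /=.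
  by rewrite (_ : 2^-1 + 2^-1 = 1 :> R) ?mul1r //; field.
have key T' : bounded_op T' -> exists p, [/\ fixed_vectors p,
    forall s, fixed_vectors s -> inner H p s = inner H (T' x) s &
    forall e : R, 0 < e -> exists2 C, averages T' C & hnorm (C x - p) < e].
  move=> bT'.
  pose S : set H := [set y | forall e : R, 0 < e -> exists2 C, averages T' C & hnorm (C x - y) < e].
  have SC C : averages T' C -> S (C x).
    by move=> aC e e0; exists C => //; rewrite subrr hnorm0.
  have Smid y z : S y -> S z -> S ((2^-1)%:C *: (y + z)).
    move=> Sy Sz e e0; have [A aA hA] := Sy e e0; have [B aB hB] := Sz e e0.
    exists ((2^-1)%:C *: (A + B)); first exact: average_mid.
    rewrite -[X in hnorm (X - _)]/((2^-1)%:C *: (A x + B x)) -scalerBr opprD addrACA.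
    exact: hnorm_half.
  have [||| p Sp hp] := @min_sq_norm R H (inner H) (@innerDl R H) (@innerZl R H)
      (@innerC R H) (@inner_ge0 R H) (@hilbert_pre_complete R H) S.
  - by exists (T' x); exact/SC/averages_refl.
  - exact: Smid.
  - move=> l hl e e0; have e2 : 0 < e / 2 by rewrite divr_gt0.
    have [s Ss] := hl _ (exprn_gt0 2 e2).
    rewrite -hnorm_sq ltr_sqr ?nnegrE ?hnorm_ge0 ?(ltW e2) // => hs.
    have [C aC hC] := Ss _ e2; exists C => //; apply: le_lt_trans (hnorm_tri s _ _) _.
    by rewrite [e]splitr; exact: ltrD.
  have fp : fixed_vectors p.
    move=> g Gg; have ug := G_unitary Gg; have lg := bounded_lin (unitary_bounded ug).
    have Sg : S (g p).
      move=> e e0; have [C aC hC] := Sp e e0; exists (Ad g C); first exact: averages_Ad.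
      by rewrite /Ad /= (fx _ (G_adj Gg)) -(linB _ _ lg) (isometric_hnorm _ ug.1).
    have := hp _ (Smid _ _ Sp Sg); have := parallelogram (@innerDl R H) (@innerZl R H)
      (@innerC R H) p (g p).
    rewrite -!hnorm_sq hnormZ cnormR ger0_norm ?invr_ge0 // (isometric_hnorm _ ug.1) exprMn => h1 h2.
    apply/esym/eqP; rewrite -subr_eq0; apply/eqP/hnorm_eq0/eqP; rewrite -sqrf_eq0 eq_le sqr_ge0 andbT.
    by move: h1 h2; move: (hnorm _ ^+ 2) (hnorm _ ^+ 2) (hnorm _ ^+ 2) => a b c; lra.
  exists p; split=> // s fs; apply/eqP; rewrite -subr_eq0; apply/eqP/cnorm_eq0/eqP.
  rewrite eq_le cnorm_ge0 andbT; apply: (@le_eps0 _ _ (hnorm s)) => e /Sp[C aC hC].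
  rewrite -(inner_av _ _ _ aC fs) -innerBl; apply: le_trans (cauchy_schwarz _ _) _.
  by rewrite mulrC hnormBC ler_wpM2l ?hnorm_ge0 // ltW.
have [p [fp ip _]] := key T bT; exists p => // T' e aT' e0.
have [p' [fp' ip' hp']] := key T' (averages_bounded bT aT').
have pp : p = p'.
  apply/eqP; rewrite -subr_eq0; apply/eqP/hnorm_eq0/eqP; rewrite -sqrf_eq0 hnorm_sq.
  have fd : fixed_vectors (p - p').
    by move=> g Gg; rewrite (linB _ _ (bounded_lin (unitary_bounded (G_unitary Gg)))) fp // fp'.
  by rewrite innerBl ip // ip' // (inner_av _ _ _ aT' fd) subrr.
have [C aC hC] := hp' e e0; exists C => // C' aC'.
by apply: averages_near aC' => //; rewrite pp.
Qed.

Definition operator_span (S : set (H -> H)) (V : set H) : set H :=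
  [set x | exists (n : nat) (T : 'I_n -> H -> H) (v : 'I_n -> H),
    (forall k, S (T k) /\ V (v k)) /\ x = \sum_(k < n) T k (v k)].

(** On [B v] with [B] in [S] and [v] fixed, an average [C] acts as [B (C v)], so the limit is
    dictated by [fixed_average]. The common norm bound of all averages carries convergence to the
    closed span. In the application [S] is the field algebra of a double cone spacelike to that of
    [T]. *)
Lemma average_operator (S : set (H -> H)) T : bounded_op T ->
  (forall B, S B -> bounded_op B /\ forall g, G g -> B \o Ad g T = Ad g T \o B) ->
  dense_in (operator_span S fixed_vectors) ->
  exists2 E, bounded_op E & forall x C0 (e : R), averages T C0 -> 0 < e ->
    exists2 C, averages C0 C & forall C', averages C C' -> hnorm (C' x - E x) < e.
Proof.
move=> bT hS dS; have [M M0 hM] := bounded_hnorm bT.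
have /boolp.choice[p hp] : forall x, exists p, fixed_vectors x -> fixed_vectors p /\
    forall T' (e : R), averages T T' -> 0 < e ->
      exists2 C, averages T' C & forall C', averages C C' -> hnorm (C' x - p) < e.
  move=> x; have [fx|nfx] := pselect (fixed_vectors x); last by exists 0.
  by have [p fp h] := fixed_average bT fx; exists p.
have SC B C : S B -> averages T C -> B \o C = C \o B.
  move=> SB; have [bB hB] := hS B SB; move: C; apply: averages_ind2 => // A D hA hD.
  rewrite comp_lin_scale ?comp_lin_add ?hA ?hD //; exact: bounded_lin.
(* Convergence along the directed family of averages: from any [C0] already reached, further
   averaging comes near [y] and stays there. Several vectors can therefore be treated one after the
   other. *)
pose close x y := forall C0 (e : R), averages T C0 -> 0 < e ->
    exists2 C, averages C0 C & forall C', averages C C' -> hnorm (C' x - y) < e.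
have close_lin c x y x' y' : close x y -> close x' y' -> close (c *: x + x') (c *: y + y').
  move=> h h' C0 e aC0 e0; have c1 : 0 < cnorm c + 1 by rewrite ltr_wpDl ?cnorm_ge0.
  have [C1 aC1 hC1] := h C0 (e / 2 / (cnorm c + 1)) aC0 (divr_gt0 (divr_gt0 e0 (ltr0n _ 2)) c1).
  have [C2 aC2 hC2] := h' C1 (e / 2) (averages_trans aC0 aC1) (divr_gt0 e0 (ltr0n _ 2)).
  exists C2; first exact: averages_trans aC1 aC2.
  move=> C' aC'; have aTC' := averages_trans (averages_trans aC0 (averages_trans aC1 aC2)) aC'.
  have lC' := bounded_lin (averages_bounded bT aTC').
  rewrite (lC' c x x') opprD addrACA -scalerBr; apply: le_lt_trans (hnormD _ _) _; rewrite hnormZ.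
  rewrite [e]splitr; apply: ler_ltD; last exact: hC2.
  rewrite -[leRHS](divfK (lt0r_neq0 c1)) mulrC.
  apply: ler_pM; rewrite ?cnorm_ge0 ?hnorm_ge0 //; last by rewrite lerDl.
  by apply/ltW/hC1; exact: averages_trans aC2 aC'.
have close0 : close 0 0.
  move=> C0 e aC0 e0; exists C0; first exact: averages_refl.
  move=> C' aC'; rewrite subr0 (lin0 (bounded_lin (averages_bounded bT (averages_trans aC0 aC')))).
  by rewrite hnorm0.
have closeS B x : S B -> fixed_vectors x -> close (B x) (B (p x)).
  move=> SB fx C0 e aC0 e0; have [_ hpx] := hp x fx; have [bB _] := hS B SB.
  have [N N0 hN] := bounded_hnorm bB.
  have [C aC hC] := hpx C0 (e / N) aC0 (divr_gt0 e0 N0); exists C => // C' aC'.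
  have /(congr1 (@^~ x)) /= <- := SC B C' SB (averages_trans aC0 (averages_trans aC aC')).
  rewrite -(linB _ _ (bounded_lin bB)); apply: le_lt_trans (hN _) _.
  by rewrite mulrC -ltr_pdivlMr // hC.
have close_bound x y : close x y -> hnorm y <= M * hnorm x.
  move=> h; rewrite -subr_le0; apply: (@le_eps0 _ _ 1) => e e0.
  have [C aC /(_ C (averages_refl C)) hC] := h T e (averages_refl T) e0.
  have := averages_bound bT hM aC x; have := hnormD (y - C x) (C x); rewrite subrK.
  by move: hC; rewrite hnormBC; move: (hnorm _) (hnorm _) (hnorm _) (M * _) => a b c d; lra.
have close_span n (B : 'I_n -> H -> H) v : (forall k, S (B k) /\ fixed_vectors (v k)) ->
    close (\sum_(k < n) B k (v k)) (\sum_(k < n) B k (p (v k))).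
  elim: n B v => [|n IH] B v hB; first by rewrite !big_ord0.
  rewrite !big_ord_recl -[B ord0 (v ord0)]scale1r -[B ord0 (p _)]scale1r.
  apply: close_lin; first by apply: closeS; case: (hB ord0).
  by apply: (IH (fun k => B (lift ord0 k)) (fun k => v (lift ord0 k))) => k; exact: hB.
have [||||E bE hE] := @dense_extension R H H close M.
- exact: ltW.
- exact: close_lin.
- exact: close_bound.
- move=> x e e0; have [_ [n [B [v [hB ->]]]] h] := dS x e e0.
  exists (\sum_(k < n) B k (v k)) => //; exists (\sum_(k < n) B k (p (v k))).
  exact: close_span.
exists E => // x C0 e aC0 e0.
have [N N0 hN] := bounded_hnorm bE.
(* The three shares are [M d] for [C' (x - z)], [d] for [C' z - E z], and [N d] for [E (z - x)]. *)
pose d := e / (1 + (M + N)).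
have MN : 0 < 1 + (M + N) by rewrite addr_gt0 // addr_gt0.
have d0 : 0 < d by rewrite divr_gt0.
have [_ [n [B [v [hB ->]]]] h] := dS x d d0.
set z := \sum_(k < n) _ in h.
have cz : close z (E z) by have h1 := close_span n B v hB; rewrite (hE _ _ h1).
have [C aC hC] := cz C0 d aC0 d0; exists C => // C' aC'.
have aTC' := averages_trans (averages_trans aC0 aC) aC'.
have bC' := averages_bounded bT aTC'.
apply: le_lt_trans (hnorm_tri (C' z) _ _) _.
rewrite -(linB _ _ (bounded_lin bC')).
have h1 := averages_bound bT hM aTC' (x - z).
have h2 := hnorm_tri (E z) (C' z) (E x); have h3 := hC C' aC'.
have h4 : hnorm (E z - E x) <= N * hnorm (x - z).
  by rewrite -(linB _ _ (bounded_lin bE)) [leRHS]/(_ * _) hnormBC; exact: hN.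
have -> : e = d + (M * d + N * d) by rewrite /d; field; rewrite gt_eqF.
have h5 : M * hnorm (x - z) <= M * d by rewrite ler_wpM2l // ltW.
have h6 : N * hnorm (x - z) <= N * d by rewrite ler_wpM2l // ltW.
move: h1 h2 h3 h4 h5 h6; move: (hnorm _) (hnorm _) (hnorm _) (hnorm _) (M * d) (N * d) => *.
lra.
Qed.

End Averages.

(** * Double cones and spacelike cones *)

Section Geometry.
Variable R : realType.
Local Notation M3 := (spacetime R).
Implicit Types (u v x y a : M3) (S O C : set M3) (s t e r : R).

Let c1 v : R := v 0 (inord 1).
Let c2 v : R := v 0 (inord 2).
Let e0 : M3 := delta_mx 0 (inord 0).

Let coordD u v : [/\ time (u + v) = time u + time v, c1 (u + v) = c1 u + c1 v
  & c2 (u + v) = c2 u + c2 v].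
Proof. by rewrite /time /c1 /c2 !mxE. Qed.

Let coordZ s v : [/\ time (s *: v) = s * time v, c1 (s *: v) = s * c1 v
  & c2 (s *: v) = s * c2 v].
Proof. by rewrite /time /c1 /c2 !mxE. Qed.

Let coordN v : [/\ time (- v) = - time v, c1 (- v) = - c1 v & c2 (- v) = - c2 v].
Proof. by rewrite /time /c1 /c2 !mxE. Qed.

Let coord0 : [/\ time e0 = 1, c1 e0 = 0 & c2 e0 = 0].
Proof.
by rewrite /time /c1 /c2 /e0 !mxE !eqxx /= -!val_eqE /= !inordK.
Qed.

Let coord_eq0 v : time v = 0 -> c1 v = 0 -> c2 v = 0 -> v = 0.
Proof.
move=> h0 h1 h2; apply/rowP => i; rewrite mxE.
have : (i = inord 0) \/ (i = inord 1) \/ (i = inord 2).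
  case: i => [[|[|[|//]]] hi]; [left|right; left|right; right];
  by apply/val_inj; rewrite /= inordK.
by case=> [->|[->|->]].
Qed.

Ltac vec_ring := apply/rowP => ?; rewrite !mxE; ring.

(** The Cauchy-Schwarz inequality for the spatial parts bounds their product by that of the times,
    strictly. *)
Lemma future_add u v : future u -> future v -> future (u + v).
Proof.
move=> [u0 hu] [v0 hv]; rewrite /future /space_sq -/(c1 _) -/(c2 _).
have [-> -> ->] := coordD u v; move: hu hv; rewrite /space_sq -/(c1 _) -/(c2 _).
rewrite -/(c1 v) -/(c2 v).
move: u0 v0; move: (time u) (time v) (c1 u) (c1 v) (c2 u) (c2 v) => t s p q p' q'.
move=> t0 s0 ht hs; split; first exact: addr_gt0.
have ts : 0 < t * s by exact: mulr_gt0.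
have h : (p * q + p' * q') ^+ 2 < (t * s) ^+ 2.
  have h1 : (p * q + p' * q') ^+ 2 <= (p ^+ 2 + p' ^+ 2) * (q ^+ 2 + q' ^+ 2).
    have := sqr_ge0 (p * q' - p' * q); nra.
  apply: le_lt_trans h1 _; rewrite exprMn.
  by apply: ltr_pM; rewrite ?addr_ge0 ?sqr_ge0.
have : p * q + p' * q' < t * s.
  rewrite ltNge; apply/negP => h'.
  by move: h; rewrite ltNge ler_sqr ?nnegrE ?(ltW ts) ?h' // (le_trans (ltW ts)).
by nra.
Qed.

Lemma future_scale s u : 0 < s -> future u -> future (s *: u).
Proof.
move=> s0 [u0 hu]; rewrite /future /space_sq -/(c1 _) -/(c2 _).
have [-> -> ->] := coordZ s u; split; first exact: mulr_gt0.
by rewrite !exprMn -mulrDr ltr_pM2l // exprn_gt0.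
Qed.

(** A coordinate box in place of a norm; openness and boundedness of cones are all measured by
    it. *)
Definition within e v := [/\ `|time v| <= e, `|c1 v| <= e & `|c2 v| <= e].

Lemma within_scale e s v : within e v -> within (`|s| * e) (s *: v).
Proof.
move=> [h0 h1 h2]; have [E0 E1 E2] := coordZ s v.
by split; rewrite ?E0 ?E1 ?E2 normrM ler_wpM2l.
Qed.

Lemma within_add e e' u v : within e u -> within e' v -> within (e + e') (u + v).
Proof.
move=> [h0 h1 h2] [k0 k1 k2]; have [E0 E1 E2] := coordD u v.
by split; rewrite ?E0 ?E1 ?E2; apply: le_trans (ler_normD _ _) _; exact: lerD.
Qed.

Lemma within_le e e' v : e <= e' -> within e v -> within e' v.
Proof. by move=> ee' [h0 h1 h2]; split; exact: le_trans ee'. Qed.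

Lemma within_exists v : exists2 r, 0 < r & within r v.
Proof.
exists (`|time v| + `|c1 v| + `|c2 v| + 1); first by rewrite ltr_wpDl // !addr_ge0.
have := normr_ge0 (time v); have := normr_ge0 (c1 v); have := normr_ge0 (c2 v).
by split; lra.
Qed.

Lemma future_open v : future v -> exists2 e, 0 < e & forall u, within e u -> future (v + u).
Proof.
move=> [t0 h]; set t := time v in t0 h.
have rho0 : 0 <= space_sq v by rewrite addr_ge0 ?sqr_ge0.
(* This [r] gives [(t - r) ^+ 2 = space_sq v + r ^+ 2], so [v - r *: e0] is still future directed,
   and the remaining [r *: e0] tolerates a perturbation of size [r / 4]. *)
pose r := (t ^+ 2 - space_sq v) / (2 * t).
have r0 : 0 < r by rewrite divr_gt0 ?subr_gt0 // mulr_gt0.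
have rE : 2 * t * r = t ^+ 2 - space_sq v by rewrite /r; field; rewrite gt_eqF.
have tr : 0 < t - r.
  have : 0 < 2 * t * (t - r) by rewrite mulrBr rE; nra.
  by rewrite pmulr_rgt0 // mulr_gt0.
exists (r / 4); first by rewrite divr_gt0.
move=> u [u0 u1 u2].
have -> : v + u = (v - r *: e0) + (r *: e0 + u) by rewrite addrA subrK.
have [E0 E1 E2] := coordZ r e0; have [F0 F1 F2] := coord0.
apply: future_add.
  rewrite /future /space_sq -/(c1 _) -/(c2 _).
  have [-> -> ->] := coordD v (- (r *: e0)); have [-> -> ->] := coordN (r *: e0).
  rewrite E0 E1 E2 F0 F1 F2 mulr0 oppr0 !addr0 mulr1 -/t; split=> //.
  by rewrite -/(space_sq v); nra.
rewrite /future /space_sq -/(c1 _) -/(c2 _).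
have [-> -> ->] := coordD (r *: e0) u.
rewrite E0 E1 E2 F0 F1 F2 mulr0 !add0r mulr1.
move: u0 u1 u2; rewrite !ler_norml => /andP[? ?] /andP[? ?] /andP[? ?].
split; first by lra.
have : c1 u ^+ 2 <= (r / 4) ^+ 2 by nra.
have : c2 u ^+ 2 <= (r / 4) ^+ 2 by nra.
have : (3 / 4 * r) ^+ 2 <= (r + time u) ^+ 2 by nra.
by nra.
Qed.

Lemma future_time_shift v : exists2 r, 0 < r & future (v + r *: e0).
Proof.
have rho0 : 0 <= space_sq v by rewrite addr_ge0 ?sqr_ge0.
exists (`|time v| + space_sq v + 1); first by rewrite ltr_wpDl // addr_ge0.
set r := _ + _ + 1.
rewrite /future /space_sq -/(c1 _) -/(c2 _).
have [E0 E1 E2] := coordZ r e0; have [F0 F1 F2] := coord0.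
have [-> -> ->] := coordD v (r *: e0).
rewrite E0 E1 E2 F0 F1 F2 mulr0 !addr0 mulr1 -/(space_sq v).
have h : space_sq v + 1 <= time v + r.
  by have := ler_norm (- time v); rewrite normrN /r; lra.
by split; nra.
Qed.

(** The tips can be placed on the time axis, so far in the past and in the future that they see both
    double cones. *)
Lemma double_cone_big O1 O2 : double_cone O1 -> double_cone O2 ->
  exists O, [/\ double_cone O, O1 `<=` O & O2 `<=` O].
Proof.
move=> [a [b [fab ->]]] [a' [b' [fab' ->]]].
have shift v v' : exists2 r, 0 < r & future (v + r *: e0) /\ future (v' + r *: e0).
  have fe s : 0 < s -> future (s *: e0).
    move=> s0; apply: future_scale => //; have [F0 F1 F2] := coord0.
    by rewrite /future /space_sq -/(c1 _) -/(c2 _) F0 F1 F2; split; lra.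
  have [r r0 h] := future_time_shift v; have [r' r'0 h'] := future_time_shift v'.
  exists (r + r'); first exact: addr_gt0.
  rewrite scalerDl addrA; split; first by apply: future_add => //; exact: fe.
  by rewrite [r *: _ + _]addrC addrA; apply: future_add => //; exact: fe.
have [r r0 [h1 h2]] := shift a a'; have [s s0 [k1 k2]] := shift (- b) (- b').
exists [set x | future (x - (- (r *: e0))) /\ future (s *: e0 - x)]; split.
- exists (- (r *: e0)), (s *: e0); split=> //.
  have -> : s *: e0 - - (r *: e0) = (- b + s *: e0) + ((b - a) + (a + r *: e0)).
    by move: e0 => w; vec_ring.
  by apply: future_add => //; exact: future_add.
- move=> x [xa bx]; split.
    have -> : x - - (r *: e0) = (x - a) + (a + r *: e0) by move: e0 => w; vec_ring.
    exact: future_add.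
  rewrite (_ : _ - x = (- b + s *: e0) + (b - x)); first exact: future_add.
  by move: e0 => w; vec_ring.
- move=> x [xa bx]; split.
    have -> : x - - (r *: e0) = (x - a') + (a' + r *: e0) by move: e0 => w; vec_ring.
    exact: future_add.
  rewrite (_ : _ - x = (- b' + s *: e0) + (b' - x)); first exact: future_add.
  by move: e0 => w; vec_ring.
Qed.

Lemma translateP S x z : translate S x z <-> S (z - x).
Proof.
split=> [[y Sy <-]|h]; first by rewrite addrK.
by exists (z - x) => //; rewrite subrK.
Qed.

Lemma translate0 S : translate S 0 = S.
Proof. by apply/seteqP; split=> z; rewrite translateP subr0. Qed.

Lemma translateD S x y : translate (translate S x) y = translate S (x + y).
Proof. by apply/seteqP; split=> z; rewrite !translateP opprD addrA addrAC. Qed.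

Lemma translate_mono S (T : set M3) x : S `<=` T -> translate S x `<=` translate T x.
Proof. by move=> ST z; rewrite !translateP => /ST. Qed.

Lemma double_cone_translate O x : double_cone O -> double_cone (translate O x).
Proof.
move=> [a [b [fab ->]]]; exists (a + x), (b + x); split.
  have -> : b + x - (a + x) = b - a by vec_ring.
  exact: fab.
apply/seteqP; split=> z; rewrite translateP /=;
  (have -> : z - x - a = z - (a + x) by vec_ring);
  by have -> : b - (z - x) = b + x - z by vec_ring.
Qed.

Lemma double_cone_bounded O : double_cone O -> exists2 r, 0 < r & forall u, O u -> within r u.
Proof.
move=> [a [b [fab ->]]]; have [r r0 ha] := within_exists a.
have ba : 0 < time (b - a) by case: fab.
exists (time (b - a) + r); first exact: addr_gt0.
move=> u [[ua hu] [bu _]]; rewrite -[u](subrK a); apply: within_add => //.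
have tE : time (b - a) = time (b - u) + time (u - a).
  by have [<- _ _] := coordD (b - u) (u - a); rewrite addrA subrK.
have ht : time (u - a) <= time (b - a) by lra.
have key (c : R) : c ^+ 2 < time (u - a) ^+ 2 -> `|c| <= time (b - a).
  move=> h; rewrite -[time _]ger0_norm ?(ltW ba) // -ler_sqr ?nnegrE // !real_normK ?num_real //.
  by nra.
move: hu; rewrite /space_sq -/(c1 _) -/(c2 _) => hu.
have := sqr_ge0 (c1 (u - a)); have := sqr_ge0 (c2 (u - a)) => s1 s2.
split; last by apply: key; lra.
  by rewrite ger0_norm // ltW.
by apply: key; lra.
Qed.

Lemma double_cone_open O v : double_cone O -> O v ->
  exists2 e, 0 < e & forall u, within e u -> O (v + u).
Proof.
move=> [a [b [fab ->]]] [va bv].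
have [e e0' he] := future_open va; have [e' e0'' he'] := future_open bv.
exists (Num.min e e'); first by rewrite lt_min e0'.
move=> u hu; split.
  by rewrite addrAC; apply: he; apply: within_le hu; rewrite ge_min lexx.
rewrite opprD addrA; apply: he'; apply: (@within_le (Num.min e e')).
  by rewrite ge_min lexx orbT.
by have := within_scale (-1) hu; rewrite scaleN1r normrN1 mul1r.
Qed.

Lemma spacelikeN v : spacelike (- v) = spacelike v.
Proof.
rewrite /spacelike /space_sq -/(c1 _) -/(c2 _); have [-> -> ->] := coordN v.
by rewrite !sqrrN.
Qed.

Lemma causal_complement_sym S (T : set M3) : S `<=` causal_complement T -> T `<=` causal_complement S.
Proof. by move=> h y Ty x /h /(_ y Ty); rewrite -spacelikeN opprB. Qed.

Lemma causal_complement_mono S (T : set M3) : S `<=` T -> causal_complement T `<=` causal_complement S.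
Proof. by move=> ST y h x /ST; exact: h. Qed.

Lemma causal_complement_translate S x :
  causal_complement (translate S x) = translate (causal_complement S) x.
Proof.
apply/seteqP; split=> y; rewrite translateP => h z.
  by move=> Sz; rewrite -addrA [_ + - z]addrC -opprD; apply: h; exists z.
by rewrite translateP => /h; rewrite opprB addrA subrK.
Qed.

(* [x] is the apex, [K] the cone of directions. *)
Record cone_directions (C : set M3) (x : M3) (K : set M3) : Prop := ConeDirections {
  cone_mem : forall z, C z <-> K (z - x);
  cone_nonempty : exists a, K a;
  cone_add : forall u v, K u -> K v -> K (u + v);
  cone_scale : forall s u, 0 < s -> K u -> K (s *: u);
  cone_open : forall v, K v -> exists2 e, 0 < e & forall u, within e u -> K (v + u);
  cone_spacelike : forall v, K v -> spacelike v }.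

(** That directions are spacelike comes from [C = C'']. A causal direction could be tilted, by
    openness, to a timelike [w]; the ray along [w] would eventually be timelike to any given point,
    so [C'] would be empty and [C''] everything. Then the apex would belong to [C], that is, 0 would
    be a direction, against [~ O 0]. *)
Lemma spacelike_cone_directions C : spacelike_cone C -> exists x K, cone_directions C x K.
Proof.
case=> x [] O [dO O0 CE CC].
pose K : set M3 := [set v | exists2 l : R, 0 < l & O (l^-1 *: v)].
have memK z : C z <-> K (z - x).
  rewrite CE; split=> [[l [y Oy [l0 ->]]]|[l l0 Oz]].
    by exists l => //; rewrite addrAC subrr add0r scalerA mulVf ?gt_eqF // scale1r.
  exists l, (l^-1 *: (z - x)) => //; split=> //.
  by rewrite scalerA divff ?gt_eqF // scale1r addrC subrK.
have scaleK s u : 0 < s -> K u -> K (s *: u).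
  move=> s0 [l l0 Ou]; exists (s * l); first exact: mulr_gt0.
  by rewrite scalerA invfM -mulrA mulrC -mulrA mulfV ?gt_eqF // mulr1.
have openK v : K v -> exists2 e, 0 < e & forall u, within e u -> K (v + u).
  move=> [l l0 Ov]; have [e e0' he] := double_cone_open dO Ov.
  exists (l * e); first exact: mulr_gt0.
  move=> u hu; exists l => //; rewrite scalerDr; apply: he.
  have -> : e = `|l^-1| * (l * e).
    by rewrite gtr0_norm ?invr_gt0 // mulKf // gt_eqF.
  exact: within_scale.
have K0 : ~ K 0 by move=> [l _]; rewrite scaler0.
have exK : exists a, K a.
  have [a [b [fab OE]]] := dO; exists (2^-1 *: (a + b)), 1; first exact: ltr01.
  rewrite invr1 scale1r OE /=.
  have -> : 2^-1 *: (a + b) - a = 2^-1 *: (b - a).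
    by apply/rowP => i; rewrite !mxE; field.
  have -> : b - 2^-1 *: (a + b) = 2^-1 *: (b - a).
    by apply/rowP => i; rewrite !mxE; field.
  by split; apply: future_scale.
exists x, K; split=> //.
  move=> u v [l l0 Ou] [m m0 Ov]; exists (l + m); first exact: addr_gt0.
  have [a [b [fab OE]]] := dO; move: Ou Ov; rewrite OE /= => -[h1 h2] [k1 k2].
  have lm : 0 < (l + m)^-1 by rewrite invr_gt0 addr_gt0.
  have lm0 : l + m != 0 by rewrite gt_eqF // addr_gt0.
  have l0' : l != 0 by rewrite gt_eqF.
  have m0' : m != 0 by rewrite gt_eqF.
  have -> : (l + m)^-1 *: (u + v) - a =
      (l + m)^-1 *: (l *: (l^-1 *: u - a) + m *: (m^-1 *: v - a)).
    by apply/rowP => i; rewrite !mxE; field; rewrite lm0 l0' m0'.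
  have -> : b - (l + m)^-1 *: (u + v) =
      (l + m)^-1 *: (l *: (b - l^-1 *: u) + m *: (b - m^-1 *: v)).
    by apply/rowP => i; rewrite !mxE; field; rewrite lm0 l0' m0'.
  by split; apply: future_scale => //; apply: future_add; apply: future_scale.
move=> v Kv; rewrite /spacelike ltNge; apply/negP => hv.
have [w Kw hw] : exists2 w, K w & space_sq w < time w ^+ 2.
  have [e e0' he] := openK v Kv.
  have t0 : time v != 0.
    apply/eqP => t0; apply: K0; rewrite -(@coord_eq0 v) //.
      by move: hv; rewrite /space_sq -/(c1 _) -/(c2 _) t0; nra.
    by move: hv; rewrite /space_sq -/(c1 _) -/(c2 _) t0; nra.
  (* A shift along the time axis, away from time zero, makes a lightlike direction timelike without
     leaving the open set [K]. *)
  pose s := if 0 < time v then e else - e.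
  exists (v + s *: e0).
    apply: he; have [F0 F1 F2] := coord0; have [E0 E1 E2] := coordZ s e0.
    have se : `|s| = e by rewrite /s; case: ifP => _; rewrite ?normrN gtr0_norm.
    by split; rewrite ?E0 ?E1 ?E2 ?F0 ?F1 ?F2 ?mulr0 ?mulr1 ?se // normr0 ltW.
  have [F0 F1 F2] := coord0; have [E0 E1 E2] := coordZ s e0.
  have [D0 D1 D2] := coordD v (s *: e0).
  rewrite /space_sq -/(c1 _) -/(c2 _) D0 D1 D2 E0 E1 E2 F0 F1 F2 mulr0 !addr0 mulr1.
  apply: le_lt_trans hv _; rewrite /s; case: ifP => [h|]; first by nra.
  by move=> /negbT; rewrite -leNgt le_eqVlt (negbTE t0) /= => h; nra.
have Cempty y : ~ causal_complement C y.
  move=> hy.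
  have {}hy l : 0 < l -> spacelike (y - x - l *: w).
    move=> l0; rewrite -addrA -opprD; apply: hy; apply/memK.
    by rewrite addrAC subrr add0r; exact: scaleK.
  move: hy hw; rewrite /spacelike /space_sq -/(c1 _) -/(c2 _) => hy hw.
  set z := y - x in hy.
  pose A := time w ^+ 2 - (c1 w ^+ 2 + c2 w ^+ 2).
  pose B := time z * time w - c1 z * c1 w - c2 z * c2 w.
  pose D := time z ^+ 2 - c1 z ^+ 2 - c2 z ^+ 2.
  have A0 : 0 < A by rewrite subr_gt0.
  have key l : 0 < l -> l ^+ 2 * A - 2 * l * B + D < 0.
    move=> /hy; have [E0 E1 E2] := coordD z (- (l *: w)).
    have [N0 N1 N2] := coordN (l *: w); have [S0 S1 S2] := coordZ l w.
    rewrite -!/(c1 _) -!/(c2 _) E0 E1 E2 N0 N1 N2 S0 S1 S2 /A /B /D => h.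
    by move: h; rewrite -subr_lt0; congr (_ < _); ring.
  (* Large enough for [l ^+ 2 * A - 2 * l * B + D] to be positive, against [key]: the point
     [x + l *: w] is then timelike to [y]. *)
  pose l := (2 * `|B| + `|D| + 1) / A + 1.
  have N0 : 0 <= (2 * `|B| + `|D| + 1) / A by rewrite divr_ge0 ?(ltW A0) // !addr_ge0 // mulr_ge0.
  have l1 : 1 <= l by rewrite lerDr.
  have lA : l * A = 2 * `|B| + `|D| + 1 + A by rewrite /l; field; rewrite gt_eqF.
  have := key l (lt_le_trans ltr01 l1).
  have hB := ler_norm B; have hD := ler_norm (- D); rewrite normrN in hD.
  have D0 := normr_ge0 D.
  have -> : l ^+ 2 * A - 2 * l * B + D = l * (l * A - 2 * B) + D by ring.
  rewrite lA => h.
  have : l * (`|D| + 1) <= l * (2 * `|B| + `|D| + 1 + A - 2 * B).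
    by rewrite ler_wpM2l ?(le_trans ler01) //; lra.
  have : `|D| + 1 <= l * (`|D| + 1) by rewrite -[leLHS]mul1r ler_wpM2r // addr_ge0.
  lra.
by apply: K0; rewrite -(subrr x); apply/memK; rewrite CC => y /Cempty.
Qed.

(** * Translates of a spacelike cone along its own directions *)

Section Cone.
Variables (C : set M3) (x : M3) (K : set M3).
Hypothesis dC : cone_directions C x K.

Lemma cone_translate y : cone_directions (translate C y) (x + y) K.
Proof.
case: dC => h1 h2 h3 h4 h5 h6; split=> // z.
by rewrite translateP h1 (_ : z - y - x = z - (x + y)) //; vec_ring.
Qed.

Lemma cone_shift_sub a t : K a -> 0 <= t -> translate C (t *: a) `<=` C.
Proof.
move=> Ka; rewrite le_eqVlt => /orP[/eqP <-|t0] z.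
  by rewrite scale0r translate0.
rewrite translateP !(cone_mem dC) => h.
have -> : z - x = (z - t *: a - x) + t *: a by vec_ring.
by apply: (cone_add dC) => //; exact: (cone_scale dC).
Qed.

Lemma cone_shift_antitone a s t : K a -> s <= t ->
  translate C (t *: a) `<=` translate C (s *: a).
Proof.
move=> Ka st z; rewrite !translateP => h.
have -> : z - s *: a = (z - t *: a) + (t - s) *: a by vec_ring.
apply: (cone_shift_sub Ka (t := t - s)); first by rewrite subr_ge0.
by rewrite translateP addrK.
Qed.

Let scale_in a e' r t (w : M3) : 0 < e' -> 0 < r -> r / e' <= t ->
  (forall u, within e' u -> K (a + u)) -> within r w -> K (t *: a + w).
Proof.
move=> e'0 r0 ht hK hw.
have t0 : 0 < t by apply: lt_le_trans ht; rewrite divr_gt0.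
have -> : t *: a + w = t *: (a + t^-1 *: w).
  by rewrite scalerDr scalerA divff ?gt_eqF // scale1r.
apply: (cone_scale dC) => //; apply: hK.
apply: (@within_le (`|t^-1| * r)); last exact: within_scale.
rewrite gtr0_norm ?invr_gt0 // mulrC ler_pdivrMr // mulrC.
by rewrite -ler_pdivrMr.
Qed.

(** A neighbourhood of [a] consists of directions; scaled by a large [t] it absorbs the bounded
    vectors [x - u] with [u] in [O]. Differences between the shifted cone and [O] are then
    directions themselves, hence spacelike. *)
Lemma shifted_cone_avoids a O : K a -> double_cone O ->
  exists2 T, 0 <= T & forall t, T <= t -> O `<=` causal_complement (translate C (t *: a)).
Proof.
move=> Ka /double_cone_bounded[r r0 hr]; have [e e1 he] := cone_open dC Ka.
have [r' r'0 hx] := within_exists x.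
exists ((r' + r) / e); first by rewrite divr_ge0 ?ltW // addr_gt0.
move=> t ht u /hr hu z; rewrite translateP (cone_mem dC) => hz.
rewrite -spacelikeN opprB; apply: (cone_spacelike dC).
have -> : z - u = (z - t *: a - x) + (t *: a + (x - u)) by vec_ring.
apply: (cone_add dC) => //; apply: (@scale_in a e (r' + r)) => //; first exact: addr_gt0.
apply: within_add => //.
by have := within_scale (-1) hu; rewrite scaleN1r normrN1 mul1r.
Qed.

Lemma shift_into_complement a O : K a -> double_cone O ->
  exists2 T, 0 <= T & forall t, T <= t -> translate O (- (t *: a)) `<=` causal_complement C.
Proof.
move=> Ka dO; have [T T0 hT] := shifted_cone_avoids Ka dO; exists T => // t /hT h.
move=> y; rewrite translateP => /h hy z Cz.
have := hy (z + t *: a); rewrite translateP addrK => /(_ Cz).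
by congr spacelike; vec_ring.
Qed.

Lemma shift_into_cone a O : K a -> double_cone O ->
  exists2 T, 0 <= T & forall t, T <= t -> translate O (t *: a) `<=` C.
Proof.
move=> Ka /double_cone_bounded[r r0 hr]; have [e e1 he] := cone_open dC Ka.
have [r' r'0 hx] := within_exists x.
exists ((r + r') / e); first by rewrite divr_ge0 ?ltW // addr_gt0.
move=> t ht z; rewrite translateP (cone_mem dC) => /hr hz.
have -> : z - x = t *: a + ((z - t *: a) - x) by vec_ring.
apply: (@scale_in a e (r + r')) => //; first exact: addr_gt0.
apply: within_add => //.
by have := within_scale (-1) hx; rewrite scaleN1r normrN1 mul1r.
Qed.

Lemma shifted_cone_sub a y : K a ->
  exists2 T, 0 <= T & forall t, T <= t -> translate C (t *: a) `<=` translate C y.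
Proof.
move=> Ka; have [e e1 he] := cone_open dC Ka; have [r r0 hy] := within_exists (- y).
exists (r / e); first by rewrite divr_ge0 ?ltW.
move=> t ht z; rewrite !translateP !(cone_mem dC) => hz.
have -> : z - y - x = (z - t *: a - x) + (t *: a + - y) by vec_ring.
by apply: (cone_add dC) => //; exact: (@scale_in a e r).
Qed.

Lemma complement_shift a t O : K a -> 0 <= t -> O `<=` causal_complement C ->
  translate O (- (t *: a)) `<=` causal_complement C.
Proof.
move=> Ka t0 h y; rewrite translateP => /h hy z Cz.
have := hy (z + t *: a) (cone_shift_sub Ka t0 _).
rewrite translateP addrK => /(_ Cz); congr spacelike; vec_ring.
Qed.

(** The core sits around the midpoint of [O]. Half the diagonal of [O] is a future vector with some
    tolerance [e], shared equally between the half height of the core and its displacement. *)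
Lemma double_cone_core a O : double_cone O -> exists O' d,
  [/\ double_cone O', 0 < d & forall t, 0 <= t <= d -> translate O' (t *: a) `<=` O].
Proof.
move=> [p [q [fpq ->]]]; pose h := 2^-1 *: (q - p).
have fh : future h by apply: future_scale.
have [e e1 he] := future_open fh.
have [r r0 ha] := within_exists a.
pose s := e / 2; have s0 : 0 < s by rewrite divr_gt0.
have F := coord0.
have we0 : within s (s *: e0).
  have [E0 E1 E2] := coordZ s e0; case: F => F0 F1 F2.
  by split; rewrite ?E0 ?E1 ?E2 ?F0 ?F1 ?F2 ?mulr0 ?mulr1 ?normr0 ?gtr0_norm // ltW.
have fe l : 0 < l -> future (l *: e0).
  move=> l0; apply: future_scale => //; case: F => F0 F1 F2.
  by rewrite /future /space_sq -/(c1 _) -/(c2 _) F0 F1 F2; split; lra.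
pose m := 2^-1 *: (p + q).
exists [set z | future (z - (m - s *: e0)) /\ future (m + s *: e0 - z)], (s / r); split.
- exists (m - s *: e0), (m + s *: e0); split=> //.
  have -> : m + s *: e0 - (m - s *: e0) = (s + s) *: e0.
    by move: e0 m => w m; vec_ring.
  by apply: fe; exact: addr_gt0.
- by rewrite divr_gt0.
move=> t /andP[t0 ht] z; rewrite translateP /= => -[h1 h2].
have wt : within s (t *: a).
  apply: (@within_le (`|t| * r)); last exact: within_scale.
  by rewrite ger0_norm // -ler_pdivlMr.
have wN u l : within l u -> within l (- u).
  by move=> /(within_scale (-1)); rewrite scaleN1r normrN1 mul1r.
have ss : s + s = e by rewrite /s; field.
split.
  have -> : z - p = (z - t *: a - (m - s *: e0)) + (h + (t *: a - s *: e0)).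
    by rewrite /m /h; move: e0 => w; apply/rowP => i; rewrite !mxE; field.
  apply: future_add => //; apply: he; rewrite -ss; apply: within_add => //.
  exact: wN.
have -> : q - z = (m + s *: e0 - (z - t *: a)) + (h + (- (t *: a) - s *: e0)).
  by rewrite /m /h; move: e0 => w; apply/rowP => i; rewrite !mxE; field.
apply: future_add => //; apply: he; rewrite -ss; apply: within_add; exact: wN.
Qed.

(* Translate far along [-a]: consecutive small translates overlap, and far away
   everything fits into one double cone. *)
Lemma cone_complement_connected (P : set M3 -> Prop) :
  (forall O O', double_cone O -> double_cone O' -> O `<=` O' ->
     O' `<=` causal_complement C -> P O <-> P O') ->
  forall O1 O2, double_cone O1 -> double_cone O2 -> O1 `<=` causal_complement C ->
    O2 `<=` causal_complement C -> P O1 -> P O2.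
Proof.
move=> hP O1 O2 dO1 dO2 h1 h2.
have [a Ka] := cone_nonempty dC.
have step O d t : double_cone O -> O `<=` causal_complement C -> 0 <= t ->
    (exists O', [/\ double_cone O', O' `<=` O & translate O' (d *: a) `<=` O]) -> 0 <= d ->
    P (translate O (- (t *: a))) <-> P (translate O (- ((t + d) *: a))).
  move=> dO hO t0 [] O' [dO' s1 s2] d0.
  have dS u : double_cone (translate O u) by exact: double_cone_translate.
  rewrite -(hP (translate O' (- (t *: a)))).
  - apply: hP => //; [exact: double_cone_translate| |].
      have -> : - (t *: a) = d *: a - (t + d) *: a by vec_ring.
      by rewrite -translateD; exact: translate_mono.
    by apply: complement_shift => //; exact: addr_ge0.
  - exact: double_cone_translate.
  - exact: dS.
  - exact: translate_mono.
  - exact: complement_shift.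
have shift O (T : R) : double_cone O -> O `<=` causal_complement C -> 0 <= T ->
    P O <-> P (translate O (- (T *: a))).
  move=> dO hO; rewrite le_eqVlt => /orP[/eqP <-|T0].
    by rewrite scale0r oppr0 translate0.
  case: (double_cone_core a dO) => O' [d [dO' d0 hO']].
  (* The number of steps is such that a single step [r] is at most [d]. *)
  pose N := (Num.truncn (T / d)).+1; pose r := T / N%:R.
  have r0 : 0 <= r by rewrite divr_ge0 ?ltW.
  have rd : r <= d.
    rewrite ler_pdivrMr // mulrC -ler_pdivrMr //; apply: ltW.
    have : 0 <= T / d by rewrite divr_ge0 ?ltW.
    by move=> /truncn_itv /andP[].
  have sub : exists O', [/\ double_cone O', O' `<=` O & translate O' (r *: a) `<=` O].
    exists O'; split=> //; last by apply: hO'; rewrite r0.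
    by have := hO' 0; rewrite scale0r translate0 lexx (ltW d0); exact.
  suff ind k : P O <-> P (translate O (- ((k%:R * r) *: a))).
    by have := ind N; rewrite /r mulrCA divff ?mulr1 // gt_eqF.
  elim: k => [|k IH]; first by rewrite mul0r scale0r oppr0 translate0.
  rewrite IH -natr1 mulrDl mul1r; apply: step => //.
  by rewrite mulr_ge0 ?ler0n.
have [B [dB s1 s2]] := double_cone_big dO1 dO2.
have [T T0 /(_ T (lexx T)) hT] := shift_into_complement Ka dB.
rewrite (shift O1 T) // (shift O2 T) //.
have dS O u : double_cone O -> double_cone (translate O u) by exact: double_cone_translate.
rewrite (hP _ (translate B (- (T *: a)))) //; [|exact: dS|exact: dS|exact: translate_mono].
rewrite (hP (translate O2 _) (translate B (- (T *: a)))) //; [exact: dS|exact: dS|].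
exact: translate_mono.
Qed.

End Cone.

Lemma spacelike_cone_translate C y : spacelike_cone C -> spacelike_cone (translate C y).
Proof.
case=> x [] O [dO O0 CE CC]; exists (x + y), O; split=> //.
  rewrite CE; apply/seteqP; split=> z; rewrite translateP.
    move=> [l [w Ow [l0 h]]]; exists l, w => //; split=> //.
    by rewrite -[z](subrK y) h; vec_ring.
  move=> [l [w Ow [l0 ->]]]; exists l, w => //; split=> //.
  by vec_ring.
by rewrite !causal_complement_translate -CC.
Qed.

End Geometry.

(** * Algebras of a net *)

Section NetAlgebras.
Variables (R : realType) (H : hilbertSpace R) (N : local_net H).
Local Notation M3 := (spacetime R).
Implicit Types (S O : set M3) (T : H -> H).
Hypothesis N_vn : forall O, double_cone O -> von_neumann_algebra (N O).
Hypothesis N_isotony : isotonous N.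

Definition local_operators S : set (H -> H) :=
  [set A | exists2 O, double_cone O /\ O `<=` S & N O A].

Lemma local_star O : double_cone O -> star_closed (N O).
Proof.
move=> dO A NA; have [h1 h2] := N_vn dO; split; last exact: h1.
by have [] : bicommutant (N O) A by rewrite h2.
Qed.

Lemma local_cstar O : double_cone O -> cstar_algebra (N O).
Proof.
by move=> dO; rewrite -(N_vn dO).2; apply: cstar_bicommutant; exact: local_star.
Qed.

Lemma local_bounded O T : double_cone O -> N O T -> bounded_op T.
Proof. by move=> dO /(local_star dO)[]. Qed.

Lemma local_operators_star S : star_closed (local_operators S).
Proof.
move=> A [] O [dO OS] NA; have [bA NA'] := local_star dO NA.
by split=> //; exists O.
Qed.

Lemma local_operators_bounded S : local_operators S `<=` @bounded_op R H H.
Proof. exact/star_bounded/local_operators_star. Qed.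

Lemma local_operators_mono S S' : S `<=` S' -> local_operators S `<=` local_operators S'.
Proof. by move=> SS A [] O [dO OS] NA; exists O => //; split=> // x /OS /SS. Qed.

Lemma local_operators_in O S T : double_cone O -> O `<=` S -> N O T -> local_operators S T.
Proof. by move=> dO OS NT; exists O. Qed.

Lemma local_in_region O S T : double_cone O -> O `<=` S -> N O T -> region_algebra N S T.
Proof.
move=> dO OS NT; apply: sub_norm_closure; first exact: local_bounded NT.
exact: local_operators_in NT.
Qed.

Lemma local_quasilocal O T : double_cone O -> N O T -> quasilocal N T.
Proof. by move=> dO; exact: local_in_region. Qed.

Lemma region_mono S S' : S `<=` S' -> region_algebra N S `<=` region_algebra N S'.
Proof. by move=> SS; apply: norm_closure_mono; exact: local_operators_mono. Qed.

Lemma commutant_region S : commutant (region_algebra N S) = commutant (local_operators S).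
Proof. exact/commutant_norm_closure/local_operators_bounded. Qed.

Lemma bicommutant_region S : bicommutant (region_algebra N S) = bicommutant (local_operators S).
Proof. by rewrite /bicommutant commutant_region. Qed.

Lemma region_double_cone O : double_cone O -> bicommutant (local_operators O) = N O.
Proof.
move=> dO; rewrite -(N_vn dO).2; apply/seteqP; split; apply: bicommutant_mono.
  by move=> A [] O1 [dO1 OO] NA; exact: (N_isotony dO1 dO OO).
by move=> A NA; exists O => //; split.
Qed.

Lemma quasilocal_cstar : (exists O, double_cone O) -> cstar_algebra (quasilocal N).
Proof.
case=> O0 dO0; apply: cstar_norm_closure.
- exact: (@local_operators_star setT).
- by exists O0 => //; exact: cstar_id (local_cstar dO0).
- move=> A B [] O [dO _] NA [] O' [dO' _] NB.
  have [Q [dQ OQ OQ']] := double_cone_big dO dO'.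
  exists Q => //; apply: (cstar_add (local_cstar dQ)); first exact: (N_isotony dO dQ OQ).
  exact: (N_isotony dO' dQ OQ').
- move=> c A [] O [dO _] NA; exists O => //; exact: (cstar_scale (local_cstar dO)).
- move=> A B [] O [dO _] NA [] O' [dO' _] NB.
  have [Q [dQ OQ OQ']] := double_cone_big dO dO'.
  exists Q => //; apply: (cstar_comp (local_cstar dQ)); first exact: (N_isotony dO dQ OQ).
  exact: (N_isotony dO' dQ OQ').
Qed.

Variables (Sa : set M3) (xs : M3) (Ks : set M3).
Hypothesis dSa : cone_directions Sa xs Ks.

Lemma cone_vnE z : cone_complement_vn N Sa z =
  bicommutant (local_operators (causal_complement (translate Sa z))).
Proof. exact: bicommutant_region. Qed.

Lemma cone_vn_cstar z : cstar_algebra (cone_complement_vn N Sa z).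
Proof. by rewrite cone_vnE; exact/cstar_bicommutant/local_operators_star. Qed.

Lemma cone_vn_bounded z T : cone_complement_vn N Sa z T -> bounded_op T.
Proof. exact/cstar_bounded/cone_vn_cstar. Qed.

Lemma cone_vn_mono z z' : translate Sa z' `<=` translate Sa z ->
  cone_complement_vn N Sa z `<=` cone_complement_vn N Sa z'.
Proof.
move=> h; rewrite !cone_vnE; apply: bicommutant_mono.
exact/local_operators_mono/causal_complement_mono.
Qed.

Lemma cone_vn_local O z T : double_cone O -> O `<=` causal_complement (translate Sa z) ->
  N O T -> cone_complement_vn N Sa z T.
Proof.
move=> dO OS NT; rewrite cone_vnE.
by apply: sub_bicommutant; [exact: local_operators_bounded | exists O].
Qed.

(** The cone complements are directed by this, which gives their union the structure of an
    algebra. *)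
Lemma common_translate y y' : exists z, translate Sa z `<=` translate Sa y /\
  translate Sa z `<=` translate Sa y'.
Proof.
have [s Ks_s] := cone_nonempty dSa.
have [T _ hT] := shifted_cone_sub dSa y Ks_s; have [T' _ hT'] := shifted_cone_sub dSa y' Ks_s.
exists (Num.max T T' *: s); split; first by apply: hT; rewrite le_max lexx.
by apply: hT'; rewrite le_max lexx orbT.
Qed.

Lemma double_cone_exists : exists O : set M3, double_cone O.
Proof.
have [s Ks_s] := cone_nonempty dSa.
pose v : M3 := delta_mx 0 (inord 0); exists [set x | future (x - 0) /\ future (v - x)].
exists 0, v; split=> //; rewrite subr0 /future /space_sq /time /v !mxE !eqxx /=.
have -> : (inord 1 == inord 0 :> 'I_3) = false by rewrite -val_eqE /= !inordK.
have -> : (inord 2 == inord 0 :> 'I_3) = false by rewrite -val_eqE /= !inordK.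
by rewrite expr0n /= addr0 expr1n; split; exact: ltr01.
Qed.

Lemma aux_cone_vn z T : cone_complement_vn N Sa z T -> aux_algebra N Sa T.
Proof.
by move=> h; apply: sub_norm_closure; [exact: cone_vn_bounded h | exists z].
Qed.

Lemma aux_cstar : cstar_algebra (aux_algebra N Sa).
Proof.
have up2 A B : (exists x, cone_complement_vn N Sa x A) -> (exists x, cone_complement_vn N Sa x B) ->
    exists x, cone_complement_vn N Sa x A /\ cone_complement_vn N Sa x B.
  move=> [x hA] [y hB]; have [z [zx zy]] := common_translate x y.
  by exists z; split; [exact: cone_vn_mono zx _ hA | exact: cone_vn_mono zy _ hB].
apply: cstar_norm_closure.
- move=> A [x hA]; have [bA hA'] := cstar_star (cone_vn_cstar x) hA.
  by split=> //; exists x.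
- by exists 0; exact: cstar_id (cone_vn_cstar 0).
- move=> A B hA hB; have [x [kA kB]] := up2 _ _ hA hB.
  by exists x; exact: (cstar_add (cone_vn_cstar x)).
- by move=> c A [x hA]; exists x; exact: (cstar_scale (cone_vn_cstar x)).
- move=> A B hA hB; have [x [kA kB]] := up2 _ _ hA hB.
  by exists x; exact: (cstar_comp (cone_vn_cstar x)).
Qed.

Lemma local_in_cone_vn O T : double_cone O -> N O T -> exists z, cone_complement_vn N Sa z T.
Proof.
move=> dO NT; have [s Ks_s] := cone_nonempty dSa.
have [t _ /(_ t (lexx t)) h] := shifted_cone_avoids dSa Ks_s dO.
by exists (t *: s); exact: cone_vn_local NT.
Qed.

Lemma quasilocal_aux : quasilocal N `<=` aux_algebra N Sa.
Proof.
apply: norm_closure_mono => A [] O [dO _] NA; exact: local_in_cone_vn NA.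
Qed.

End NetAlgebras.

(** * Norm limits of conjugations by unitaries *)

Section UniformLimits.
Variable R : realType.
Implicit Types H K : hilbertSpace R.

Lemma adj_conjugate H (U A : H -> H) : bounded_op U -> bounded_op A ->
  adj (adj U \o A \o U) = adj U \o adj A \o U.
Proof.
move=> bU bA; apply: is_adjoint_unique => x y /=.
by rewrite (adj_innerr _ _ bU) (adj_inner _ _ bA) (adj_inner _ _ bU).
Qed.

Lemma bounded_of_approx H K (S : H -> K) :
  (forall e : R, 0 < e -> exists2 B : H -> K, bounded_op B & forall x, hnorm (S x - B x) <= e * hnorm x) ->
  bounded_op S.
Proof.
move=> h; have [B bB hB] := h 1 ltr01; have [M M0 hM] := bounded_hnorm bB.
apply: (@hnorm_bounded _ _ _ _ (1 + M)).
  move=> c x y; apply/eqP; rewrite -subr_eq0; apply/eqP.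
  apply: (@hnorm_eps0 _ _ _ (hnorm (c *: x + y) + cnorm c * hnorm x + hnorm y)) => e /h[D bD hD].
  have -> : S (c *: x + y) - (c *: S x + S y) =
      (S (c *: x + y) - D (c *: x + y)) - (c *: (S x - D x) + (S y - D y)).
    rewrite (bounded_lin bD) -[RHS]addrA -opprD; congr (_ - _).
    by rewrite addrACA -scalerDr ![_ + (_ - _)]addrC !subrK.
  apply: le_trans (hnormB_le _ _) _; apply: le_trans (lerD (hD _) (hnormD _ _)) _.
  rewrite hnormZ; apply: le_trans (lerD (lexx _) (lerD (ler_wpM2l (cnorm_ge0 c) (hD x)) (hD y))) _.
  by rewrite le_eqVlt; apply/orP; left; apply/eqP; ring.
move=> x; have := hnormD (S x - B x) (B x); rewrite subrK => h1.
by apply: le_trans h1 _; rewrite mulrDl; exact: lerD.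
Qed.

(* The strong limit of the conjugations [adj (U n) \o T \o U n], which are eventually
   constant on each member of an increasing sequence of algebras. *)
Lemma conjugation_limit H (M : nat -> set (H -> H)) (U : nat -> H -> H) :
  (forall n, cstar_algebra (M n)) -> (forall m n, (m <= n)%N -> M m `<=` M n) ->
  (forall n, unitary_op (U n)) ->
  (forall m n T, (m <= n)%N -> M m T -> adj (U m) \o T \o U m = adj (U n) \o T \o U n) ->
  exists2 rho : (H -> H) -> (H -> H),
    representation (norm_closure [set T | exists n, M n T]) rho &
    forall n T, M n T -> rho T = adj (U n) \o T \o U n.
Proof.
move=> cM mM uU hU.
set Minf := [set T | exists n, M n T].
pose a n T : H -> H := adj (U n) \o T \o U n.
have bU n := unitary_bounded (uU n).
have ba n T : bounded_op T -> bounded_op (a n T).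
  by move=> bT; apply: bounded_comp => //; apply: bounded_comp => //; exact: bounded_adj.
have aB n T T' x : a n T x - a n T' x = adj (U n) (T (U n x) - T' (U n x)).
  by rewrite /a /= -linB //; exact/bounded_lin/bounded_adj.
have a_close n T T' (e : R) : (forall x, hnorm (T x - T' x) <= e * hnorm x) ->
    forall x, hnorm (a n T x - a n T' x) <= e * hnorm x.
  move=> h x; rewrite aB (isometric_hnorm _ (unitary_adj (uU n)).1).
  by apply: le_trans (h _) _; rewrite (isometric_hnorm _ (uU n).1).
(* Convergence in operator norm, to a map [S] not yet known to be linear. *)
pose ulim T S := forall e : R, 0 < e -> exists N : nat, forall n, (N <= n)%N ->
  forall x, hnorm (a n T x - S x) <= e * hnorm x.
have ulim_uniq T S S' : ulim T S -> ulim T S' -> S = S'.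
  move=> h h'; apply/funext => x; apply/eqP; rewrite -subr_eq0; apply/eqP.
  apply: (@hnorm_eps0 _ _ _ (2 * hnorm x)) => e e0.
  have [n1 h1] := h e e0; have [n2 h2] := h' e e0; pose n := maxn n1 n2.
  apply: le_trans (hnorm_tri (a n T x) _ _) _; rewrite hnormBC.
  have := h1 n (leq_maxl _ _) x; have := h2 n (leq_maxr _ _) x.
  by move: (hnorm _) (hnorm _) (hnorm x) => u v w; lra.
have ulim_bounded T S : bounded_op T -> ulim T S -> bounded_op S.
  move=> bT h; apply: bounded_of_approx => e /h[n /(_ n (leqnn n)) he'].
  by exists (a n T) => [|x]; [exact: ba | rewrite hnormBC].
have ulim_ex T : norm_closure Minf T -> exists S, ulim T S.
  move=> /norm_closureP[bT hT].
  have cauchy (e : R) : 0 < e -> exists N : nat, forall m n, (N <= m)%N -> (N <= n)%N ->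
      forall x, hnorm (a m T x - a n T x) <= e * hnorm x.
    move=> e0; have [T' [N MT'] hT'] := hT (e / 2) (divr_gt0 e0 (ltr0n _ 2)).
    exists N => m n Nm Nn x; apply: le_trans (hnorm_tri (a m T' x) _ _) _.
    rewrite [e in leRHS]splitr mulrDl; apply: lerD; first exact: a_close.
    rewrite [X in hnorm (X - _)](_ : _ = a n T' x); first by rewrite hnormBC; exact: a_close.
    by rewrite /a -(hU _ _ _ Nm MT') (hU _ _ _ Nn MT').
  have /boolp.choice[S hS] : forall x, exists l, seq_lim (fun n => a n T x) l.
    move=> x; apply: hnorm_complete => e e0.
    have x1 : 0 < hnorm x + 1 by rewrite ltr_wpDl ?hnorm_ge0.
    have [N hN] := cauchy (e / (hnorm x + 1)) (divr_gt0 e0 x1).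
    exists N => m n Nm Nn; apply: le_lt_trans (hN m n Nm Nn x) _.
    by rewrite mulrAC ltr_pdivrMr // ltr_pM2l // ltrDl.
  exists S => e e0; have [N hN] := cauchy e e0; exists N => n Nn x.
  rewrite -subr_le0; apply: (@le_eps0 _ _ 1) => d d0; rewrite mul1r lerBlDl.
  have [N' hN'] := hS x d d0; pose m := maxn N N'.
  apply: le_trans (hnorm_tri (a m T x) _ _) _; apply: lerD.
    by apply: hN => //; exact: leq_maxl.
  by apply/ltW/hN'; exact: leq_maxr.
have /boolp.choice[rho hrho] : forall T, exists S, norm_closure Minf T -> ulim T S.
  move=> T; have [/ulim_ex[S hS]|nT] := pselect (norm_closure Minf T); first by exists S.
  by exists idfun.
have cI : cstar_algebra (norm_closure Minf).
  have up2 A B : Minf A -> Minf B -> exists n, M n A /\ M n B.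
    move=> [n hA] [m hB]; exists (maxn n m).
    by split; [exact: (mM _ _ (leq_maxl n m)) | exact: (mM _ _ (leq_maxr n m))].
  apply: cstar_norm_closure.
  - by move=> A [n /(cstar_star (cM n))[bA hA]]; split=> //; exists n.
  - by exists 0%N; exact: cstar_id.
  - by move=> A B /up2 h /h[n [hA hB]]; exists n; exact: (cstar_add (cM n)).
  - by move=> c A [n hA]; exists n; exact: (cstar_scale (cM n)).
  - by move=> A B /up2 h /h[n [hA hB]]; exists n; exact: (cstar_comp (cM n)).
have rho_eq n T : M n T -> rho T = a n T.
  move=> MT; have cT : norm_closure Minf T.
    by apply: sub_norm_closure; [exact: (cstar_bounded (cM n)) | exists n].
  apply: (ulim_uniq T) (hrho T cT) _ => e e0; exists n => m nm x.
  by rewrite /a -(hU _ _ _ nm MT) subrr hnorm0 mulr_ge0 ?hnorm_ge0 // ltW.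
have bI T : norm_closure Minf T -> bounded_op T by exact: norm_closure_bounded.
have brho T : norm_closure Minf T -> bounded_op (rho T).
  by move=> cT; apply: ulim_bounded (hrho T cT); exact: bI.
exists rho => //; split.
- exact: brho.
- rewrite (rho_eq 0%N); last exact: cstar_id.
  by rewrite /a; exact: unitary_adjl.
- move=> A B cA cB; apply: (ulim_uniq (A + B)); first exact/hrho/(cstar_add cI).
  move=> e e0; have e2 : 0 < e / 2 by rewrite divr_gt0.
  have [n1 h1] := hrho A cA _ e2; have [n2 h2] := hrho B cB _ e2.
  exists (maxn n1 n2) => n; rewrite geq_max => /andP[/h1 k1 /h2 k2] x.
  have -> : a n (A + B) x = a n A x + a n B x.
    exact: (linD (A (U n x)) (B (U n x)) (bounded_lin (bounded_adj (bU n)))).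
  rewrite -[(rho A + rho B) x]/(rho A x + rho B x) opprD addrACA.
  by apply: le_trans (hnormD _ _) _; rewrite [e in leRHS]splitr mulrDl; exact: lerD.
- move=> c A cA; apply: (ulim_uniq (c *: A)); first exact/hrho/(cstar_scale cI).
  move=> e e0; have c1 : 0 < cnorm c + 1 by rewrite ltr_wpDl ?cnorm_ge0.
  have [n1 h1] := hrho A cA _ (divr_gt0 e0 c1).
  exists n1 => n /h1 k1 x.
  have -> : a n (c *: A) x = c *: a n A x.
    exact: (linZ c (A (U n x)) (bounded_lin (bounded_adj (bU n)))).
  rewrite -[(c *: rho A) x]/(c *: rho A x) -scalerBr hnormZ.
  apply: (@le_trans _ _ ((cnorm c + 1) * (e / (cnorm c + 1) * hnorm x))).
    by apply: ler_pM; rewrite ?cnorm_ge0 ?hnorm_ge0 // lerDl.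
  by rewrite mulrA [(cnorm c + 1) * _]mulrC divfK // gt_eqF.
- move=> A B cA cB; apply: (ulim_uniq (A \o B)); first exact/hrho/(cstar_comp cI).
  have [b b0 hb] := bounded_hnorm (brho B cB); have [c c0 hc] := bounded_hnorm (bI A cA).
  move=> e e0.
  have [n1 h1] := hrho A cA (e / 2 / b) (divr_gt0 (divr_gt0 e0 (ltr0n _ 2)) b0).
  have [n2 h2] := hrho B cB (e / 2 / c) (divr_gt0 (divr_gt0 e0 (ltr0n _ 2)) c0).
  exists (maxn n1 n2) => n; rewrite geq_max => /andP[/h1 k1 /h2 k2] x.
  have -> : a n (A \o B) x = a n A (a n B x).
    by rewrite /a /= -[U n (adj (U n) _)]/((U n \o adj (U n)) _) unitary_adjr.
  rewrite /=; apply: le_trans (hnorm_tri (a n A (rho B x)) _ _) _.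
  rewrite [e in leRHS]splitr mulrDl; apply: lerD.
    rewrite -(linB _ _ (bounded_lin (ba n A (bI A cA)))).
    have hca y : hnorm (a n A y) <= c * hnorm y.
      rewrite /a /= (isometric_hnorm _ (unitary_adj (uU n)).1).
      by apply: le_trans (hc _) _; rewrite (isometric_hnorm _ (uU n).1).
    apply: le_trans (hca _) _; apply: le_trans (ler_wpM2l (ltW c0) (k2 x)) _.
    by rewrite mulrA [c * _]mulrC divfK // gt_eqF.
  apply: le_trans (k1 _) _; apply: (@le_trans _ _ (e / 2 / b * (b * hnorm x))).
    by apply: ler_wpM2l => //; rewrite divr_ge0 ?ltW // divr_gt0.
  by rewrite mulrA divfK // gt_eqF.
- move=> A cA; have [bA cA'] := cstar_star cI cA.
  apply: (ulim_uniq (adj A)); first exact: hrho.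
  move=> e e0; have [n1 h1] := hrho A cA e e0; exists n1 => n /h1 k1 x.
  have b1 := ba n A bA; have b2 := brho A cA.
  have -> : a n (adj A) = adj (a n A).
    by rewrite /a (adj_conjugate (bU n) bA).
  have -> : adj (a n A) x - adj (rho A) x = adj (a n A - rho A) x.
    apply: inner_extr => z; rewrite innerBr -!adj_inner //; last exact: bounded_sub.
    by rewrite -innerBl.
  by apply: adj_bound => //; [exact: bounded_sub | exact: ltW].
Qed.

End UniformLimits.

(** * Extension of charges to the field net *)

Section RelationUnitary.
Variable R : realType.

Lemma inner_sumr (H : hilbertSpace R) I (r : seq I) (F : I -> H) (x : H) :
  inner H x (\sum_(i <- r) F i) = \sum_(i <- r) inner H x (F i).
Proof.
elim: r => [|i r IH]; first by rewrite !big_nil inner0r.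
by rewrite !big_cons innerDr IH.
Qed.

(** Equality of the Gram matrices makes the relation and its inverse isometric, so both extend to
    bounded operators, and these are inverse to each other on dense sets. *)
Lemma unitary_extension (H K : hilbertSpace R) (G : H -> K -> Prop) :
  (forall c x y x' y', G x y -> G x' y' -> G (c *: x + x') (c *: y + y')) ->
  (forall x y x' y', G x y -> G x' y' -> inner H x x' = inner K y y') ->
  dense_in [set x | exists y, G x y] -> dense_in [set y | exists x, G x y] ->
  exists2 U : H -> K, unitary_op U & forall x y, G x y -> U x = y.
Proof.
move=> GL GI dG rG.
have Gn x y : G x y -> hnorm x = hnorm y.
  by move=> g; apply/eqP; rewrite -(@eqrXn2 _ 2) ?hnorm_ge0 // !hnorm_sq (GI _ _ _ _ g g).
have [||||U bU hU] := @dense_extension R H K G 1 => //.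
  by move=> x y /Gn ->; rewrite mul1r.
have [||||U' bU' hU'] := @dense_extension R K H (fun y x => G x y) 1 => //.
- by move=> c y x y' x'; exact: GL.
- by move=> y x /Gn ->; rewrite mul1r.
have UU' : U \o U' = idfun.
  apply: (dense_bounded_eq _ _ rG); [exact: bounded_comp | exact: bounded_id|].
  by move=> y [x g] /=; rewrite (hU' _ _ g) (hU _ _ g).
have adU : adj U \o U = idfun.
  apply: (dense_bounded_eq _ _ dG).
  - by apply: bounded_comp => //; exact: bounded_adj.
  - exact: bounded_id.
  move=> x [y g] /=; apply: (dense_eq dG) => x' [y' g'].
  by rewrite adj_innerr // (hU _ _ g) (hU _ _ g') (GI _ _ _ _ g g').
have U'E : adj U = U'.
  by rewrite -[adj U]/(adj U \o idfun) -UU' -[LHS]/((adj U \o U) \o U') adU.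
by exists U => //; apply: unitary_intro => //; rewrite U'E.
Qed.

Lemma weakly_continuous_sub (H K : hilbertSpace R) (M M' : set (H -> H)) (rho : (H -> H) -> (K -> K)) :
  M' `<=` M -> weakly_continuous_on M rho -> weakly_continuous_on M' rho.
Proof.
move=> MM h F B PF FM MB; apply: h; last exact: MM; exact: filterS FM.
Qed.

End RelationUnitary.

(** * Observables inside the field net, and means over the gauge group *)

Section FieldNet.
Variables (R : realType) (H0 H : hilbertSpace R) (A : local_net H0)
  (J : H0 -> H) (pi : (H0 -> H0) -> (H -> H)) (G : set (H -> H)) (F : local_net H)
  (Sa : set (spacetime R)) (piSa : (H0 -> H0) -> (H -> H)).
Local Notation M3 := (spacetime R).
Hypothesis A_vn : forall O, double_cone O -> von_neumann_algebra (A O).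
Hypothesis A_isotony : isotonous A.
Hypothesis A_duality : haag_duality A.
Hypothesis hF : complete_normal_field_net A J pi G F.
Hypothesis hpi : aux_extension A Sa pi piSa.
Variables (xs : M3) (Ks : set M3).
Hypothesis dSa : cone_directions Sa xs Ks.

Let F_vn := fld_vn hF.
Let F_isotony := fld_isotony hF.
Let iJ := fld_incl hF.
Let bJ := isometric_bounded iJ.
Let JJ : adj J \o J = idfun := adj_isometric iJ.
Let prep := aux_rep hpi.

Let A_aux O B : double_cone O -> A O B -> aux_algebra A Sa B.
Proof.
by move=> dO AB; have [z /(aux_cone_vn A_vn)] := local_in_cone_vn A_vn dSa dO AB.
Qed.

Lemma piSa_pi O B : double_cone O -> A O B -> piSa B = pi B.
Proof. by move=> dO AB; apply: (aux_extends hpi); exact: local_quasilocal AB. Qed.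

Lemma pi_local O B : double_cone O -> A O B -> F O (pi B).
Proof.
move=> dO AB; have : (pi @` A O) (pi B) by exists B.
by rewrite -(fld_fixed_points hF dO) => -[].
Qed.

Lemma pi_bounded O B : double_cone O -> A O B -> bounded_op (pi B).
Proof. by move=> dO /(pi_local dO); exact: local_bounded. Qed.

Lemma pi_invariant O B g : double_cone O -> A O B -> G g -> g \o pi B = pi B \o g.
Proof.
move=> dO AB Gg; have : (pi @` A O) (pi B) by exists B.
rewrite -(fld_fixed_points hF dO) => -[_ /(_ g Gg) h].
rewrite -[in RHS]h /Ad -[RHS]/(g \o pi B \o (adj g \o g)).
by rewrite (unitary_adjl (fld_unitary hF Gg)).
Qed.

Lemma pi_J O B : double_cone O -> A O B -> pi B \o J = J \o B.
Proof. by move=> dO AB; apply: (fld_vacuum hF); exact: local_quasilocal AB. Qed.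

Lemma adjJ_pi O B : double_cone O -> A O B -> adj J \o pi B = B \o adj J.
Proof.
move=> dO AB; have [bB AB'] := local_star A_vn dO AB.
have bp := pi_bounded dO AB.
apply/funext => x; apply: inner_ext => y /=.
rewrite (adj_innerr _ _ bJ) (adj_inner _ _ bp).
rewrite -(rep_adj (fld_rep hF)); last exact: local_quasilocal AB.
have /(congr1 (@^~ y)) /= -> := pi_J dO AB'.
by rewrite -(adj_innerr _ _ bJ) -(adj_innerr _ _ (bounded_adj bB)) adjK.
Qed.

(** By locality [T] commutes with [pi B] for [B] spacelike to [O], and [J] intertwines [pi B] with
    [B]; so the compression commutes with the observables of the causal complement, and duality
    places it in [A O]. *)
Lemma compression_local O T : double_cone O -> F O T -> A O (adj J \o T \o J).
Proof.
move=> dO FT; have bT := local_bounded F_vn dO FT.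
rewrite -(region_double_cone A_vn A_isotony dO) -bicommutant_region //.
rewrite -(A_duality (or_introl dO)) commutant_region //.
split; first by apply: bounded_comp => //; apply: bounded_comp => //; exact: bounded_adj.
move=> B [] Q [dQ QO] AB.
have com : pi B \o T = T \o pi B by apply: (fld_locality hF dQ dO QO) => //; exact: pi_local.
rewrite -[LHS]/((B \o adj J) \o T \o J) -(adjJ_pi dQ AB).
rewrite -[LHS]/(adj J \o (pi B \o T) \o J) com.
by rewrite -[LHS]/(adj J \o T \o (pi B \o J)) (pi_J dQ AB).
Qed.

Lemma cyclic_dense O : double_cone O -> dense_in [set xi : H | exists (n : nat)
  (T : 'I_n -> H -> H) (v : 'I_n -> H0), (forall k, F O (T k)) /\ xi = \sum_(k < n) T k (J (v k))].
Proof. by move=> dO; apply/dense_inP; exact: (fld_cyclic hF dO). Qed.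

Lemma cyclic_vector O (x y : H) : double_cone O ->
  (forall T v, F O T -> inner H x (T (J v)) = inner H y (T (J v))) -> x = y.
Proof.
move=> dO h; apply: (dense_eq (cyclic_dense dO)) => _ [n [T [v [FT ->]]]].
by rewrite !inner_sumr; apply: eq_bigr => k _; exact: h.
Qed.

Lemma cyclic_operator O (K : hilbertSpace R) (P Q : H -> K) : double_cone O -> bounded_op P -> bounded_op Q ->
  (forall T v, F O T -> P (T (J v)) = Q (T (J v))) -> P = Q.
Proof.
move=> dO bP bQ h; apply: (dense_bounded_eq bP bQ (cyclic_dense dO)) => _ [n [T [v [FT ->]]]].
rewrite (lin_sum _ _ (bounded_lin bP)) (lin_sum _ _ (bounded_lin bQ)).
by apply: eq_bigr => k _; exact: h.
Qed.

Lemma star_algebra_aux z B :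
  star_algebra (local_operators A (causal_complement (translate Sa z))) B -> aux_algebra A Sa B.
Proof.
move=> h; apply: (aux_cone_vn A_vn (z := z)); rewrite cone_vnE //.
by apply: star_algebra_bicommutant h; exact: local_operators_bounded.
Qed.

(** Commutation is checked on words in local observables of [D] and passes to the weak closure after
    [S] has been moved across the inner product. The region [D] is kept apart from the complement of
    [Sa + z], as a transporter must be located more precisely. *)
Lemma piSa_commute (D : set M3) z (X : H0 -> H0) (S : H -> H) :
  D `<=` causal_complement (translate Sa z) -> bicommutant (local_operators A D) X ->
  bounded_op S ->
  (forall O B, double_cone O -> O `<=` D -> A O B -> S \o pi B = pi B \o S) ->
  S \o piSa X = piSa X \o S.
Proof.
move=> Dz cX bS h.
have sD := local_operators_star A_vn (S := D).
have Dsub : bicommutant (local_operators A D) `<=` cone_complement_vn A Sa z.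
  by rewrite cone_vnE //; apply: bicommutant_mono; exact: local_operators_mono.
have Daux B : bicommutant (local_operators A D) B -> aux_algebra A Sa B.
  by move=> /Dsub; exact: aux_cone_vn.
have gaux B : star_algebra (local_operators A D) B -> aux_algebra A Sa B.
  by move=> /(star_algebra_bicommutant (star_bounded sD)) /Daux.
have wc : weakly_continuous_on (bicommutant (local_operators A D)) piSa.
  exact: (@weakly_continuous_sub _ _ _ _ _ _ Dsub (@aux_weak _ _ _ _ _ _ _ hpi z)).
have key B : star_algebra (local_operators A D) B -> S \o piSa B = piSa B \o S.
  elim=> {B} [B [] O [dO OD] AB||B C gB hB gC hC|c B gB hB|B C gB hB gC hC].
  - by rewrite (piSa_pi dO AB); exact: h AB.
  - by rewrite (rep_unital prep).
  - rewrite (rep_add prep (gaux _ gB) (gaux _ gC)) comp_lin_add ?hB ?hC //.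
    exact: bounded_lin.
  - rewrite (rep_scale prep _ (gaux _ gB)) comp_lin_scale ?hB //; exact: bounded_lin.
  - rewrite (rep_mul prep (gaux _ gB) (gaux _ gC)).
    by rewrite -[LHS]/((S \o piSa B) \o piSa C) hB -[LHS]/(piSa B \o (S \o piSa C)) hC.
apply/funext => x; apply: inner_ext => y /=.
rewrite (adj_inner _ _ bS).
apply: (weak_eq sD wc wc) => // B /key /(congr1 (@^~ x)) /= e.
by rewrite -(adj_inner _ _ bS) e.
Qed.

Lemma piSa_J z X : cone_complement_vn A Sa z X -> piSa X \o J = J \o X.
Proof.
rewrite cone_vnE // => cX; set D := causal_complement _ in cX.
have sD := local_operators_star A_vn (S := D).
have wc : weakly_continuous_on (bicommutant (local_operators A D)) piSa.
  by rewrite /D -(cone_vnE A_vn); exact: (@aux_weak _ _ _ _ _ _ _ hpi z).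
have key B : star_algebra (local_operators A D) B -> piSa B \o J = J \o B.
  elim=> {B} [B [] O [dO OD] AB||B C gB hB gC hC|c B gB hB|B C gB hB gC hC].
  - by rewrite (piSa_pi dO AB); exact: pi_J AB.
  - by rewrite (rep_unital prep).
  - rewrite (rep_add prep (star_algebra_aux gB) (star_algebra_aux gC)).
    rewrite (comp_lin_add _ _ (bounded_lin bJ)) -hB -hC //.
  - rewrite (rep_scale prep _ (star_algebra_aux gB)) (comp_lin_scale _ _ (bounded_lin bJ)) -hB //.
  - rewrite (rep_mul prep (star_algebra_aux gB) (star_algebra_aux gC)).
    by rewrite -[LHS]/(piSa B \o (piSa C \o J)) hC -[LHS]/((piSa B \o J) \o C) hB.
apply/funext => v; apply: inner_ext => y /=.
rewrite (adj_inner _ _ bJ).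
apply: (weak_eq sD wc (@weakly_continuous_id _ _ _)) => // B /key /(congr1 (@^~ v)) /= ->.
by rewrite (adj_inner _ _ bJ).
Qed.

Lemma piSa_bounded X : aux_algebra A Sa X -> bounded_op (piSa X).
Proof. exact: (rep_bounded prep). Qed.

Lemma piSa_unitary X : aux_algebra A Sa X -> unitary_op X -> unitary_op (piSa X).
Proof.
move=> aX uX; have [bX aX'] := cstar_star (aux_cstar A_vn dSa) aX.
apply: unitary_intro; first exact: piSa_bounded.
  by rewrite -(rep_adj prep aX) -(rep_mul prep aX' aX) unitary_adjl ?(rep_unital prep).
by rewrite -(rep_adj prep aX) -(rep_mul prep aX aX') unitary_adjr ?(rep_unital prep).
Qed.

Lemma piSa_invariant z X g : cone_complement_vn A Sa z X -> G g -> g \o piSa X = piSa X \o g.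
Proof.
rewrite cone_vnE // => cX Gg; apply: (piSa_commute (z := z)) cX _ _ => //.
  exact/unitary_bounded/(fld_unitary hF).
by move=> O B dO _ AB; exact: pi_invariant AB Gg.
Qed.

Lemma piSa_cone_vn z X : cone_complement_vn A Sa z X -> cone_complement_vn F Sa z (piSa X).
Proof.
move=> cX; rewrite cone_vnE //; split.
  by apply: piSa_bounded; exact: aux_cone_vn cX.
move=> S [bS hS]; rewrite cone_vnE // in cX; apply: (piSa_commute (z := z)) cX bS _ => //.
by move=> O B dO OD AB; symmetry; apply: hS; exists O => //; exact: pi_local.
Qed.

Lemma piSa_local_commute (D : set M3) z X O T :
  D `<=` causal_complement (translate Sa z) -> bicommutant (local_operators A D) X ->
  double_cone O -> O `<=` causal_complement D -> F O T -> T \o piSa X = piSa X \o T.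
Proof.
move=> Dz cX dO OD FT; apply: (piSa_commute Dz cX); first exact: local_bounded FT.
move=> Q B dQ QD AB; apply: (fld_locality hF dO dQ) => //; last exact: pi_local.
by move=> x /OD hx y /QD; exact: hx.
Qed.

(** Membership in [bicommutant S'] is commutation with every [T] in the commutant of [S'], an
    identity between weakly continuous matrix elements. *)
Lemma weak_preserves (L : hilbertSpace R) (S S' M : set (L -> L)) rho :
  star_closed S -> star_closed S' -> representation M rho -> cstar_algebra M ->
  bicommutant S `<=` M -> weakly_continuous_on (bicommutant S) rho ->
  (forall B, S B -> bicommutant S' (rho B)) -> forall X, bicommutant S X -> bicommutant S' (rho X).
Proof.
move=> sS sS' rr cM SM wc h X cX.
have gM B : star_algebra S B -> M B.
  by move=> /(star_algebra_bicommutant (star_bounded sS)) /SM.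
have cS' := cstar_bicommutant sS'.
have key B : star_algebra S B -> bicommutant S' (rho B).
  elim=> {B} [B SB||B D gB hB gD hD|c B gB hB|B D gB hB gD hD].
  - exact: h.
  - by rewrite (rep_unital rr); exact: cstar_id.
  - by rewrite (rep_add rr (gM _ gB) (gM _ gD)); exact: (cstar_add cS').
  - by rewrite (rep_scale rr _ (gM _ gB)); exact: (cstar_scale cS').
  - by rewrite (rep_mul rr (gM _ gB) (gM _ gD)); exact: (cstar_comp cS').
split; first by apply: (rep_bounded rr); exact: SM.
move=> T [bT hT]; apply/funext => x; apply: inner_ext => y /=.
rewrite (adj_inner _ _ bT).
apply: (weak_eq sS wc wc) cX => B /key [_ hB].
have /(congr1 (@^~ x)) /= <- := hB T (conj bT hT).
by rewrite (adj_inner _ _ bT).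
Qed.

(** What [transport] asks of a map on [F O]. It holds for the identity, for conjugations by
    unitaries and for the restriction of any representation. *)
Definition local_hom O (rho : (H -> H) -> (H -> H)) := forall S T, F O S -> F O T ->
  [/\ bounded_op (rho T), rho (S \o T) = rho S \o rho T & rho (adj T) = adj (rho T)].

Lemma local_hom_id O : double_cone O -> local_hom O id.
Proof. by move=> dO S T _ FT; split=> //; exact: local_bounded FT. Qed.

Lemma local_hom_conjugate O U : double_cone O -> unitary_op U ->
  local_hom O (fun T => adj U \o T \o U).
Proof.
move=> dO uU S T FS FT; have bU := unitary_bounded uU.
have bT := local_bounded F_vn dO FT; split.
- by apply: bounded_comp => //; apply: bounded_comp => //; exact: bounded_adj.
- by rewrite -[RHS]/(adj U \o S \o (U \o adj U) \o T \o U) unitary_adjr.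
- by rewrite adj_conjugate.
Qed.

(* Both sides agree on [J H0] and on F(O); since F(O) J H0 is dense, matrix elements of
   an element of F(O') between such vectors are determined by its compression to H0. *)
Lemma transport O Q (rho sigma : (H -> H) -> (H -> H)) (U : H -> H) (X : H0 -> H0) :
  double_cone O -> double_cone Q -> O `<=` Q -> local_hom Q rho -> local_hom Q sigma ->
  bounded_op U -> bounded_op X -> U \o J = J \o X -> adj U \o J = J \o adj X ->
  (forall S, F O S -> U \o rho S = sigma S \o U) ->
  (forall T, F Q T -> adj J \o sigma T \o J \o X = X \o (adj J \o rho T \o J)) ->
  (forall x y, (forall S w, F O S -> inner H x (sigma S (J w)) = inner H y (sigma S (J w))) -> x = y) ->
  (forall P P' : H -> H, bounded_op P -> bounded_op P' ->
     (forall T v, F Q T -> P (rho T (J v)) = P' (rho T (J v))) -> P = P') ->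
  forall T, F Q T -> U \o rho T = sigma T \o U.
Proof.
move=> dO dQ OQ hr hs bU bX UJ UJ' hO hQ dens dens' T FT.
have FOQ S : F O S -> F Q S by exact: F_isotony.
have step T' v : F Q T' -> U (rho T' (J v)) = sigma T' (J (X v)).
  move=> FT'; apply: dens => S w FS; have FS' := FOQ _ FS.
  have [bS FSa] := local_star F_vn dO FS; have FSa' := FOQ _ FSa.
  have [brS _ _] := hr _ _ FS' FS'; have [bsS _ _] := hs _ _ FS' FS'.
  have [brT mr _] := hr _ _ FSa' FT'; have [bsT ms _] := hs _ _ FSa' FT'.
  have [_ _ ar] := hr _ _ FS' FS'; have [_ _ as'] := hs _ _ FS' FS'.
  have US : adj U \o sigma S = rho S \o adj U.
    have [bra _ _] := hr _ _ FSa' FSa'; have [bsa _ _] := hs _ _ FSa' FSa'.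
    have e := congr1 (@adj R H H) (hO _ FSa).
    by rewrite (adj_comp bU bra) (adj_comp bsa bU) ar as' (adjK brS) (adjK bsS) in e.
  rewrite (adj_inner _ _ bU).
  have /(congr1 (@^~ (J w))) /= -> := US.
  have /(congr1 (@^~ w)) /= -> := UJ'.
  (* The matrix element of [T'] against [S] is one of [adj S \o T'] between vectors of the image of
     [J], and there [hQ] applies. *)
  have /= e1 := congr1 (@^~ v) (hQ (adj S \o T') (cstar_comp (local_cstar F_vn dQ) FSa' FT')).
  rewrite mr ms ar as' /= in e1.
  rewrite -[LHS](adj_innerr _ _ brS) -[RHS](adj_innerr _ _ bsS).
  rewrite -[LHS](adj_innerr _ _ bJ) -(adj_innerr _ _ (bounded_adj bX)) adjK //.
  by rewrite -e1 (adj_innerr _ _ bJ).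
apply: dens'.
- by apply: bounded_comp => //; have [] := hr _ _ FT FT.
- by apply: bounded_comp => //; have [] := hs _ _ FT FT.
move=> T' v FT' /=.
have [_ mr _] := hr _ _ FT FT'; have [_ ms _] := hs _ _ FT FT'.
have FTT := cstar_comp (local_cstar F_vn dQ) FT FT'.
rewrite -[rho T _]/((rho T \o rho T') (J v)) -mr step // ms /=.
by rewrite step.
Qed.

(** A translate of [Sa] far along itself is spacelike to [Q], and like every spacelike cone it
    contains a translate of any given double cone. *)
Lemma spacelike_double_cone Q : double_cone Q ->
  exists2 O : set M3, double_cone O & O `<=` causal_complement Q.
Proof.
move=> dQ; have [s Ks_s] := cone_nonempty dSa.
have [t _ /(_ t (lexx t)) h] := shifted_cone_avoids dSa Ks_s dQ.
case: (double_cone_exists dSa) => O1 dO1.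
have [r _ /(_ r (lexx r)) h'] := shift_into_cone (cone_translate dSa (t *: s)) Ks_s dO1.
exists (translate O1 (r *: s)); first exact: double_cone_translate.
by move=> x /h'; move: x; exact: causal_complement_sym h.
Qed.

Lemma Ad_local g O T : G g -> double_cone O -> F O T -> F O (Ad g T).
Proof. by move=> Gg dO FT; rewrite -(fld_action hF Gg dO); exists T. Qed.

Lemma averages_local O T B : double_cone O -> F O T -> averages G T B -> F O B.
Proof.
move=> dO FT; elim=> {B} [g Gg|B D _ FB _ FD]; first exact: Ad_local.
by apply: (cstar_scale (local_cstar F_vn dO)); exact: (cstar_add (local_cstar F_vn dO)).
Qed.

(** The averages converge because the fields of a double cone spacelike to [O] commute with all of
    them and are cyclic. The limit commutes with the commutant of [F O] and is fixed by [G], so it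
    comes from an observable. Matrix elements that averaging leaves unchanged survive in the limit,
    and this is how the mean is used later. *)
Lemma invariant_mean O T : double_cone O -> F O T -> exists2 B, A O B &
  forall x y, (forall D, averages G T D -> inner H (D x) y = inner H (T x) y) ->
    inner H (pi B x) y = inner H (T x) y.
Proof.
move=> dO FT; have [Gid Gcomp Gadj] := fld_group hF.
have bT := local_bounded F_vn dO FT; have uG := fld_unitary hF.
have [Q dQ QO] := spacelike_double_cone dO.
have [||E bE hE] := @average_operator R H G uG Gid Gcomp Gadj (F Q) T bT.
- move=> B FB; split; first exact: local_bounded FB.
  by move=> g Gg; apply: (fld_locality hF dQ dO QO) => //; exact: Ad_local.
- move=> x e e0; have [_ [n [S [v [FS ->]]]] h] := cyclic_dense dQ x e0.
  exists (\sum_(k < n) S k (J (v k))) => //; exists n, S, (fun k => J (v k)); split=> // k.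
  split=> // g Gg; have /(congr1 (@^~ (v k))) /= := fld_fixes hF Gg.
  exact.
(* The second averaging starts from the result of the first, which preserves the approximation at
   [x]; two vectors are thus controlled at once. *)
have near x y (e : R) : 0 < e -> exists B, [/\ averages G T B, hnorm (B x - E x) < e,
    hnorm (B y - E y) < e & forall D, averages G B D -> hnorm (D x - E x) < e /\ hnorm (D y - E y) < e].
  move=> e0; have [B aB hB] := hE x T e (averages_refl Gid T) e0.
  have [D aD hD] := hE y B e aB e0; exists D.
  have aTD := averages_trans uG Gcomp aB aD; have rD := averages_refl Gid D.
  split; [by []|exact: hB|exact: hD|].
  move=> D' aD'; split; last exact: hD.
  by apply: hB; exact: (averages_trans uG Gcomp aD aD').
have FE : F O E.
  rewrite -(F_vn dO).2; split=> // S [bS hS].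
  have [M M0 hM] := bounded_hnorm bS.
  apply/funext => x /=; apply/eqP; rewrite -subr_eq0; apply/eqP.
  apply: (@hnorm_eps0 _ _ _ (M + 1)) => e e0.
  have [B [aB hBx hBy _]] := near x (S x) e e0.
  have /(congr1 (@^~ x)) /= eB := hS B (averages_local dO FT aB).
  apply: le_trans (hnorm_tri (S (B x)) _ _) _; rewrite mulrDl mul1r; apply: lerD.
    rewrite -(linB _ _ (bounded_lin bS)); apply: le_trans (hM _) _.
    by rewrite ler_wpM2l ?(ltW M0) // hnormBC ltW.
  by rewrite -eB ltW.
have GE g : G g -> Ad g E = E.
  move=> Gg; have ug := uG _ Gg; have bg := unitary_bounded ug.
  apply/funext => x /=; apply/eqP; rewrite -subr_eq0; apply/eqP.
  apply: (@hnorm_eps0 _ _ _ 2) => e e0.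
  have [B [aB _ hBy hB]] := near x (adj g x) e e0.
  have [h1 _] := hB _ (averages_Ad uG Gcomp (averages_refl Gid B) Gg).
  apply: le_trans (hnorm_tri (Ad g B x) _ _) _; rewrite mulr_natl mulr2n; apply: lerD; last exact: ltW.
  by rewrite /Ad /= -(linB _ _ (bounded_lin bg)) (isometric_hnorm _ ug.1) hnormBC ltW.
have : (pi @` A O) E by rewrite -(fld_fixed_points hF dO); split.
case=> B AB eB; exists B => // x y hxy; rewrite eB.
apply/eqP; rewrite -subr_eq0; apply/eqP/cnorm_eq0/eqP; rewrite eq_le cnorm_ge0 andbT.
apply: (@le_eps0 _ _ (hnorm y)) => e e0.
have [D [aD hD _ _]] := near x x e e0.
rewrite -(hxy D aD) -innerBl; apply: le_trans (cauchy_schwarz _ _) _.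
by rewrite mulrC ler_wpM2l ?hnorm_ge0 // hnormBC ltW.
Qed.

(** * The extension of one localised charge *)

Section LocalExtension.
Variables (C : set M3) (xc : M3) (K : set M3) (a x0 : M3).
Variables (eta : (H0 -> H0) -> (H0 -> H0)) (V : R -> H0 -> H0).
Hypothesis C_cone : spacelike_cone C.
Hypothesis dC : cone_directions C xc K.
Hypothesis Ka : K a.
Hypothesis C_Sa : C `<=` causal_complement (translate Sa x0).
Hypothesis eta_loc : localised A C eta.
Hypothesis V_unitary : forall t, unitary_op (V t).
Hypothesis V_eta : forall t B,
  region_algebra A (causal_complement (translate C (t *: a))) B -> V t \o eta B = B \o V t.

Local Notation Cn t := (translate C (t *: a)).
Local Notation Cn' t := (causal_complement (translate C (t *: a))).

Definition charge_shift t := piSa (V t).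
Local Notation W := charge_shift.
Definition local_extension_at t (T : H -> H) := adj (W t) \o T \o W t.
Local Notation etaloc := local_extension_at.

Lemma shifted_antitone s t : s <= t -> Cn t `<=` Cn s.
Proof. exact: (cone_shift_antitone dC Ka). Qed.

Lemma shifted_complement_monotone s t : s <= t -> Cn' s `<=` Cn' t.
Proof. by move=> /shifted_antitone; exact: causal_complement_mono. Qed.

Lemma shifted_sub t : 0 <= t -> Cn t `<=` C.
Proof. exact: (cone_shift_sub dC Ka). Qed.

Lemma exists_shift O : double_cone O -> exists2 t, 0 <= t & O `<=` Cn' t.
Proof.
by move=> /(shifted_cone_avoids dC Ka)[t t0 /(_ t (lexx t)) h]; exists t.
Qed.

(** As [t >= 0] puts the translate inside [C], the intertwining relation holds on the observables of
    the complement of [C], where [eta] is the identity; so [V t] commutes with them. *)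
Lemma V_local t : 0 <= t -> bicommutant (local_operators A C) (V t).
Proof.
move=> t0; rewrite -bicommutant_region // -(A_duality (or_intror C_cone)) commutant_region //.
split; first exact: unitary_bounded.
move=> B [] O [dO OC] AB.
have <- : V t \o eta B = B \o V t.
  apply: V_eta; apply: (local_in_region A_vn dO) AB => x /OC.
  exact/causal_complement_mono/shifted_sub.
by congr (_ \o _); apply: eta_loc; exact: local_in_region AB.
Qed.

Lemma V_cone_vn t : 0 <= t -> cone_complement_vn A Sa x0 (V t).
Proof.
move=> t0; rewrite cone_vnE //; apply: bicommutant_mono (V_local t0).
exact: local_operators_mono.
Qed.

Let V_aux t : 0 <= t -> aux_algebra A Sa (V t).
Proof. by move=> /V_cone_vn; exact: aux_cone_vn. Qed.

Lemma shift_unitary t : 0 <= t -> unitary_op (W t).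
Proof. by move=> t0; apply: piSa_unitary; [exact: V_aux | exact: V_unitary]. Qed.

Lemma shift_J t : 0 <= t -> W t \o J = J \o V t.
Proof. by move=> /V_cone_vn; exact: piSa_J. Qed.

Lemma shift_local_commute t O T : 0 <= t -> double_cone O -> O `<=` causal_complement C ->
  F O T -> T \o W t = W t \o T.
Proof. by move=> t0 dO OC FT; exact: (piSa_local_commute C_Sa (V_local t0) dO). Qed.

Lemma shift_invariant t g : 0 <= t -> G g -> g \o W t = W t \o g.
Proof. by move=> /V_cone_vn; exact: piSa_invariant. Qed.

Lemma shift_cone_vn t : 0 <= t -> cone_complement_vn F Sa x0 (W t).
Proof. by move=> /V_cone_vn; exact: piSa_cone_vn. Qed.

Lemma eta_conjugate t O B : double_cone O -> O `<=` Cn' t -> A O B -> eta B = adj (V t) \o B \o V t.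
Proof.
move=> dO OC AB; rewrite -[RHS]/(adj (V t) \o (B \o V t)) -V_eta; last exact: local_in_region AB.
by rewrite -[RHS]/((adj (V t) \o V t) \o eta B) unitary_adjl.
Qed.

Lemma etaloc_consistent s t O T : 0 <= s -> s <= t -> double_cone O -> O `<=` Cn' s -> F O T ->
  etaloc s T = etaloc t T.
Proof.
move=> s0 st dO OC FT; have t0 := le_trans s0 st.
have uWs := shift_unitary s0; have uWt := shift_unitary t0.
pose X := V t \o adj (V s).
have cX : bicommutant (local_operators A (Cn s)) X.
  rewrite -bicommutant_region // -(A_duality (or_intror (spacelike_cone_translate _ C_cone))).
  rewrite commutant_region //; split.
    by apply: bounded_comp; [|apply: bounded_adj]; exact: unitary_bounded.
  move=> B [] Q [dQ QC] AB.
  have QC' : Q `<=` Cn' t by move=> y /QC; exact: shifted_complement_monotone.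
  rewrite -[LHS]/((B \o V t) \o adj (V s)) -V_eta; last exact: local_in_region AB.
  rewrite (eta_conjugate dQ QC AB).
  rewrite -[LHS]/(V t \o (adj (V s) \o B) \o (V s \o adj (V s))).
  by rewrite unitary_adjr.
have eX : piSa X = W t \o adj (W s).
  have [_ aV] := cstar_star (aux_cstar A_vn dSa) (V_aux s0).
  by rewrite (rep_mul prep (V_aux t0) aV) (rep_adj prep (V_aux s0)).
have Ds : Cn s `<=` causal_complement (translate Sa x0).
  by move=> y /(shifted_sub s0) /C_Sa.
have := piSa_local_commute Ds cX dO OC FT; rewrite eX => e.
rewrite /etaloc -[LHS]/(idfun \o (adj (W s) \o T \o W s)) -(unitary_adjl uWt).
rewrite -[LHS]/(adj (W t) \o ((W t \o adj (W s)) \o T) \o W s) -e.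
by rewrite -[LHS]/(adj (W t) \o T \o W t \o (adj (W s) \o W s)) unitary_adjl.
Qed.

Lemma etaloc_indep s t O T : 0 <= s -> 0 <= t -> double_cone O -> O `<=` Cn' s -> O `<=` Cn' t ->
  F O T -> etaloc s T = etaloc t T.
Proof.
move=> s0 t0 dO Os Ot FT; have [st|/ltW ts] := leP s t.
  exact: etaloc_consistent FT.
by symmetry; exact: etaloc_consistent FT.
Qed.

Lemma etaloc_pi t O B : 0 <= t -> double_cone O -> O `<=` Cn' t -> A O B ->
  etaloc t (pi B) = piSa (eta B).
Proof.
move=> t0 dO OC AB; rewrite (eta_conjugate dO OC AB) /etaloc -(piSa_pi dO AB).
have aB := A_aux dO AB; have aV := V_aux t0.
have cA := aux_cstar A_vn dSa; have [_ aV'] := cstar_star cA aV.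
rewrite (rep_mul prep (cstar_comp cA aV' aB) aV) (rep_mul prep aV' aB).
by rewrite (rep_adj prep aV).
Qed.

Lemma etaloc_compression t O T : 0 <= t -> double_cone O -> O `<=` Cn' t -> F O T ->
  adj J \o etaloc t T \o J = eta (adj J \o T \o J).
Proof.
move=> t0 dO OC FT; rewrite (eta_conjugate dO OC (compression_local dO FT)) /etaloc.
have bW := unitary_bounded (shift_unitary t0).
have bV := unitary_bounded (V_unitary t).
rewrite -[LHS]/((adj J \o adj (W t)) \o T \o (W t \o J)) shift_J //.
by rewrite -adj_comp // shift_J // adj_comp.
Qed.

Lemma etaloc_hom t O : 0 <= t -> double_cone O -> local_hom O (etaloc t).
Proof. by move=> t0 dO; apply: local_hom_conjugate => //; exact: shift_unitary. Qed.

(** [etaloc t T] sends [J v] to [adj (W t)] applied to [T (J (V t v))]. As [V t] is onto, these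
    vectors are the image of the cyclic ones under a unitary, so their span is dense. *)
Lemma etaloc_operator t O (L : hilbertSpace R) (P Q : H -> L) : 0 <= t -> double_cone O ->
  bounded_op P -> bounded_op Q ->
  (forall T v, F O T -> P (etaloc t T (J v)) = Q (etaloc t T (J v))) -> P = Q.
Proof.
move=> t0 dO bP bQ h; have uW := shift_unitary t0; have bW := unitary_bounded uW.
have e : P \o adj (W t) = Q \o adj (W t).
  apply: (cyclic_operator dO); try (by apply: bounded_comp => //; exact: bounded_adj).
  move=> T v FT; have := h T (adj (V t) v) FT; rewrite /etaloc /=.
  have /(congr1 (@^~ (adj (V t) v))) /= -> := shift_J t0.
  by rewrite -[V t (adj (V t) v)]/((V t \o adj (V t)) v) unitary_adjr.
rewrite -[P]/(P \o idfun) -[Q]/(Q \o idfun) -(unitary_adjl uW).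
by rewrite -[LHS]/((P \o adj (W t)) \o W t) e.
Qed.

(** On one double cone in the complement of [D], the unitary is prescribed by sending
    [etaloc t T (J v)] to [T (J (V0 v))]. The Gram matrices agree because the compression of
    [etaloc t (adj T' \o T)] is [eta] of an observable, and there [V0] implements [eta]. *)
Lemma etaloc_implemented D : spacelike_cone D ->
  equivalent_on (region_algebra A (causal_complement D)) eta idfun ->
  exists2 U, unitary_op U & forall t O T, 0 <= t -> double_cone O -> O `<=` causal_complement D ->
    O `<=` Cn' t -> F O T -> U \o etaloc t T = T \o U.
Proof.
move=> hD [V0 uV0 hV0].
have [xd [Kd dD]] := spacelike_cone_directions hD.
have [d Kdd] := cone_nonempty dD.
have bV0 := unitary_bounded uV0.
case: (double_cone_exists dSa) => O1 dO1.
have [r r0 /(_ r (lexx r)) O1D] := shift_into_complement dD Kdd dO1.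
set O := translate O1 _ in O1D.
have dO : double_cone O by exact: double_cone_translate.
have [t t0 OC] := exists_shift dO.
have cO := local_cstar F_vn dO.
have V0_eta Q B : double_cone Q -> Q `<=` causal_complement D -> A Q B -> V0 \o eta B = B \o V0.
  by move=> dQ QD AB; apply: hV0; exact: local_in_region AB.
pose X (T : H -> H) v := etaloc t T (J v); pose Y (T : H -> H) v := T (J (V0 v)).
pose Rel x y := exists (n : nat) (T : 'I_n -> H -> H) (v : 'I_n -> H0), [/\ forall k, F O (T k),
   x = \sum_(k < n) X (T k) (v k) & y = \sum_(k < n) Y (T k) (v k)].
have XY T T' v v' : F O T -> F O T' -> inner H (X T v) (X T' v') = inner H (Y T v) (Y T' v').
  move=> FT FT'; have [bT' FTa'] := local_star F_vn dO FT'.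
  have FTT := cstar_comp cO FTa' FT.
  have [b1 _ _] := etaloc_hom t0 dO FT' FT'; have [b2 _ _] := etaloc_hom t0 dO FTT FTT.
  have [_ _ aT'] := etaloc_hom t0 dO FT' FT'; have [_ mT _] := etaloc_hom t0 dO FTa' FT.
  rewrite /X /Y -(adj_innerr _ _ b1) -aT' -[etaloc t (adj T') _]/((etaloc t (adj T') \o etaloc t T) (J v)).
  rewrite -mT -(adj_innerr _ _ bJ).
  have /(congr1 (@^~ v)) /= -> := etaloc_compression t0 dO OC FTT.
  rewrite -(adj_innerr _ _ bT') -(adj_innerr _ _ bJ) -(adj_innerr _ _ bV0).
  have e := V0_eta _ _ dO O1D (compression_local dO FTT).
  congr (inner H0 _ _).
  rewrite -[RHS]/(adj V0 (((adj J \o (adj T' \o T) \o J) \o V0) v)) -e /=.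
  by rewrite -[RHS]/((adj V0 \o V0) _) unitary_adjl.
have [||||U uU hU] := @unitary_extension R H H Rel.
- move=> c x y x' y' [n [T [v [FT -> ->]]]] [m [T' [v' [FT' -> ->]]]].
  exists (n + m)%N, (fun k => match fintype.split k with inl i => c *: T i | inr j => T' j end),
    (fun k => match fintype.split k with inl i => v i | inr j => v' j end).
  split.
  + by move=> k; case: (fintype.split k) => i //; exact: (cstar_scale cO).
  + rewrite big_split_ord scaler_sumr /=; congr (_ + _); apply: eq_bigr => i _.
      rewrite (unsplitK (inl i : 'I_n + 'I_m)) /X /etaloc /=.
      exact/esym/(linZ _ _ (bounded_lin (bounded_adj (unitary_bounded (shift_unitary t0))))).
    by rewrite (unsplitK (inr i : 'I_n + 'I_m)).
  + rewrite big_split_ord scaler_sumr /=; congr (_ + _); apply: eq_bigr => i _.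
      by rewrite (unsplitK (inl i : 'I_n + 'I_m)).
    by rewrite (unsplitK (inr i : 'I_n + 'I_m)).
- move=> x y x' y' [n [T [v [FT -> ->]]]] [m [T' [v' [FT' -> ->]]]].
  rewrite !inner_suml; apply: eq_bigr => i _; rewrite !inner_sumr; apply: eq_bigr => j _.
  exact: XY.
- have uW := shift_unitary t0; have bW := unitary_bounded uW.
  move=> x e e0; have [_ [n [T [v [FT ->]]]] h] := cyclic_dense dO (W t x) e0.
  exists (\sum_(k < n) X (T k) (adj (V t) (v k))).
    by exists (\sum_(k < n) Y (T k) (adj (V t) (v k))), n, T, (fun k => adj (V t) (v k)).
  suff -> : \sum_(k < n) X (T k) (adj (V t) (v k)) = adj (W t) (\sum_(k < n) T k (J (v k))).
    rewrite -[x]/(idfun x) -(unitary_adjl uW) /= -(linB _ _ (bounded_lin (bounded_adj bW))).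
    by rewrite (isometric_hnorm _ (unitary_adj uW).1).
  rewrite (lin_sum _ _ (bounded_lin (bounded_adj bW))); apply: eq_bigr => k _.
  rewrite /X /etaloc /=; have /(congr1 (@^~ (adj (V t) (v k)))) /= -> := shift_J t0.
  by rewrite -[V t (adj (V t) _)]/((V t \o adj (V t)) _) unitary_adjr.
- move=> y e e0; have [_ [n [T [v [FT ->]]]] h] := cyclic_dense dO y e0.
  exists (\sum_(k < n) T k (J (v k))) => //.
  exists (\sum_(k < n) X (T k) (adj V0 (v k))), n, T, (fun k => adj V0 (v k)); split=> //.
  apply: eq_bigr => k _; rewrite /Y.
  by rewrite -[V0 (adj V0 _)]/((V0 \o adj V0) _) unitary_adjr.
have bU := unitary_bounded uU.
have UX T v : F O T -> U (X T v) = Y T v.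
  move=> FT; apply: hU; exists 1%N, (fun=> T), (fun=> v).
  by split=> //; rewrite big_ord1.
have Fid : F O idfun by exact: cstar_id.
have UJ : U \o J = J \o V0.
  apply/funext => v /=; have := UX idfun v Fid; rewrite /X /Y /etaloc /=.
  by rewrite -[adj (W t) (W t _)]/((adj (W t) \o W t) _) unitary_adjl //; exact: shift_unitary.
have UJ' : adj U \o J = J \o adj V0.
  rewrite -[LHS]/((adj U \o J) \o idfun) -(unitary_adjr uV0).
  rewrite -[LHS]/(adj U \o (J \o V0) \o adj V0) -UJ.
  by rewrite -[LHS]/((adj U \o U) \o J \o adj V0) unitary_adjl.
(* Multiplicativity turns the prescription on vectors into an operator identity: both sides send
   [etaloc t T' (J v)] to [T (T' (J (V0 v)))]. *)
have baseO s T : 0 <= s -> O `<=` Cn' s -> F O T -> U \o etaloc s T = T \o U.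
  move=> s0 OCs FT; rewrite (etaloc_indep s0 t0 dO OCs OC FT).
  apply: (etaloc_operator t0 dO).
  - by apply: bounded_comp => //; have [] := etaloc_hom t0 dO FT FT.
  - by apply: bounded_comp => //; exact: local_bounded FT.
  move=> T' v FT'; have [_ m _] := etaloc_hom t0 dO FT FT'.
  rewrite /= -[etaloc t T (etaloc t T' _)]/((etaloc t T \o etaloc t T') (J v)) -m.
  by rewrite (UX (T \o T')) ?(UX T') //; exact: (cstar_comp cO).
exists U => //.
(* The relation is asked for all admissible shifts at once: a larger double cone may need a larger
   shift, and [etaloc_indep] mediates between the two. *)
pose P Q := forall s T, 0 <= s -> Q `<=` Cn' s -> F Q T -> U \o etaloc s T = T \o U.
suff PQ Q : double_cone Q -> Q `<=` causal_complement D -> P Q.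
  by move=> s Q T s0 dQ QD QC FT; exact: (PQ Q dQ QD s T s0 QC FT).
move=> dQ QD; apply: (cone_complement_connected dD (P := P)) dO dQ O1D QD _ => //.
move=> {}Q Q' dQ dQ' QQ' QD; split=> hP s T s0 QC FT; last first.
  have [s' s'0 QC'] := exists_shift dQ'.
  rewrite (etaloc_indep s0 s'0 dQ QC _ FT); last by move=> x /QQ' /QC'.
  by apply: hP => //; exact: (F_isotony dQ dQ').
apply: (transport (sigma := id) (X := V0) dQ dQ' QQ') => //.
- exact: etaloc_hom.
- exact: local_hom_id.
- by move=> S FS; apply: hP => // x /QQ' /QC.
- move=> T' FT'; rewrite (etaloc_compression s0 dQ' QC FT').
  by rewrite (V0_eta _ _ dQ' QD (compression_local dQ' FT')).
- by move=> x y h; apply: (cyclic_vector dQ) => T' v FT'; exact: h.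
- by move=> P1 P2 b1 b2 h; exact: (etaloc_operator s0 dQ' b1 b2).
Qed.

Hypothesis Sa_cone : spacelike_cone Sa.
Hypothesis eta_rep : representation (quasilocal A) eta.
Hypothesis eta_bf : forall D, spacelike_cone D ->
  equivalent_on (region_algebra A (causal_complement D)) eta idfun.

Lemma nat_above (r : R) : exists n : nat, r <= n%:R.
Proof.
exists (Num.truncn (`|r|)).+1; apply: le_trans (ler_norm r) _.
by have /andP[_ /ltW] := truncn_itv (normr_ge0 r).
Qed.

(** For [m <= n] the operator [U n \o adj (U m)] commutes with the fields of the complement of
    [Sn m], hence with [M m]; so the conjugations are compatible and [conjugation_limit] applies. *)
Lemma extension_exists : exists etahat : (H -> H) -> (H -> H),
  [/\ representation (aux_algebra F Sa) etahat,
    forall z, weakly_continuous_on (cone_complement_vn F Sa z) etahat,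
    forall t O T, 0 <= t -> double_cone O -> O `<=` Cn' t -> F O T -> etahat T = etaloc t T
  & forall D, spacelike_cone D -> exists2 U, unitary_op U &
      forall T, region_algebra F (causal_complement D) T -> U \o etahat T = T \o U].
Proof.
have [s Ks_s] := cone_nonempty dSa.
pose Sn (n : nat) := translate Sa (n%:R *: s).
pose M n := cone_complement_vn F Sa (n%:R *: s).
have /boolp.choice[U hU] : forall n, exists U : H -> H, unitary_op U /\
    forall t O T, 0 <= t -> double_cone O -> O `<=` causal_complement (Sn n) ->
      O `<=` Cn' t -> F O T -> U \o etaloc t T = T \o U.
  move=> n; have cSn := spacelike_cone_translate (n%:R *: s) Sa_cone.
  by have [U uU hU] := etaloc_implemented cSn (eta_bf cSn); exists U.
have uU n : unitary_op (U n) by case: (hU n).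
have Umono m n : (m <= n)%N -> Sn n `<=` Sn m.
  by move=> mn; apply: (cone_shift_antitone dSa Ks_s); rewrite ler_nat.
have mM m n : (m <= n)%N -> M m `<=` M n.
  by move=> /Umono h; exact: cone_vn_mono.
have compat m n T : (m <= n)%N -> M m T -> adj (U m) \o T \o U m = adj (U n) \o T \o U n.
  move=> mn MT; pose X := U n \o adj (U m).
  have cX : commutant (local_operators F (causal_complement (Sn m))) X.
    split.
      by apply: bounded_comp; [|apply: bounded_adj]; exact: unitary_bounded.
    move=> S [] O [dO OS] FS; have [t t0 OC] := exists_shift dO.
    have em := (hU m).2 t O S t0 dO OS OC FS.
    have OSn : O `<=` causal_complement (Sn n).
      by move=> x /OS; exact/causal_complement_mono/Umono.
    have en := (hU n).2 t O S t0 dO OSn OC FS.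
    rewrite -[LHS]/((S \o U n) \o adj (U m)) -en.
    rewrite -[LHS]/(U n \o (idfun \o etaloc t S) \o adj (U m)) -(unitary_adjl (uU m)).
    rewrite -[LHS]/(U n \o adj (U m) \o (U m \o etaloc t S) \o adj (U m)) em.
    by rewrite -[LHS]/(U n \o adj (U m) \o S \o (U m \o adj (U m))) unitary_adjr.
  have e : X \o T = T \o X.
    by move: MT; rewrite /M cone_vnE // => -[_ h]; exact: h.
  rewrite -[RHS]/(adj (U n) \o T \o U n \o idfun) -(unitary_adjl (uU m)).
  rewrite -[RHS]/(adj (U n) \o (T \o X) \o U m) -e.
  by rewrite -[RHS]/((adj (U n) \o U n) \o adj (U m) \o T \o U m) unitary_adjl.
have [rho rrho hrho] := conjugation_limit (fun n => cone_vn_cstar F_vn Sa (n%:R *: s)) mM uU compat.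
(* The translates by [n%:R *: s] are cofinal, so the sequence [M] exhausts the union that defines
   [aux_algebra]. *)
have Msub z : exists n, cone_complement_vn F Sa z `<=` M n.
  have [r _ hr] := shifted_cone_sub dSa z Ks_s; have [n hMn] := nat_above r.
  by exists n; apply: cone_vn_mono => //; exact: hr.
have auxE : norm_closure [set T | exists n, M n T] = aux_algebra F Sa.
  apply/seteqP; split; apply: norm_closure_mono => T.
    by move=> [n MT]; exists (n%:R *: s).
  by move=> [z MT]; have [n hMn] := Msub z; exists n; exact: hMn.
rewrite auxE in rrho.
have rho_loc t O T : 0 <= t -> double_cone O -> O `<=` Cn' t -> F O T -> rho T = etaloc t T.
  move=> t0 dO OC FT; have [r _ hr] := shifted_cone_avoids dSa Ks_s dO.
  have [n /hr hMn] := nat_above r.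
  have MT : M n T by exact: cone_vn_local FT.
  rewrite (hrho n T MT) -[LHS]/(adj (U n) \o (T \o U n)).
  rewrite -((hU n).2 t O T t0 dO hMn OC FT).
  by rewrite -[LHS]/((adj (U n) \o U n) \o etaloc t T) unitary_adjl.
exists rho; split=> //.
(* On [M n] the matrix element of the image of [T] at [x] and [y] is that of [T] at [U n x] and
   [U n y]. *)
- move=> z F0 T PF FM MT FT x y; have [n hMn] := Msub z.
  rewrite (hrho n T (hMn _ MT)) /= adj_innerr; last exact: unitary_bounded.
  apply: cvg_trans (FT (U n x) (U n y)); apply: near_eq_cvg; apply: filterS FM => B /hMn MB.
  by rewrite (hrho n B MB) /= adj_innerr //; exact: unitary_bounded.
- move=> D hD; have [U' uU' hU'] := etaloc_implemented hD (eta_bf hD); exists U' => // T cT.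
  have aF := aux_cstar F_vn dSa.
  have q_aux S : region_algebra F (causal_complement D) S -> aux_algebra F Sa S.
    by move=> cS; apply: (quasilocal_aux F_vn dSa); exact: region_mono cS.
  (* [norm_closure_intertwine] has the mapped operator on the right, so the relation is proved for
     [adj U'] and turned round afterwards. *)
  have e : adj U' \o T = rho T \o adj U'.
    have /norm_closureP[_ appr] := cT; have aT := q_aux T cT.
    apply: (norm_closure_intertwine (f := rho)) cT _ _.
    + exact/bounded_adj/unitary_bounded.
    + move=> e e0; have [S LS hS] := appr e e0.
      have aS : aux_algebra F Sa S.
        by apply: q_aux; apply: (sub_norm_closure _ LS); exact: (local_operators_bounded F_vn LS).
      exists S => //; split=> //; apply: (representation_close aF rrho) => //; exact: ltW.
    + move=> S [] O [dO OD] FS; have [t t0 OC] := exists_shift dO.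
      rewrite (rho_loc t O S) //.
      rewrite -[LHS]/(adj U' \o S \o idfun) -(unitary_adjr uU').
      rewrite -[LHS]/(adj U' \o (S \o U') \o adj U') -(hU' t O S t0 dO OD OC FS).
      by rewrite -[LHS]/((adj U' \o U') \o etaloc t S \o adj U') unitary_adjl.
  rewrite -[LHS]/(U' \o rho T \o idfun) -(unitary_adjl uU').
  rewrite -[LHS]/(U' \o (rho T \o adj U') \o U') -e.
  by rewrite -[LHS]/((U' \o adj U') \o T \o U') unitary_adjr.
Qed.

Variable etahat : (H -> H) -> (H -> H).
Hypothesis E_rep : representation (aux_algebra F Sa) etahat.
Hypothesis E_weak : forall z, weakly_continuous_on (cone_complement_vn F Sa z) etahat.
Hypothesis E_loc : forall t O T, 0 <= t -> double_cone O -> O `<=` Cn' t -> F O T ->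
  etahat T = etaloc t T.

Let cauxF := aux_cstar F_vn dSa.
Let cauxA := aux_cstar A_vn dSa.

(** [W t] belongs to the algebra for [x0], hence to the larger one for [z], and conjugation by it
    keeps local fields there; weak continuity does the rest. *)
Lemma extension_cone_vn z T : translate Sa z `<=` translate Sa x0 ->
  cone_complement_vn F Sa z T -> cone_complement_vn F Sa z (etahat T).
Proof.
move=> zx; have wz := @E_weak z; have MM := cone_vn_mono F_vn zx.
have Maux S : cone_complement_vn F Sa z S -> aux_algebra F Sa S by exact: aux_cone_vn.
have cMz := cone_vn_cstar F_vn Sa z.
have hgen B : local_operators F (causal_complement (translate Sa z)) B ->
    cone_complement_vn F Sa z (etahat B).
  move=> [] O [dO OS] FB; have [t t0 OC] := exists_shift dO.
  rewrite (E_loc t0 dO OC FB); have MW := MM _ (shift_cone_vn t0).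
  have [_ MW'] := cstar_star cMz MW.
  apply: (cstar_comp cMz) => //; apply: (cstar_comp cMz) => //.
  exact: cone_vn_local FB.
rewrite cone_vnE // in wz Maux hgen *.
have sD := local_operators_star F_vn (S := causal_complement (translate Sa z)).
exact: (weak_preserves sD sD E_rep cauxF Maux wz hgen).
Qed.

Lemma extension_aux T : aux_algebra F Sa T -> aux_algebra F Sa (etahat T).
Proof.
move=> aT; rewrite /aux_algebra; apply/norm_closureP; split; first exact: (rep_bounded E_rep).
move=> e e0; have /norm_closureP[_ /(_ e e0) [S [z MS] hS]] := aT.
have [z' [h1 h2]] := common_translate dSa z x0.
have MS' : cone_complement_vn F Sa z' S by exact: (cone_vn_mono F_vn h1).
exists (etahat S); first by exists z'; exact: extension_cone_vn.
apply: (representation_close cauxF E_rep) => //; [exact: aux_cone_vn MS' | exact: ltW].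
Qed.

Let qauxF T : quasilocal F T -> aux_algebra F Sa T.
Proof. exact: (quasilocal_aux F_vn dSa). Qed.

Lemma extension_localised : localised F C etahat.
Proof.
move=> T cT; apply/funext => x; apply/eqP; rewrite -subr_eq0; apply/eqP.
apply: (@hnorm_eps0 _ _ _ (2 * hnorm x)) => e e0.
have /norm_closureP[_ /(_ e e0) [S [ O [dO OC] FS] hS]] := cT.
have eS : etahat S = S.
  have [t t0 OCt] := exists_shift dO; rewrite (E_loc t0 dO OCt FS) /etaloc.
  rewrite -[LHS]/(adj (W t) \o (S \o W t)) (shift_local_commute t0 dO OC FS).
  by rewrite -[LHS]/((adj (W t) \o W t) \o S) unitary_adjl //; exact: shift_unitary.
have aT : aux_algebra F Sa T by apply: qauxF; exact: region_mono cT.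
have aS : aux_algebra F Sa S by apply: qauxF; exact: local_quasilocal FS.
have h := representation_close cauxF E_rep aT aS (ltW e0) hS x.
apply: le_trans (hnorm_tri (S x) _ _) _; rewrite eS in h.
by have := hS x; rewrite (hnormBC (S x)); move: h; move: (hnorm _) (hnorm _) (hnorm x) => u v w; lra.
Qed.

Lemma eta_aux B : quasilocal A B -> aux_algebra A Sa (eta B).
Proof.
move=> qB; apply: (cstar_closed cauxA); apply/norm_closureP; split; first exact: (rep_bounded eta_rep).
move=> e e0; have /norm_closureP[_ /(_ e e0) [S [ O [dO _] AS] hS]] := qB.
have [t t0 OC] := exists_shift dO; exists (eta S).
  rewrite (eta_conjugate dO OC AS); have aV := V_aux t0; have [_ aV'] := cstar_star cauxA aV.
  apply: (cstar_comp cauxA) => //; apply: (cstar_comp cauxA) => //; exact: A_aux AS.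
apply: (representation_close (quasilocal_cstar A_vn A_isotony (double_cone_exists dSa)) eta_rep) => //.
  exact: local_quasilocal AS.
exact: ltW.
Qed.

Lemma extension_extends B : quasilocal A B -> etahat (pi B) = piSa (eta B).
Proof.
move=> qB; apply/funext => x; apply/eqP; rewrite -subr_eq0; apply/eqP.
apply: (@hnorm_eps0 _ _ _ (2 * hnorm x)) => e e0.
have /norm_closureP[_ /(_ e e0) [S [ O [dO _] AS] hS]] := qB.
have [t t0 OC] := exists_shift dO.
have cqA := quasilocal_cstar A_vn A_isotony (double_cone_exists dSa).
have qS : quasilocal A S by exact: local_quasilocal AS.
have h1 := representation_close cqA (fld_rep hF) qB qS (ltW e0) hS.
have h2 := representation_close cqA eta_rep qB qS (ltW e0) hS.
have h3 := representation_close cauxA prep (eta_aux qB) (eta_aux qS) (ltW e0) h2 x.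
have qpS : aux_algebra F Sa (pi S) by apply: qauxF; apply: local_quasilocal (pi_local dO AS).
have qpB : aux_algebra F Sa (pi B).
  apply: (cstar_closed cauxF); apply/norm_closureP; split; first exact: (rep_bounded (fld_rep hF)).
  move=> d d0; have /norm_closureP[_ /(_ d d0) [S' [ O' [dO' _] AS'] hS']] := qB.
  exists (pi S'); first by apply: qauxF; apply: local_quasilocal (pi_local dO' AS').
  apply: (representation_close cqA (fld_rep hF)) => //; [exact: local_quasilocal AS' | exact: ltW].
have h4 := representation_close cauxF E_rep qpB qpS (ltW e0) h1 x.
apply: le_trans (hnorm_tri (etahat (pi S) x) _ _) _.
rewrite (E_loc t0 dO OC (pi_local dO AS)) in h4 *.
rewrite (etaloc_pi t0 dO OC AS) in h4 *.
by rewrite [in X in _ + X]hnormBC; move: h3 h4; move: (hnorm _) (hnorm _) (hnorm x) => u v w; lra.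
Qed.

Let Ad_close g (T S : H -> H) (e : R) : G g -> (forall x, hnorm (T x - S x) <= e * hnorm x) ->
  forall x, hnorm (Ad g T x - Ad g S x) <= e * hnorm x.
Proof.
move=> Gg h x; have ug := fld_unitary hF Gg.
rewrite /Ad /= -(linB _ _ (bounded_lin (unitary_bounded ug))) (isometric_hnorm _ ug.1).
by apply: le_trans (h _) _; rewrite (isometric_hnorm _ (unitary_adj ug).1).
Qed.

Lemma Ad_quasilocal g T : G g -> quasilocal F T -> quasilocal F (Ad g T).
Proof.
move=> Gg qT; have bg := unitary_bounded (fld_unitary hF Gg).
have bT := norm_closure_bounded qT.
apply/norm_closureP; split.
  by apply: bounded_comp; [exact: bounded_comp | exact: bounded_adj].
move=> e e0; have /norm_closureP[_ /(_ e e0) [S [ O [dO OT] FS] hS]] := qT.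
exists (Ad g S); first by exists O => //; exact: Ad_local.
exact: Ad_close.
Qed.

(** [W t] is in the image of [piSa] and so commutes with [G]; hence [Ad g] passes through the local
    formula. *)
Lemma extension_equivariant g T : G g -> quasilocal F T -> Ad g (etahat T) = etahat (Ad g T).
Proof.
move=> Gg qT; apply/funext => x; apply/eqP; rewrite -subr_eq0; apply/eqP.
apply: (@hnorm_eps0 _ _ _ (2 * hnorm x)) => e e0.
have /norm_closureP[_ /(_ e e0) [S [ O [dO _] FS] hS]] := qT.
have [t t0 OC] := exists_shift dO.
have qS : quasilocal F S by exact: local_quasilocal FS.
have eS : Ad g (etahat S) = etahat (Ad g S).
  rewrite (E_loc t0 dO OC FS) (E_loc t0 dO OC (Ad_local Gg dO FS)) /etaloc /Ad.
  have bg := unitary_bounded (fld_unitary hF Gg); have bW := unitary_bounded (shift_unitary t0).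
  have [_ _ hG] := fld_group hF.
  have e2 := shift_invariant t0 (hG _ Gg).
  have e3 : g \o adj (W t) = adj (W t) \o g.
    have := congr1 (@adj R H H) e2; rewrite (adj_comp (bounded_adj bg) bW).
    by rewrite (adj_comp bW (bounded_adj bg)) (adjK bg) => ->.
  rewrite -[LHS]/((g \o adj (W t)) \o S \o (W t \o adj g)) e3 -e2 //.
have h1 := Ad_close Gg (representation_close cauxF E_rep (qauxF qT) (qauxF qS) (ltW e0) hS) x.
have h2 := representation_close cauxF E_rep (qauxF (Ad_quasilocal Gg qT))
  (qauxF (Ad_quasilocal Gg qS)) (ltW e0) (Ad_close Gg hS) x.
apply: le_trans (hnorm_tri (Ad g (etahat S) x) _ _) _; rewrite [in X in _ + X]eS.
by rewrite [in X in _ + X]hnormBC; move: h1 h2; move: (hnorm _) (hnorm _) (hnorm x) => u v w; lra.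
Qed.

(** Two weakly continuous maps that agree on local observables. This makes [etahat] computable on
    lifted transporters and on lifted solutions of the conjugate equations, for which being
    quasilocal is not known. *)
Lemma extension_piSa eta' z X : aux_extension A Sa eta eta' ->
  translate Sa z `<=` translate Sa x0 -> cone_complement_vn A Sa z X ->
  cone_complement_vn A Sa z (eta' X) /\ etahat (piSa X) = piSa (eta' X).
Proof.
move=> he zx cX.
have r' := aux_rep he; have wz := @aux_weak _ _ _ _ _ _ _ he z.
have cMz := cone_vn_cstar A_vn Sa z.
have Maux S : cone_complement_vn A Sa z S -> aux_algebra A Sa S by exact: aux_cone_vn.
(* [piSa] is weakly continuous on the algebra of a single complement only, so [eta'] has to preserve
   this algebra before the two can be composed. *)
have pres : forall Y, cone_complement_vn A Sa z Y -> cone_complement_vn A Sa z (eta' Y).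
  have hgen B : local_operators A (causal_complement (translate Sa z)) B ->
      cone_complement_vn A Sa z (eta' B).
    move=> [] O [dO OS] AB; have [t t0 OC] := exists_shift dO.
    rewrite (aux_extends he (local_quasilocal A_vn dO AB)) (eta_conjugate dO OC AB).
    have MV := cone_vn_mono A_vn zx (V_cone_vn t0); have [_ MV'] := cstar_star cMz MV.
    apply: (cstar_comp cMz) => //; apply: (cstar_comp cMz) => //.
    exact: cone_vn_local AB.
  have wz' := wz; rewrite cone_vnE // in wz' Maux hgen *.
  have sD := local_operators_star A_vn (S := causal_complement (translate Sa z)).
  exact: (weak_preserves sD sD r' cauxA Maux wz' hgen).
split; first exact: pres.
have w1 : weakly_continuous_on (cone_complement_vn A Sa z) (etahat \o piSa).
  by apply: weakly_continuous_comp (@aux_weak _ _ _ _ _ _ _ hpi z) (@E_weak z) _ => Y; exact: piSa_cone_vn.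
have w2 : weakly_continuous_on (cone_complement_vn A Sa z) (piSa \o eta').
  exact: weakly_continuous_comp wz (@aux_weak _ _ _ _ _ _ _ hpi z) pres.
have sD := local_operators_star A_vn (S := causal_complement (translate Sa z)).
have gM B : star_algebra (local_operators A (causal_complement (translate Sa z))) B ->
    cone_complement_vn A Sa z B.
  by move=> gB; rewrite cone_vnE //; apply: star_algebra_bicommutant gB; exact: star_bounded.
have key B : star_algebra (local_operators A (causal_complement (translate Sa z))) B ->
    etahat (piSa B) = piSa (eta' B).
  have ap D : cone_complement_vn A Sa z D -> aux_algebra F Sa (piSa D).
    by move=> /piSa_cone_vn; exact: aux_cone_vn.
  have ae D : cone_complement_vn A Sa z D -> aux_algebra A Sa (eta' D).
    by move=> /pres /Maux.
  elim=> {B} [B [] O [dO OD] AB||B D gB hB gD hD|c B gB hB|B D gB hB gD hD].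
  - have qB := local_quasilocal A_vn dO AB.
    by rewrite (piSa_pi dO AB) (extension_extends qB) (aux_extends he qB).
  - by rewrite (rep_unital prep) (rep_unital E_rep) (rep_unital r') (rep_unital prep).
  - have mB := gM _ gB; have mD := gM _ gD.
    rewrite (rep_add prep (Maux _ mB) (Maux _ mD)) (rep_add E_rep (ap _ mB) (ap _ mD)) hB hD.
    by rewrite (rep_add r' (Maux _ mB) (Maux _ mD)) (rep_add prep (ae _ mB) (ae _ mD)).
  - have mB := gM _ gB.
    rewrite (rep_scale prep _ (Maux _ mB)) (rep_scale E_rep _ (ap _ mB)) hB.
    by rewrite (rep_scale r' _ (Maux _ mB)) (rep_scale prep _ (ae _ mB)).
  - have mB := gM _ gB; have mD := gM _ gD.
    rewrite (rep_mul prep (Maux _ mB) (Maux _ mD)) (rep_mul E_rep (ap _ mB) (ap _ mD)) hB hD.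
    by rewrite (rep_mul r' (Maux _ mB) (Maux _ mD)) (rep_mul prep (ae _ mB) (ae _ mD)).
rewrite cone_vnE // in w1 w2 cX.
apply/funext => x; apply: inner_ext => y.
by apply: (weak_eq sD w1 w2) cX => B /key /= ->.
Qed.

Lemma extension_unique etahat' : BF_criterion F etahat' -> localised F C etahat' ->
  (forall B, quasilocal A B -> etahat' (pi B) = piSa (eta B)) ->
  (forall g T, G g -> quasilocal F T -> Ad g (etahat' T) = etahat' (Ad g T)) ->
  forall T, quasilocal F T -> etahat' T = etahat T.
Proof.
move=> [r' bf'] loc' ext' equi'.
have uG := fld_unitary hF; have [_ _ Gadj] := fld_group hF.
have cqF := quasilocal_cstar F_vn F_isotony (double_cone_exists dSa).
suff local_eq O T : double_cone O -> F O T -> etahat' T = etahat T.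
  move=> T qT; apply/funext => x; apply/eqP; rewrite -subr_eq0; apply/eqP.
  apply: (@hnorm_eps0 _ _ _ (2 * hnorm x)) => e e0.
  have /norm_closureP[_ /(_ e e0) [S [ O [dO _] FS] hS]] := qT.
  have qS : quasilocal F S by exact: local_quasilocal FS.
  have h1 := representation_close cqF r' qT qS (ltW e0) hS x.
  have h2 := representation_close cauxF E_rep (qauxF qT) (qauxF qS) (ltW e0) hS x.
  apply: le_trans (hnorm_tri (etahat' S x) _ _) _; rewrite [in X in _ + X](local_eq O S dO FS).
  by rewrite [in X in _ + X]hnormBC; move: h1 h2; move: (hnorm _) (hnorm _) (hnorm x) => u v w; lra.
move=> dO FT.
(* [P] is spacelike to [C], so both maps are the identity on [F P]; they are compared on a double
   cone [B] around [O] and [P]. *)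
have [r _ /(_ r (lexx r)) PC] := shift_into_complement dC Ka dO.
set P := translate O _ in PC; have dP : double_cone P by exact: double_cone_translate.
have [B [dB OB PB]] := double_cone_big dO dP.
have [t t0 BC] := exists_shift dB.
(* On [F B] the map [etahat'] becomes conjugation by [W']. Its matrix elements at [J v] and [J w]
   are those of the argument at [W' (J v)] and [W' (J w)], to which [invariant_mean] applies. *)
have [W' uW' hW'] := bf' _ (spacelike_cone_translate (t *: a) C_cone).
have bW' := unitary_bounded uW'.
have etaE S : F B S -> etahat' S = adj W' \o S \o W'.
  move=> FS; have e : W' \o etahat' S = S \o W' by apply: hW'; exact: local_in_region FS.
  rewrite -[RHS]/(adj W' \o (S \o W')) -e.
  by rewrite -[RHS]/((adj W' \o W') \o etahat' S) unitary_adjl.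
have qF S : F B S -> quasilocal F S by exact: local_quasilocal.
have comp' S : F B S -> adj J \o etahat' S \o J = eta (adj J \o S \o J).
  (* The mean serves twice: with the vectors [J v] it shows that [b] is the compression of [S], with
     the vectors [W' (J v)] that [etahat' (pi b)] and [etahat' S] have the same compression. *)
  move=> FS; have [b Ab hb] := invariant_mean dB FS.
  have Fpb := pi_local dB Ab.
  have e1 : adj J \o S \o J = b.
    apply/funext => v; apply: inner_ext => w /=; rewrite (adj_innerr _ _ bJ).
    have <- : inner H (pi b (J v)) (J w) = inner H (S (J v)) (J w).
      apply: hb => D; elim=> {D} [g Gg|D D' _ hD _ hD'].
        have fx := fld_fixes hF; rewrite /Ad /= (adj_inner _ _ (unitary_bounded (uG _ Gg))).
        have /(congr1 (@^~ w)) /= -> := fx _ (Gadj _ Gg).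
        by have /(congr1 (@^~ v)) /= -> := fx _ (Gadj _ Gg).
      rewrite -[X in inner H X]/((2^-1)%:C *: (D (J v) + D' (J v))) innerZl innerDl hD hD'.
      rewrite mulrDr -mulrDl -rmorphD /=.
      by rewrite (_ : 2^-1 + 2^-1 = 1 :> R) ?mul1r //; field.
    have /(congr1 (@^~ v)) /= -> := pi_J dB Ab.
    by case: iJ => _ ->.
  rewrite e1; apply/funext => v; apply: inner_ext => w /=; rewrite (adj_innerr _ _ bJ).
  have e2 : adj J \o etaloc t (pi b) \o J = eta b.
    rewrite (etaloc_compression t0 dB BC Fpb); congr eta.
    by rewrite -[LHS]/(adj J \o (pi b \o J)) (pi_J dB Ab) -[LHS]/((adj J \o J) \o b) JJ.
  rewrite -e2 /= (adj_innerr _ _ bJ) (etaloc_pi t0 dB BC Ab) -(ext' b); last exact: local_quasilocal Ab.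
  rewrite (etaE _ Fpb) (etaE _ FS) /= !(adj_innerr _ _ bW').
  symmetry; apply: hb => D aD; have FD := averages_local dB FS aD.
  have eq_inner D' : F B D' -> inner H (D' (W' (J v))) (W' (J w)) = inner H (etahat' D' (J v)) (J w).
    by move=> FD'; rewrite (etaE _ FD') /= (adj_innerr _ _ bW').
  rewrite (eq_inner _ FD) (eq_inner _ FS).
  elim: aD {FD} => {D} [g Gg|D D' aD hD aD' hD'].
    rewrite -(equi' g S Gg (qF _ FS)) /Ad /= (adj_inner _ _ (unitary_bounded (uG _ Gg))).
    have /(congr1 (@^~ w)) /= -> := fld_fixes hF (Gadj _ Gg).
    by have /(congr1 (@^~ v)) /= -> := fld_fixes hF (Gadj _ Gg).
  have qD := qF _ (averages_local dB FS aD); have qD' := qF _ (averages_local dB FS aD').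
  rewrite (rep_scale r' _ (cstar_add cqF qD qD')) (rep_add r' qD qD').
  rewrite -[X in inner H X]/((2^-1)%:C *: (etahat' D (J v) + etahat' D' (J v))).
  rewrite innerZl innerDl hD hD' mulrDr -mulrDl -rmorphD /=.
  by rewrite (_ : 2^-1 + 2^-1 = 1 :> R) ?mul1r //; field.
have FPB S : F P S -> F B S by exact: F_isotony.
have triv' S : F P S -> etahat' S = S.
  by move=> FS; apply: loc'; exact: local_in_region FS.
have triv S : F P S -> etaloc t S = S.
  move=> FS; rewrite /etaloc -[LHS]/(adj (W t) \o (S \o W t)) (shift_local_commute t0 dP PC FS).
  by rewrite -[LHS]/((adj (W t) \o W t) \o S) unitary_adjl //; exact: shift_unitary.
have FT' : F B T by exact: (F_isotony dO dB OB).
rewrite (E_loc t0 dB BC FT').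
have e : idfun \o etahat' T = etaloc t T \o idfun; last exact: e.
apply: (transport (X := idfun) dP dB PB) FT' => //.
- move=> S S' FS FS'; split.
  + exact: (rep_bounded r' (qF _ FS')).
  + exact: (rep_mul r' (qF _ FS) (qF _ FS')).
  + exact: (rep_adj r' (qF _ FS')).
- exact: etaloc_hom.
- exact: bounded_id.
- exact: bounded_id.
- by rewrite !adj_id.
- by move=> S FS; rewrite triv // triv'.
- by move=> S FS; rewrite -[LHS]/(adj J \o etaloc t S \o J) -[RHS]/(adj J \o etahat' S \o J) (comp' S FS) (etaloc_compression t0 dB BC FS).
- by move=> x y h; apply: (cyclic_vector dP) => S v FS; have := h S v FS; rewrite triv.
- move=> P1 P2 b1 b2 h; apply: (cyclic_operator dP b1 b2) => S v FS.
  by have := h S v (FPB _ FS); rewrite triv'.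
Qed.

End LocalExtension.

(** Duality for the cone [Sa + w], after taking commutants: the commutant of its observables is the
    weak closure of those of its complement. *)
Lemma cone_vn_intro w X : spacelike_cone Sa -> bounded_op X ->
  (forall O B, double_cone O -> O `<=` translate Sa w -> A O B -> X \o B = B \o X) ->
  cone_complement_vn A Sa w X.
Proof.
move=> Sa_cone bX h; rewrite /cone_complement_vn /bicommutant.
rewrite (A_duality (or_intror (spacelike_cone_translate w Sa_cone))) commutant3; last first.
  exact: norm_closure_bounded.
rewrite commutant_region //; split=> // B [] O [dO OS] AB.
by rewrite (h O).
Qed.

(** * Lifting intertwiners from the observables to the fields *)

Section Intertwiner.
Variables (C D : set M3) (xc xd : M3) (K L : set M3) (a d x0 y0 : M3).
Variables (eta zeta : (H0 -> H0) -> (H0 -> H0)) (V W : R -> H0 -> H0).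
Hypothesis Sa_cone : spacelike_cone Sa.
Hypotheses (C_cone : spacelike_cone C) (D_cone : spacelike_cone D).
Hypotheses (dC : cone_directions C xc K) (dD : cone_directions D xd L).
Hypotheses (Ka : K a) (Ld : L d).
Hypothesis C_Sa : C `<=` causal_complement (translate Sa x0).
Hypothesis D_Sa : D `<=` causal_complement (translate Sa y0).
Hypotheses (eta_loc : localised A C eta) (zeta_loc : localised A D zeta).
Hypotheses (V_unitary : forall t, unitary_op (V t)) (W_unitary : forall t, unitary_op (W t)).
Hypothesis V_eta : forall t B,
  region_algebra A (causal_complement (translate C (t *: a))) B -> V t \o eta B = B \o V t.
Hypothesis W_zeta : forall t B,
  region_algebra A (causal_complement (translate D (t *: d))) B -> W t \o zeta B = B \o W t.
Hypothesis zeta_rep : representation (quasilocal A) zeta.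
Variables etahat zetahat : (H -> H) -> (H -> H).
Hypotheses (E_rep : representation (aux_algebra F Sa) etahat)
  (Z_rep : representation (aux_algebra F Sa) zetahat).
Hypothesis E_weak : forall z, weakly_continuous_on (cone_complement_vn F Sa z) etahat.
Hypothesis Z_weak : forall z, weakly_continuous_on (cone_complement_vn F Sa z) zetahat.
Hypothesis E_loc : forall t O T, 0 <= t -> double_cone O ->
  O `<=` causal_complement (translate C (t *: a)) -> F O T -> etahat T = local_extension_at V t T.
Hypothesis Z_loc : forall t O T, 0 <= t -> double_cone O ->
  O `<=` causal_complement (translate D (t *: d)) -> F O T -> zetahat T = local_extension_at W t T.
Variables eta' zeta' : (H0 -> H0) -> (H0 -> H0).
Hypotheses (he : aux_extension A Sa eta eta') (hz : aux_extension A Sa zeta zeta').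
Variable X : H0 -> H0.
Hypothesis X_aux : aux_algebra A Sa X.
Hypothesis X_int : forall B, aux_algebra A Sa B -> X \o B = zeta' (eta' B) \o X.

(** Inside [Sa + w] both charges act trivially, so [X] commutes with the observables there. This
    places [X], given only in a norm closure, in one algebra on which [piSa] is weakly
    continuous. *)
Lemma intertwiner_cone_vn w : translate Sa w `<=` translate Sa x0 ->
  translate Sa w `<=` translate Sa y0 -> cone_complement_vn A Sa w X.
Proof.
move=> wx wy; apply: cone_vn_intro => //; first exact: norm_closure_bounded X_aux.
move=> O B dO Ow AB; rewrite X_int; last exact: A_aux AB.
have qB := local_quasilocal A_vn dO AB.
have OC : O `<=` causal_complement C.
  by move=> x /Ow /wx; move: x; exact: causal_complement_sym.
have OD : O `<=` causal_complement D.
  by move=> x /Ow /wy; move: x; exact: causal_complement_sym.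
rewrite (aux_extends he qB) (eta_loc (local_in_region A_vn dO OC AB)).
by rewrite (aux_extends hz qB) (zeta_loc (local_in_region A_vn dO OD AB)).
Qed.

Let cauxF := aux_cstar F_vn dSa.
Let cauxA := aux_cstar A_vn dSa.

(** On a large double cone [zetahat \o etahat] is conjugation by a unitary, so [transport] can
    compare it with the identity, starting from a double cone inside [Sa + w] where both charges are
    trivial. *)
Lemma intertwiner_lift T : aux_algebra F Sa T ->
  piSa X \o T = zetahat (etahat T) \o piSa X.
Proof.
have [w [wx wy]] := common_translate dSa x0 y0.
have MX := intertwiner_cone_vn wx wy.
have bX := cone_vn_bounded A_vn MX.
have [_ MX'] := cstar_star (cone_vn_cstar A_vn Sa w) MX.
have bpX := piSa_bounded X_aux.
have local_case O S : double_cone O -> F O S -> piSa X \o S = zetahat (etahat S) \o piSa X.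
  move=> dO FS; have [s Ks_s] := cone_nonempty dSa.
  have [r _ /(_ r (lexx r)) Pw] := shift_into_cone (cone_translate dSa w) Ks_s dO.
  set P := translate O _ in Pw; have dP : double_cone P by exact: double_cone_translate.
  have [B [dB OB PB]] := double_cone_big dO dP.
  have [t t0 BC] := exists_shift dC Ka dB; have [u u0 BD] := exists_shift dD Ld dB.
  have PC : P `<=` causal_complement C.
    by move=> x /Pw /wx; move: x; exact: causal_complement_sym.
  have PD : P `<=` causal_complement D.
    by move=> x /Pw /wy; move: x; exact: causal_complement_sym.
  have MVx := V_cone_vn C_cone dC Ka C_Sa eta_loc V_unitary V_eta t0.
  have MV := cone_vn_mono A_vn wx MVx.
  have MWx := V_cone_vn D_cone dD Ld D_Sa zeta_loc W_unitary W_zeta u0.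
  have [MzV hzV] := extension_piSa D_cone dD Ld D_Sa zeta_loc W_unitary W_zeta zeta_rep Z_rep
    Z_weak Z_loc hz wy MV.
  have aV := aux_cone_vn A_vn MV; have [_ aV'] := cstar_star cauxA aV.
  have rz := aux_rep hz.
  have uzV : unitary_op (zeta' (V t)).
    apply: unitary_intro; first exact: (rep_bounded rz).
      by rewrite -(rep_adj rz aV) -(rep_mul rz aV' aV) unitary_adjl ?(rep_unital rz).
    by rewrite -(rep_adj rz aV) -(rep_mul rz aV aV') unitary_adjr ?(rep_unital rz).
  have uWh := shift_unitary D_cone dD Ld D_Sa zeta_loc W_unitary W_zeta u0.
  have uzVh : unitary_op (piSa (zeta' (V t))).
    by apply: piSa_unitary => //; exact: aux_cone_vn MzV.
  have aVh : aux_algebra F Sa (piSa (V t)) by apply: (aux_cone_vn F_vn); exact: piSa_cone_vn MV.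
  have [_ aVh'] := cstar_star cauxF aVh.
  (* [zetahat (etahat T')] is [T'] conjugated by the transporter of [zeta] and then by the image
     under [zetahat] of the transporter of [eta]; [Z] collects both. *)
  pose Z := charge_shift W u \o piSa (zeta' (V t)).
  have uZ : unitary_op Z by exact: unitary_comp.
  have bZ := unitary_bounded uZ.
  have ZJ : Z \o J = J \o (W u \o zeta' (V t)).
    rewrite -[LHS]/(charge_shift W u \o (piSa (zeta' (V t)) \o J)) (piSa_J MzV).
    by rewrite -[LHS]/((charge_shift W u \o J) \o zeta' (V t)) (piSa_J MWx).
  have hatE T' : F B T' -> zetahat (etahat T') = adj Z \o T' \o Z.
    move=> FT'; rewrite (E_loc t0 dB BC FT') /local_extension_at /charge_shift.
    have aT' : aux_algebra F Sa T'.
      by apply: (quasilocal_aux F_vn dSa); exact: local_quasilocal FT'.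
    rewrite (rep_mul Z_rep (cstar_comp cauxF aVh' aT') aVh) (rep_mul Z_rep aVh' aT').
    rewrite (rep_adj Z_rep aVh) hzV (Z_loc u0 dB BD FT') /Z.
    by rewrite adj_comp //; exact: unitary_bounded.
  have FS' : F B S by exact: (F_isotony dO dB OB).
  rewrite (hatE S FS').
  have trivE Q : F P Q -> adj Z \o Q \o Z = Q.
    move=> FQ; have FQ' : F B Q by exact: (F_isotony dP dB PB).
    rewrite -hatE //.
    have -> : etahat Q = Q.
      apply: (extension_localised C_cone dC Ka C_Sa eta_loc V_unitary V_eta E_rep E_loc).
      exact: local_in_region FQ.
    apply: (extension_localised D_cone dD Ld D_Sa zeta_loc W_unitary W_zeta Z_rep Z_loc).
    exact: local_in_region FQ.
  apply: (transport (rho := id) (sigma := fun T' => adj Z \o T' \o Z) (X := X) dP dB PB) FS' => //.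
  - exact: local_hom_id.
  - exact: local_hom_conjugate.
  - exact: piSa_J MX.
  - by rewrite -(rep_adj prep X_aux); exact: piSa_J MX'.
  - move=> Q FQ; rewrite trivE //; symmetry.
    have MX2 := MX; rewrite cone_vnE // in MX2.
    apply: (piSa_local_commute (z := w) _ MX2 dP) => //.
    by move=> x /Pw; move: x; exact: causal_complement_sym.
  (* The compression of [adj Z \o Q \o Z] is [zeta' (eta' b)], so the intertwining property of [X]
     on observables is exactly what is asked. *)
  - move=> Q FQ; have Ab := compression_local dB FQ; set b := adj J \o Q \o J in Ab *.
    have qb := local_quasilocal A_vn dB Ab; have ab := A_aux dB Ab.
    rewrite X_int // -[LHS]/(((adj J \o adj Z) \o Q \o (Z \o J)) \o X).
    congr (_ \o X); rewrite -adj_comp // ZJ.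
    have bWz : bounded_op (W u \o zeta' (V t)).
      by apply: bounded_comp; exact: unitary_bounded.
    rewrite adj_comp // adj_comp; [|exact: unitary_bounded|exact: unitary_bounded].
    rewrite -[LHS]/(adj (zeta' (V t)) \o (adj (W u) \o b \o W u) \o zeta' (V t)).
    rewrite -(eta_conjugate W_unitary W_zeta dB BD Ab) -(aux_extends hz qb) -(rep_adj rz aV).
    rewrite -(rep_mul rz aV' ab) -(rep_mul rz (cstar_comp cauxA aV' ab) aV).
    by rewrite (aux_extends he qb) (eta_conjugate V_unitary V_eta dB BC Ab).
  - by move=> x y h; apply: (cyclic_vector dP) => Q v FQ; have := h Q v FQ; rewrite trivE.
  - by move=> P1 P2 b1 b2; exact: (cyclic_operator dB b1 b2).
have hcomp S T' : aux_algebra F Sa S -> aux_algebra F Sa T' ->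
    [/\ zetahat (etahat (S + T')) = zetahat (etahat S) + zetahat (etahat T'),
      zetahat (etahat (S \o T')) = zetahat (etahat S) \o zetahat (etahat T') &
      forall c, zetahat (etahat (c *: S)) = c *: zetahat (etahat S)].
  move=> aS aT'.
  have aux1 Q := extension_aux C_cone dC Ka C_Sa eta_loc V_unitary V_eta E_rep E_weak E_loc (T := Q).
  have aeS := aux1 _ aS; have aeT := aux1 _ aT'; split.
  - by rewrite (rep_add E_rep) // (rep_add Z_rep).
  - by rewrite (rep_mul E_rep) // (rep_mul Z_rep).
  - by move=> c; rewrite (rep_scale E_rep) // (rep_scale Z_rep).
have cone_case z S : translate Sa z `<=` translate Sa x0 -> translate Sa z `<=` translate Sa y0 ->
    cone_complement_vn F Sa z S -> piSa X \o S = zetahat (etahat S) \o piSa X.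
  move=> zx zy MS.
  have pres Q := extension_cone_vn C_cone dC Ka C_Sa eta_loc V_unitary V_eta E_rep E_weak E_loc
    (z := z) (T := Q) zx.
  have wc : weakly_continuous_on (cone_complement_vn F Sa z) (zetahat \o etahat).
    exact: weakly_continuous_comp (@E_weak z) (@Z_weak z) pres.
  have sD := local_operators_star F_vn (S := causal_complement (translate Sa z)).
  have gaux B : star_algebra (local_operators F (causal_complement (translate Sa z))) B ->
      aux_algebra F Sa B.
    move=> gB; apply: (aux_cone_vn F_vn (z := z)); rewrite cone_vnE //.
    by apply: star_algebra_bicommutant gB; exact: star_bounded.
  have key B : star_algebra (local_operators F (causal_complement (translate Sa z))) B ->
      piSa X \o B = zetahat (etahat B) \o piSa X.
    elim=> {B} [B [] O [dO _] FB||B Q gB hB gQ hQ|c B gB hB|B Q gB hB gQ hQ].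
    - exact: local_case FB.
    - by rewrite (rep_unital E_rep) (rep_unital Z_rep).
    - have [-> _ _] := hcomp _ _ (gaux _ gB) (gaux _ gQ).
      by rewrite comp_lin_add ?hB ?hQ //; exact: bounded_lin.
    - have [_ _ ->] := hcomp _ _ (gaux _ gB) (gaux _ gB).
      by rewrite comp_lin_scale ?hB //; exact: bounded_lin.
    - have [_ -> _] := hcomp _ _ (gaux _ gB) (gaux _ gQ).
      rewrite -[LHS]/((piSa X \o B) \o Q) hB.
      by rewrite -[LHS]/(zetahat (etahat B) \o (piSa X \o Q)) hQ.
  rewrite cone_vnE // in wc MS.
  apply/funext => x; apply: inner_ext => y /=; rewrite (adj_inner _ _ bpX).
  apply: (weak_eq sD (@weakly_continuous_id _ _ _) wc) MS => B /key /(congr1 (@^~ x)) /= <-.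
  by rewrite (adj_inner _ _ bpX).
move=> aT; have /norm_closureP[_ appr] := aT; have aT0 := aT.
apply: (norm_closure_intertwine (f := zetahat \o etahat)) aT0 _ _ => //.
  move=> e e0; have [S [z MS] hS] := appr e e0; exists S; first by exists z.
  split=> //; have aS := aux_cone_vn F_vn MS.
  have aux1 Q := extension_aux C_cone dC Ka C_Sa eta_loc V_unitary V_eta E_rep E_weak E_loc (T := Q).
  apply: (representation_close cauxF Z_rep (aux1 _ aT) (aux1 _ aS) (ltW e0)).
  exact: (representation_close cauxF E_rep aT aS (ltW e0) hS).
(* [cone_case] wants a translate inside both [Sa + x0] and [Sa + y0]; shrinking the cone only
   enlarges the algebra around [S]. *)
move=> S [z MS]; have [z1 [h1 h2]] := common_translate dSa z w.
have h3 : translate Sa z1 `<=` translate Sa x0 by move=> x /h2 /wx.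
have h4 : translate Sa z1 `<=` translate Sa y0 by move=> x /h2 /wy.
by apply: cone_case h3 h4 _; exact: (cone_vn_mono F_vn h1).
Qed.

End Intertwiner.

Lemma charge_transporters C eta : spacelike_cone C ->
  (forall D, spacelike_cone D -> equivalent_on (region_algebra A (causal_complement D)) eta idfun) ->
  exists xc K a (V : R -> H0 -> H0), [/\ cone_directions C xc K, K a, forall t, unitary_op (V t) &
    forall t B, region_algebra A (causal_complement (translate C (t *: a))) B ->
      V t \o eta B = B \o V t].
Proof.
move=> hC bf; have [xc [K dC]] := spacelike_cone_directions hC.
have [a Ka] := cone_nonempty dC.
have /boolp.choice[V hV] : forall t : R, exists V : H0 -> H0, unitary_op V /\
    forall B, region_algebra A (causal_complement (translate C (t *: a))) B ->
      V \o eta B = B \o V.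
  by move=> t; have [V uV hV] := bf _ (spacelike_cone_translate (t *: a) hC); exists V.
by exists xc, K, a, V; split=> // t; case: (hV t).
Qed.

Lemma representation_sub (K L : hilbertSpace R) (M M' : set (K -> K)) (rho : (K -> K) -> (L -> L)) :
  M' `<=` M -> representation M rho -> representation M' rho.
Proof. by move=> MM [h1 h2 h3 h4 h5 h6]; split=> *; auto. Qed.

Lemma equivariant_extension (C : set M3) (eta : (H0 -> H0) -> (H0 -> H0)) :
  spacelike_cone Sa -> spacelike_cone C ->
  (exists x : M3, C `<=` causal_complement (translate Sa x)) -> localised_BF A Sa C eta ->
  exists etahat : (H -> H) -> (H -> H),
    equivariant_BF_extension A F pi piSa G Sa C eta etahat /\
    (forall etahat', equivariant_BF_extension A F pi piSa G Sa C eta etahat' ->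
       forall T, quasilocal F T -> etahat' T = etahat T).
Proof.
move=> hSa hC [x0 C_Sa] [[eta_rep bf] eta_loc].
move=> [D [y0 [zeta [eta' [zeta' [[hD D_Sa [zeta_rep bz] zeta_loc]]]]]]].
move=> [he hz ee ez [Rr [Rb [[Rr_aux Rb_aux] c_r c_b c_eq1 c_eq2]]]].
have [xc [K [a [V [dC Ka uV hV]]]]] := charge_transporters hC bf.
have [xd [L [d [W [dD Ld uW hW]]]]] := charge_transporters hD bz.
have [etahat [E_rep E_weak E_loc E_impl]] :=
  extension_exists hC dC Ka C_Sa eta_loc uV hV hSa bf.
have [zetahat [Z_rep Z_weak Z_loc Z_impl]] :=
  extension_exists hD dD Ld D_Sa zeta_loc uW hW hSa bz.
have qaux := quasilocal_aux F_vn dSa.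
have E_aux T := extension_aux hC dC Ka C_Sa eta_loc uV hV E_rep E_weak E_loc (T := T).
have Z_aux T := extension_aux hD dD Ld D_Sa zeta_loc uW hW Z_rep Z_weak Z_loc (T := T).
exists etahat; split; last first.
  move=> etahat' [[bf' loc' _] ext' equi'] T.
  exact: (extension_unique hC dC Ka C_Sa eta_loc uV hV E_rep E_loc bf' loc' ext' equi').
split.
- split.
  + by split=> [|D' hD']; [exact: representation_sub qaux E_rep | exact: E_impl].
  + by move=> T cT; exact: (extension_localised hC dC Ka C_Sa eta_loc uV hV E_rep E_loc cT).
  (* Both extensions are already defined and weakly continuous on [aux_algebra F Sa], so each serves
     as its own auxiliary extension. *)
  + exists D, y0, zetahat, etahat, zetahat; split.
      split=> //; last first.
        by move=> T cT; exact: (extension_localised hD dD Ld D_Sa zeta_loc uW hW Z_rep Z_loc cT).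
      by split=> [|D' hD']; [exact: representation_sub qaux Z_rep | exact: Z_impl].
    split=> //.
    exists (piSa Rr), (piSa Rb).
    have [w [wx wy]] := common_translate dSa x0 y0.
    have Mr := intertwiner_cone_vn hSa C_Sa D_Sa eta_loc zeta_loc he hz Rr_aux c_r wx wy.
    have Mb := intertwiner_cone_vn hSa D_Sa C_Sa zeta_loc eta_loc hz he Rb_aux c_b wy wx.
    have [Mer her] := extension_piSa hC dC Ka C_Sa eta_loc uV hV eta_rep E_rep E_weak E_loc he wx Mr.
    have [Mzb hzb] := extension_piSa hD dD Ld D_Sa zeta_loc uW hW zeta_rep Z_rep Z_weak Z_loc hz wy Mb.
    have cA := aux_cstar A_vn dSa.
    have [_ Rr_aux'] := cstar_star cA Rr_aux; have [_ Rb_aux'] := cstar_star cA Rb_aux.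
    split.
    * by split; apply: (aux_cone_vn F_vn (z := w)); exact: piSa_cone_vn.
    * move=> T aT; exact: (intertwiner_lift hSa hC hD dC dD Ka Ld C_Sa D_Sa eta_loc zeta_loc
        uV uW hV hW zeta_rep E_rep Z_rep E_weak Z_weak E_loc Z_loc he hz Rr_aux c_r aT).
    * move=> T aT; exact: (intertwiner_lift hSa hD hC dD dC Ld Ka D_Sa C_Sa zeta_loc eta_loc
        uW uV hW hV eta_rep Z_rep E_rep Z_weak E_weak Z_loc E_loc hz he Rb_aux c_b aT).
    (* By [her] the conjugate equation for the lifts is [piSa] of the one for the observables. *)
    * rewrite her -(rep_adj prep Rb_aux) -(rep_mul prep Rb_aux' (aux_cone_vn A_vn Mer)) c_eq1.
      exact: (rep_unital prep).
    * rewrite hzb -(rep_adj prep Rr_aux) -(rep_mul prep Rr_aux' (aux_cone_vn A_vn Mzb)) c_eq2.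
      exact: (rep_unital prep).
- move=> B; exact: (extension_extends hC dC Ka C_Sa eta_loc uV hV eta_rep E_rep E_loc).
- move=> g T; exact: (extension_equivariant hC dC Ka C_Sa eta_loc uV hV E_rep E_loc).
Qed.

End FieldNet.

Theorem theorem4p3 (R : realType) (H0 H : hilbertSpace R)
    (A : local_net H0) (U0 : spacetime R -> H0 -> H0) (Omega : H0)
    (J : H0 -> H) (pi : (H0 -> H0) -> (H -> H)) (G : set (H -> H)) (F : local_net H)
    (Sa : set (spacetime R)) (piSa : (H0 -> H0) -> (H -> H))
    (hA : observable_net A U0 Omega)
    (hstd : standing_assumptions A U0)
    (hF : complete_normal_field_net A J pi G F)
    (hSa : spacelike_cone Sa)
    (hpi : aux_extension A Sa pi piSa)
    (C : set (spacetime R)) (hC : spacelike_cone C)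
    (hCSa : exists x : spacetime R, C `<=` causal_complement (translate Sa x))
    (eta : (H0 -> H0) -> (H0 -> H0)) (heta : localised_BF A Sa C eta) :
  exists etahat : (H -> H) -> (H -> H),
    equivariant_BF_extension A F pi piSa G Sa C eta etahat /\
    (forall etahat' : (H -> H) -> (H -> H),
       equivariant_BF_extension A F pi piSa G Sa C eta etahat' ->
       forall T, quasilocal F T -> etahat' T = etahat T).
Proof.
have [xs [Ks dSa]] := spacelike_cone_directions hSa.
exact: (equivariant_extension (obs_vn hA) (obs_isotony hA) (obs_duality hA) hF hpi dSa).
Qed.
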